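(* Let $\mathcal{H}(T,A,\mu)$ be a Cauchy--de Branges space of the convergence class and of finite order, and for $\gamma\in\mathbb{C}$ let $$B_\gamma(z)=A(z)\Big(\gamma+\sum_n\frac{\mu_n}{t_n-z}\Big).$$ 1. For every $\gamma\ne0$ the zero set $\mathcal{Z}(B_\gamma)$ (counting multiplicities) is a uniqueness set for $\mathcal{H}(T,A,\mu)$, i.e. the only $F\in\mathcal{H}(T,A,\mu)$ vanishing on $\mathcal{Z}(B_\gamma)$ with at least the corresponding multiplicities is $F\equiv0$. 2. If moreover the space is small, then $\mathcal{Z}(B_0)$ is not a uniqueness set for $\mathcal{H}(T,A,\mu)$, but the subspace of functions in $\mathcal{H}(T,A,\mu)$ vanishing on $\mathcal{Z}(B_0)$ (counting multiplicities) is one-dimensional.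
   Context: Let $T=\{t_n\}_{n\ge1}\subset\mathbb{C}$ be a set of distinct points with $|t_n|\to\infty$, and let $\mu_n>0$ satisfy $\sum_n\frac{\mu_n}{|t_n|^2+1}<\infty$; write $\mu=\sum_n\mu_n\delta_{t_n}$. Let $A$ be an entire function with simple zeros exactly at the points of $T$ and no other zeros. The Cauchy--de Branges space is $\mathcal{H}(T,A,\mu)=\{F(z)=A(z)\sum_n\frac{c_n\mu_n^{1/2}}{z-t_n}:(c_n)\in\ell^2\}$ with norm $\|F\|=\|(c_n)\|_{\ell^2}$; it is a reproducing kernel Hilbert space of entire functions. It is of the convergence class if $\sum_n\frac{\mu_n}{|t_n|+1}<\infty$, and small if $\sum_n\mu_n<\infty$. It is of finite order if all its elements are entire functions of finite order (equivalently, $A$ has finite order). *)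

(* Defs.v *)
From Stdlib Require Import Reals ClassicalEpsilon.
From Coquelicot Require Import Coquelicot.
Open Scope R_scope.

(* Sum of a complex series, computed componentwise (meaningful when the
   series converges). *)
Definition CSeries (a : nat -> C) : C :=
  (Series (fun n => fst (a n)), Series (fun n => snd (a n))).

Definition entire (f : C -> C) : Prop :=
  forall z : C, @ex_derive C_AbsRing C_NormedModule f z.

Definition finite_order (f : C -> C) : Prop :=
  entire f /\
  exists rho R0 : R, 0 < rho /\ 1 <= R0 /\
    forall z : C, R0 <= Cmod z -> Cmod (f z) <= exp (Rpower (Cmod z) rho).

(* Kernel term A(z)/(z - t_n), extended by continuity at z = t_n
   (where A has a simple zero) by the value A'(t_n). *)
Definition Kq (t : nat -> C) (A : C -> C) (n : nat) (z : C) : C :=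
  if excluded_middle_informative (z = t n) then C_derive A (t n)
  else (A z / (z - t n))%C.

(* Element of the Cauchy--de Branges space H(T,A,mu) with coefficient
   sequence c : F(z) = A(z) * sum_n c_n mu_n^{1/2} / (z - t_n). *)
Definition CdB_fun (t : nat -> C) (A : C -> C) (mu : nat -> R) (c : nat -> C)
  : C -> C :=
  fun z => CSeries (fun n => (c n * RtoC (sqrt (mu n)) * Kq t A n z)%C).

Definition inCdB (t : nat -> C) (A : C -> C) (mu : nat -> R) (F : C -> C)
  : Prop :=
  exists c : nat -> C,
    ex_series (fun n => Cmod (c n) ^ 2) /\ F = CdB_fun t A mu c.

(* B_gamma(z) = A(z) (gamma + sum_n mu_n / (t_n - z)), written as the
   everywhere-convergent series gamma A(z) - sum_n mu_n A(z)/(z - t_n),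
   i.e. the entire function obtained by continuous extension at the t_n. *)
Definition Bgamma (t : nat -> C) (A : C -> C) (mu : nat -> R) (gamma : C)
  : C -> C :=
  fun z => (gamma * A z - CSeries (fun n => (RtoC (mu n) * Kq t A n z)%C))%C.

Definition vanishes_to (f : C -> C) (w : C) (k : nat) : Prop :=
  exists g : C -> C, entire g /\ forall z, f z = (Cpow (z - w) k * g z)%C.

Definition vanishes_on_zeros (B F : C -> C) : Prop :=
  forall (w : C) (k : nat), vanishes_to B w k -> vanishes_to F w k.

(* Main.v *)
Require Import Defs.
From Stdlib Require Import Reals Lra Lia ClassicalEpsilon.
From Coquelicot Require Import Coquelicot.
Open Scope R_scope.

(* An element F of the space vanishing on Z(B_gamma) is F = S B_gamma with S entire,
   and S has finite order by Jensen's inequality for B_gamma. Off T one has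
   S = (F/A) / (B_gamma/A), a quotient of two discrete Cauchy transforms. A Cauchy
   transform sum a_n/(z - t_n) with sum |a_n|/(|t_n| + 1) finite tends to zero off a
   set which has small mean on suitable circles |z| = rho in (R, 2R), because
   1/|z - t|^2 has mean 1/|rho^2 - |t|^2| there. So for gamma <> 0 the function S is
   small off such a set, and in the small case with gamma = 0, where F/A is O(1/z)
   and B_0/A is comparable to 1/z, it is bounded off such a set. Scaling S so that
   this bound is 1 and writing M(r) = max log^+ |S| over |z| <= r, the Poisson-Jensen inequality then gives
   M(r) <= eps M(4r) for every eps and large r; since M grows at most polynomially,
   M vanishes. Thus S = 0 if gamma <> 0, and S is constant by Liouville if gamma = 0.
   Circle means are independent of the radius by Goursat's theorem in logarithmic
   coordinates, which yields Cauchy's formula. *)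

(** Nothing separates the [t_n], so a Cauchy transform need not be small on any whole circle; only
    the mean of its potential is. By Chebyshev's inequality the set where the potential of the near
    points reaches 1/2 is then small. Off this set [S] is bounded by hypothesis, on it only by its
    maximum over a larger disc. The radius 4r arises because the circle is taken in (2r, 4r), where
    the Poisson kernel for |z| <= r is at most 3. The two cases differ in the weights of the
    potential. Put a_n = c_n sqrt(mu_n). For gamma <> 0, multiples of |a_n| and mu_n suffice; their
    sums against 1/(|t_n| + 1) are finite by Cauchy-Schwarz and by the convergence class. For gamma
    = 0 the denominator B_0/A also decays, so both transforms are multiplied by z. Since z/(z - t) =
    1 + t/(z - t), the remainders carry the weights |a_n| |t_n| and mu_n |t_n|, which are admissible
    because the space is small, and the denominator keeps the main term sum mu_n > 0. *)

(** * Elementary inequalities for the modulus *)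

Lemma Cmod_sub_sym (a b : C) : Cmod (a - b) = Cmod (b - a).
Proof. rewrite <- Cmod_opp. f_equal. ring. Qed.

Lemma Cmod_diff_le (a b : C) : Rabs (Cmod a - Cmod b) <= Cmod (a - b).
Proof.
  pose proof (Cmod_triangle (a - b) b) as H1.
  pose proof (Cmod_triangle (b - a) a) as H2.
  replace (a - b + b)%C with a in H1 by ring.
  replace (b - a + a)%C with b in H2 by ring.
  rewrite (Cmod_sub_sym b a) in H2. apply Rabs_le. lra.
Qed.

Lemma Cmod_minus_ge (a b : C) : Cmod a - Cmod b <= Cmod (a - b).
Proof. pose proof (Cmod_diff_le a b) as H. apply Rabs_le_between in H. lra. Qed.

Lemma Cmod_minus_le (a b : C) : Cmod (a - b) <= Cmod a + Cmod b.
Proof.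
  replace (a - b)%C with (a + - b)%C by ring.
  rewrite <- (Cmod_opp b). apply Cmod_triangle.
Qed.

Lemma Cmod_pos (x : C) : x <> 0 -> 0 < Cmod x.
Proof. apply Cmod_gt_0. Qed.

Lemma Cmod_zero_le (x : C) : Cmod x <= 0 -> x = 0.
Proof. intros H. apply Cmod_eq_0. pose proof (Cmod_ge_0 x). lra. Qed.

Lemma Csub_eq (a b : C) : (a - b)%C = 0 -> a = b.
Proof. intros H. replace a with (a - b + b)%C by ring. rewrite H. ring. Qed.

Lemma Csub_neq (a b : C) : a <> b -> (a - b)%C <> 0.
Proof. intros H E. apply H, Csub_eq, E. Qed.

(** * Continuity and complex differentiability *)

(** Stated with [Cmod] alone because two structures on [C] are in play: [C_AbsRing] for [ex_derive]
    and [C_R_NormedModule] for [RInt]. Both are reached from this form. *)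
Definition ctn (f : C -> C) (z : C) : Prop :=
  forall e, 0 < e -> exists d, 0 < d /\
    forall w, Cmod (w - z) < d -> Cmod (f w - f z) < e.

Lemma ctn_const (k z : C) : ctn (fun _ => k) z.
Proof.
  intros e He. exists 1. split; [lra|]. intros w _.
  replace (k - k)%C with (RtoC 0) by ring. rewrite Cmod_0. lra.
Qed.

Lemma ctn_id (z : C) : ctn (fun w => w) z.
Proof. intros e He. exists e. auto. Qed.

Lemma ctn_ext_loc (f g : C -> C) (z : C) (r : R) :
  0 < r -> (forall w, Cmod (w - z) < r -> f w = g w) -> ctn f z -> ctn g z.
Proof.
  intros Hr E Hf e He. destruct (Hf e He) as [d [Hd Hw]].
  exists (Rmin d r). split. { apply Rmin_pos; auto. }
  intros w H. rewrite <- !E.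
  - apply Hw. eapply Rlt_le_trans; [exact H|apply Rmin_l].
  - replace (z - z)%C with (RtoC 0) by ring. rewrite Cmod_0. lra.
  - eapply Rlt_le_trans; [exact H|apply Rmin_r].
Qed.

Lemma ctn_ext (f g : C -> C) (z : C) :
  (forall w, f w = g w) -> ctn f z -> ctn g z.
Proof. intros E. apply (ctn_ext_loc _ _ _ 1); auto. lra. Qed.

Lemma ctn_plus (f g : C -> C) (z : C) :
  ctn f z -> ctn g z -> ctn (fun w => (f w + g w)%C) z.
Proof.
  intros Hf Hg e He.
  destruct (Hf (e/2)) as [d1 [H1 H1']]; [lra|].
  destruct (Hg (e/2)) as [d2 [H2 H2']]; [lra|].
  exists (Rmin d1 d2). split. { apply Rmin_pos; auto. }
  intros w H.
  assert (A1 := H1' w (Rlt_le_trans _ _ _ H (Rmin_l _ _))).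
  assert (A2 := H2' w (Rlt_le_trans _ _ _ H (Rmin_r _ _))).
  replace (f w + g w - (f z + g z))%C with ((f w - f z) + (g w - g z))%C by ring.
  pose proof (Cmod_triangle (f w - f z) (g w - g z)). lra.
Qed.

Lemma ctn_bounded (f : C -> C) (z : C) :
  ctn f z -> exists d, 0 < d /\ forall w, Cmod (w - z) < d -> Cmod (f w) <= Cmod (f z) + 1.
Proof.
  intros Hf. destruct (Hf 1 Rlt_0_1) as [d [Hd H]]. exists d. split; auto.
  intros w Hw. pose proof (Cmod_minus_ge (f w) (f z)). specialize (H w Hw). lra.
Qed.

Lemma ctn_mult (f g : C -> C) (z : C) :
  ctn f z -> ctn g z -> ctn (fun w => (f w * g w)%C) z.
Proof.
  intros Hf Hg e He.
  destruct (ctn_bounded f z Hf) as [d0 [H0 H0']].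
  pose proof (Cmod_ge_0 (f z)) as Pf. pose proof (Cmod_ge_0 (g z)) as Pg.
  set (Mf := Cmod (f z) + 1) in *. set (Mg := Cmod (g z) + 1).
  destruct (Hf (e/2/Mg)) as [d1 [H1 H1']].
  { unfold Mg. apply Rdiv_lt_0_compat; lra. }
  destruct (Hg (e/2/Mf)) as [d2 [H2 H2']].
  { unfold Mf. apply Rdiv_lt_0_compat; lra. }
  exists (Rmin d0 (Rmin d1 d2)). split. { repeat apply Rmin_pos; auto. }
  intros w H.
  assert (A0 := H0' w (Rlt_le_trans _ _ _ H (Rmin_l _ _))).
  assert (H' := Rlt_le_trans _ _ _ H (Rmin_r _ _)).
  assert (A1 := H1' w (Rlt_le_trans _ _ _ H' (Rmin_l _ _))).
  assert (A2 := H2' w (Rlt_le_trans _ _ _ H' (Rmin_r _ _))).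
  replace (f w * g w - f z * g z)%C with (f w * (g w - g z) + g z * (f w - f z))%C by ring.
  pose proof (Cmod_triangle (f w * (g w - g z)) (g z * (f w - f z))) as T.
  rewrite !Cmod_mult in T.
  assert (Cmod (f w) * Cmod (g w - g z) <= Mf * (e/2/Mf)).
  { apply Rmult_le_compat; try apply Cmod_ge_0; lra. }
  assert (Cmod (g z) * Cmod (f w - f z) < Mg * (e/2/Mg)).
  { apply Rle_lt_trans with (Cmod (g z) * (e/2/Mg)).
    - apply Rmult_le_compat_l; lra.
    - apply Rmult_lt_compat_r; unfold Mg; [apply Rdiv_lt_0_compat; lra|lra]. }
  replace (Mf * (e/2/Mf)) with (e/2) in * by (field; unfold Mf; lra).
  replace (Mg * (e/2/Mg)) with (e/2) in * by (field; unfold Mg; lra).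
  lra.
Qed.

Lemma ctn_minus (f g : C -> C) (z : C) :
  ctn f z -> ctn g z -> ctn (fun w => (f w - g w)%C) z.
Proof.
  intros Hf Hg.
  apply (ctn_ext (fun w => (f w + (-1) * g w)%C)). { intros; ring. }
  apply ctn_plus; auto. apply ctn_mult; auto. apply ctn_const.
Qed.

Lemma ctn_neq (f : C -> C) (z k : C) :
  ctn f z -> f z <> k -> exists d, 0 < d /\ forall w, Cmod (w - z) < d ->
    Cmod (f z - k) / 2 <= Cmod (f w - k) /\ f w <> k.
Proof.
  intros Hf H. assert (P := Cmod_pos _ (Csub_neq _ _ H)).
  destruct (Hf (Cmod (f z - k) / 2)) as [d [Hd Hw]]; [lra|].
  exists d. split; auto. intros w Hw'. specialize (Hw w Hw').
  pose proof (Cmod_minus_ge (f z - k) (f z - f w)) as T.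
  rewrite (Cmod_sub_sym (f z) (f w)) in T.
  replace (f z - k - (f z - f w))%C with (f w - k)%C in T by ring.
  split; [lra|]. intros E. rewrite E in T.
  replace (k - k)%C with (RtoC 0) in T by ring. rewrite Cmod_0 in T.
  rewrite E in Hw. rewrite (Cmod_sub_sym k) in Hw. rewrite (Cmod_sub_sym k) in T. lra.
Qed.

Lemma ctn_inv (f : C -> C) (z : C) :
  ctn f z -> f z <> 0 -> ctn (fun w => (/ f w)%C) z.
Proof.
  intros Hf Hz e He.
  destruct (ctn_neq f z 0 Hf Hz) as [d0 [H0 H0']].
  assert (P : 0 < Cmod (f z)) by (apply Cmod_pos; auto).
  replace (f z - 0)%C with (f z) in H0' by ring.
  set (m := Cmod (f z)) in *.
  destruct (Hf (e * (m * m) / 2)) as [d1 [H1 H1']].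
  { assert (0 < e * (m * m)) by (repeat apply Rmult_lt_0_compat; auto). lra. }
  exists (Rmin d0 d1). split. { apply Rmin_pos; auto. }
  intros w H.
  destruct (H0' w (Rlt_le_trans _ _ _ H (Rmin_l _ _))) as [A0 A0'].
  assert (A1 := H1' w (Rlt_le_trans _ _ _ H (Rmin_r _ _))).
  replace (f w - 0)%C with (f w) in A0 by ring.
  replace (/ f w - / f z)%C with (- (f w - f z) / (f w * f z))%C by (field; auto).
  assert (f w * f z <> 0)%C by (apply Cmult_neq_0; auto).
  rewrite Cmod_div, Cmod_opp, Cmod_mult; auto. fold m.
  apply Rmult_lt_reg_r with (Cmod (f w) * m). { apply Rmult_lt_0_compat; lra. }
  unfold Rdiv. rewrite Rmult_assoc, Rinv_l, Rmult_1_r.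
  2:{ apply Rgt_not_eq, Rmult_lt_0_compat; lra. }
  eapply Rlt_le_trans; [exact A1|]. unfold Rdiv. rewrite Rmult_assoc.
  apply Rmult_le_compat_l; [lra|]. nra.
Qed.

Lemma ctn_comp (g f : C -> C) (z : C) :
  ctn f z -> ctn g (f z) -> ctn (fun w => g (f w)) z.
Proof.
  intros Hf Hg e He. destruct (Hg e He) as [d [Hd Hw]].
  destruct (Hf d Hd) as [d' [Hd' Hw']]. exists d'. split; auto.
Qed.

Lemma ctn_pow (f : C -> C) (n : nat) (z : C) :
  ctn f z -> ctn (fun w => (f w ^ n)%C) z.
Proof.
  intros Hf. induction n as [|n IH]; simpl.
  - apply ctn_const.
  - apply ctn_mult; auto.
Qed.

Lemma ctn_Cmod (f : C -> C) (z : C) :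
  ctn f z -> ctn (fun w => RtoC (Cmod (f w))) z.
Proof.
  intros Hf e He. destruct (Hf e He) as [d [Hd H]]. exists d. split; auto.
  intros w Hw. rewrite <- RtoC_minus, Cmod_R.
  eapply Rle_lt_trans; [apply Cmod_diff_le|]. auto.
Qed.

Lemma ctn_real (u : R -> R) (g : C -> R) (z : C) :
  continuity_pt u (g z) -> ctn (fun w => RtoC (g w)) z -> ctn (fun w => RtoC (u (g w))) z.
Proof.
  intros Hu Hg e He. destruct (Hu e He) as [d [Hd H]].
  destruct (Hg d Hd) as [d' [Hd' H']]. exists d'. split; auto.
  intros w Hw. specialize (H' w Hw). rewrite <- RtoC_minus, Cmod_R in *.
  (* [continuity_pt] says nothing at the base point itself. *)
  destruct (Req_dec (g w) (g z)) as [E|E].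
  - rewrite E, Rminus_diag, Rabs_R0. auto.
  - apply H. split; [split; [exact I|auto]|exact H'].
Qed.

(** Caratheodory's form of differentiability, with derivative [q z]. The product and chain rules
    become identities between quotients, and in [entire_quotient] the function [q] is itself the
    object wanted. *)
Definition cdiff (f : C -> C) (z : C) : Prop :=
  exists q, ctn q z /\ forall w, (f w - f z = q w * (w - z))%C.

Lemma cdiff_ctn f z : cdiff f z -> ctn f z.
Proof.
  intros [q [Hq E]].
  apply (ctn_ext (fun w => (f z + q w * (w - z))%C)).
  { intros w. rewrite <- E. ring. }
  apply ctn_plus; [apply ctn_const|]. apply ctn_mult; auto.
  apply ctn_minus; [apply ctn_id|apply ctn_const].
Qed.

Lemma cdiff_const k z : cdiff (fun _ => k) z.
Proof. exists (fun _ => RtoC 0). split; [apply ctn_const|intros; ring]. Qed.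

Lemma cdiff_id z : cdiff (fun w => w) z.
Proof. exists (fun _ => RtoC 1). split; [apply ctn_const|intros; ring]. Qed.

Lemma cdiff_plus f g z : cdiff f z -> cdiff g z -> cdiff (fun w => (f w + g w)%C) z.
Proof.
  intros [q [Hq E]] [p [Hp E']]. exists (fun w => (q w + p w)%C). split.
  - apply ctn_plus; auto.
  - intros w. rewrite Cmult_plus_distr_r, <- E, <- E'. ring.
Qed.

Lemma cdiff_mult f g z : cdiff f z -> cdiff g z -> cdiff (fun w => (f w * g w)%C) z.
Proof.
  intros Hf Hg. pose proof (cdiff_ctn _ _ Hg) as Cg.
  destruct Hf as [q [Hq E]], Hg as [p [Hp E']].
  exists (fun w => (q w * g w + f z * p w)%C). split.
  - apply ctn_plus; apply ctn_mult; auto. apply ctn_const.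
  - intros w. replace ((q w * g w + f z * p w) * (w - z))%C
      with (q w * (w - z) * g w + f z * (p w * (w - z)))%C by ring.
    rewrite <- E, <- E'. ring.
Qed.

Lemma cdiff_ext f g z : (forall w, f w = g w) -> cdiff f z -> cdiff g z.
Proof. intros E [q [Hq H]]. exists q. split; auto. intros w. rewrite <- !E. auto. Qed.

Lemma cdiff_minus f g z : cdiff f z -> cdiff g z -> cdiff (fun w => (f w - g w)%C) z.
Proof.
  intros Hf Hg. apply (cdiff_ext (fun w => (f w + (-1) * g w)%C)). { intros; ring. }
  apply cdiff_plus; auto. apply cdiff_mult; auto. apply cdiff_const.
Qed.

Lemma cdiff_opp f z : cdiff f z -> cdiff (fun w => (- f w)%C) z.
Proof.
  intros Hf. apply (cdiff_ext (fun w => ((-1) * f w)%C)). { intros; ring. }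
  apply cdiff_mult; auto. apply cdiff_const.
Qed.

Lemma cdiff_comp g f z : cdiff f z -> cdiff g (f z) -> cdiff (fun w => g (f w)) z.
Proof.
  intros Hf [p [Hp E']]. pose proof (cdiff_ctn _ _ Hf) as Cf. destruct Hf as [q [Hq E]].
  exists (fun w => (p (f w) * q w)%C). split.
  - apply ctn_mult; auto. apply (ctn_comp p f); auto.
  - intros w. rewrite E', E. ring.
Qed.

Lemma cdiff_pow f n z : cdiff f z -> cdiff (fun w => (f w ^ n)%C) z.
Proof.
  intros Hf. induction n as [|n IH]; simpl.
  - apply cdiff_const.
  - apply cdiff_mult; auto.
Qed.

(* Away from [z] the quotient is forced to be the difference quotient, so local
   agreement is enough. *)
Lemma cdiff_ext_loc f g z r :
  0 < r -> (forall w, Cmod (w - z) < r -> f w = g w) -> cdiff f z -> cdiff g z.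
Proof.
  intros Hr E [q [Hq H]].
  assert (Ez : f z = g z).
  { apply E. replace (z - z)%C with (RtoC 0) by ring. rewrite Cmod_0. auto. }
  exists (fun w => if Ceq_dec w z then q z else ((g w - g z) / (w - z))%C).
  split.
  - apply (ctn_ext_loc q _ z r Hr); auto.
    intros w Hw. destruct (Ceq_dec w z) as [->|N]; auto.
    rewrite <- (E w Hw), <- Ez, H. field. apply Csub_neq; auto.
  - intros w. destruct (Ceq_dec w z) as [->|N]; [ring|]. field. apply Csub_neq; auto.
Qed.

Lemma cdiff_inv f z : cdiff f z -> f z <> 0 -> cdiff (fun w => (/ f w)%C) z.
Proof.
  intros Hf Hz. pose proof (cdiff_ctn _ _ Hf) as Cf.
  destruct (ctn_neq f z 0 Cf Hz) as [d [Hd H]]. destruct Hf as [q [Hq E]].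
  (* The quotient identity is required for all [w], even where [f w = 0] and [/ f w] is a default
     value. Only near [z] is this quotient known to equal [- q w / (f w * f z)]. *)
  exists (fun w => if Ceq_dec w z then (- q z / (f z * f z))%C
            else ((/ f w - / f z) / (w - z))%C).
  split.
  - apply (ctn_ext_loc (fun w => (- 1 * q w * / (f w * f z))%C) _ z d Hd).
    + intros w Hw. destruct (Ceq_dec w z) as [->|N].
      * unfold Cdiv. ring.
      * destruct (H w Hw) as [_ Hw']. assert (w - z <> 0)%C by (apply Csub_neq; auto).
        replace (/ f w - / f z)%C with (- (f w - f z) / (f w * f z))%C by (field; auto).
        rewrite E. field. auto.
    + apply ctn_mult; [apply ctn_mult; auto; apply ctn_const|].
      apply ctn_inv. { apply ctn_mult; auto. apply ctn_const. }
      apply Cmult_neq_0; auto.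
  - intros w. destruct (Ceq_dec w z) as [->|N]; [ring|].
    generalize (/ f w)%C (/ f z)%C. intros a b. field. apply Csub_neq; auto.
Qed.

Lemma is_derive_quotient (f : C -> C) (z l : C) :
  @is_derive C_AbsRing C_NormedModule f z l ->
  exists q, ctn q z /\ q z = l /\ forall w, (f w - f z = q w * (w - z))%C.
Proof.
  intros [_ H]. specialize (H z (fun P HP => HP)).
  set (q := fun w => if Ceq_dec w z then l else ((f w - f z) / (w - z))%C).
  assert (qz : q z = l). { unfold q. destruct (Ceq_dec z z); [auto|congruence]. }
  exists q. split; [|split; [exact qz|]].
  - intros e He. assert (He2 : 0 < e / 2) by lra.
    destruct (H (mkposreal _ He2)) as [d Hd].
    exists d. split; [apply cond_pos|]. intros w Hw. rewrite qz.
    unfold q. destruct (Ceq_dec w z) as [->|N].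
    { replace (l - l)%C with (RtoC 0) by ring. rewrite Cmod_0. auto. }
    specialize (Hd w Hw). simpl in Hd.
    change (Cmod ((f w - f z) - (w - z) * l) <= e / 2 * Cmod (w - z))%C in Hd.
    assert (N' := Csub_neq _ _ N). assert (P := Cmod_pos _ N').
    replace ((f w - f z) / (w - z) - l)%C
      with (((f w - f z) - (w - z) * l) / (w - z))%C by (field; auto).
    rewrite Cmod_div; auto.
    apply Rmult_lt_reg_r with (Cmod (w - z)); auto.
    unfold Rdiv at 1. rewrite Rmult_assoc, Rinv_l, Rmult_1_r; nra.
  - intros w. unfold q. destruct (Ceq_dec w z) as [->|N]; [ring|].
    field. apply Csub_neq; auto.
Qed.

Lemma quotient_is_derive (f q : C -> C) (z : C) :
  ctn q z -> (forall w, (f w - f z = q w * (w - z))%C) ->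
  @is_derive C_AbsRing C_NormedModule f z (q z).
Proof.
  intros Hq E. split.
  - apply (@is_linear_scal_l C_AbsRing C_NormedModule).
  - intros x Hx. assert (z = x) as <-.
    { apply (is_filter_lim_locally_unique _ _ Hx). }
    intros [e He]. destruct (Hq e He) as [d [Hd H]].
    exists (mkposreal d Hd). intros w Hw. specialize (H w Hw). simpl.
    change (Cmod ((f w - f z) - (w - z) * q z) <= e * Cmod (w - z))%C.
    rewrite E. replace (q w * (w - z) - (w - z) * q z)%C with ((q w - q z) * (w - z))%C by ring.
    rewrite Cmod_mult. apply Rmult_le_compat_r; [apply Cmod_ge_0|lra].
Qed.

Lemma cdiff_ex_derive (f : C -> C) (z : C) :
  cdiff f z <-> @ex_derive C_AbsRing C_NormedModule f z.
Proof.
  split.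
  - intros [q [Hq E]]. exists (q z). apply quotient_is_derive; auto.
  - intros [l Hl]. destruct (is_derive_quotient _ _ _ Hl) as [q [Hq [_ E]]].
    exists q; auto.
Qed.

Lemma entire_cdiff (f : C -> C) : entire f <-> forall z, cdiff f z.
Proof. split; intros H z; apply cdiff_ex_derive, H. Qed.

Lemma C_derive_quotient (f : C -> C) (z : C) : cdiff f z ->
  exists q, ctn q z /\ q z = C_derive f z /\ forall w, (f w - f z = q w * (w - z))%C.
Proof.
  intros [q [Hq E]]. exists q. split; auto. split; auto.
  symmetry. apply is_C_derive_unique. apply quotient_is_derive; auto.
Qed.

(** * The complex exponential *)

Definition Cexp (z : C) : C := (exp (fst z) * cos (snd z), exp (fst z) * sin (snd z)).

Lemma Cexp_plus (z w : C) : Cexp (z + w) = (Cexp z * Cexp w)%C.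
Proof.
  unfold Cexp, Cmult, Cplus. simpl. rewrite exp_plus, cos_plus, sin_plus. f_equal; ring.
Qed.

Lemma Cmod_Cexp (z : C) : Cmod (Cexp z) = exp (fst z).
Proof.
  unfold Cmod, Cexp. simpl.
  replace (exp (fst z) * cos (snd z) * (exp (fst z) * cos (snd z) * 1)
    + exp (fst z) * sin (snd z) * (exp (fst z) * sin (snd z) * 1))
    with (exp (fst z) * exp (fst z) * (Rsqr (sin (snd z)) + Rsqr (cos (snd z))))
    by (unfold Rsqr; ring).
  rewrite sin2_cos2, Rmult_1_r. apply sqrt_square. left; apply exp_pos.
Qed.

Lemma derivable_pt_lim_mult_error (u : R -> R) (l : R) : derivable_pt_lim u 0 l ->
  forall e, 0 < e -> exists d, 0 < d /\ forall h, Rabs h < d -> Rabs (u h - u 0 - l * h) <= e * Rabs h.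
Proof.
  intros H e He. destruct (H e He) as [d Hd]. exists d. split; [apply cond_pos|].
  intros h Hh. destruct (Req_dec h 0) as [->|N].
  { replace (u 0 - u 0 - l * 0) with 0 by ring. rewrite Rabs_R0. lra. }
  specialize (Hd h N Hh). rewrite Rplus_0_l in Hd.
  replace (u h - u 0 - l * h) with (((u h - u 0) / h - l) * h) by (field; auto).
  rewrite Rabs_mult. apply Rmult_le_compat_r; [apply Rabs_pos|lra].
Qed.

Lemma Cmod_le_sum (z : C) : Cmod z <= Rabs (fst z) + Rabs (snd z).
Proof.
  destruct z as [x y]. pose proof (Cmod_triangle (RtoC x) (Ci * RtoC y)) as T.
  rewrite Cmod_mult, Cmod_Ci, !Cmod_R, Rmult_1_l in T. simpl.
  replace (RtoC x + Ci * RtoC y)%C with ((x, y) : C) in T; auto.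
  unfold RtoC, Ci, Cplus, Cmult; simpl. f_equal; simpl; ring.
Qed.

Lemma fst_le_Cmod (z : C) : Rabs (fst z) <= Cmod z.
Proof. eapply Rle_trans; [apply Rmax_l|apply Rmax_Cmod]. Qed.

Lemma snd_le_Cmod (z : C) : Rabs (snd z) <= Cmod z.
Proof. eapply Rle_trans; [apply Rmax_r|apply Rmax_Cmod]. Qed.

(** With [x], [y], [w] the first order errors of [exp a], [cos b], [sin b], the components of the
    error are [x + (1 + a + x) * y] and [(1 + a + x) * w + (a + x) * b]. The factor [1 + a + x] is
    at most 2 in modulus, and the last product is quadratic in [Cmod h]. *)
Lemma Cexp_error_0 : forall e, 0 < e -> exists d, 0 < d /\
  forall h, Cmod h < d -> Cmod (Cexp h - 1 - h) <= e * Cmod h.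
Proof.
  intros e He.
  destruct (derivable_pt_lim_mult_error exp 1) with (e := Rmin 1 (e/8)) as [d1 [H1 E1]].
  { replace 1 with (exp 0) by apply exp_0. apply derivable_pt_lim_exp. }
  { apply Rmin_pos; lra. }
  destruct (derivable_pt_lim_mult_error cos 0) with (e := e/16) as [d2 [H2 E2]].
  { replace 0 with (- sin 0) at 2 by (rewrite sin_0; ring). apply derivable_pt_lim_cos. }
  { lra. }
  destruct (derivable_pt_lim_mult_error sin 1) with (e := e/16) as [d3 [H3 E3]].
  { replace 1 with (cos 0) by apply cos_0. apply derivable_pt_lim_sin. }
  { lra. }
  exists (Rmin (Rmin d1 (Rmin d2 d3)) (Rmin (1/2) (e/8))). split.
  { repeat apply Rmin_pos; auto; lra. }
  intros h Hh.
  assert (Hh1 := Rlt_le_trans _ _ _ Hh (Rmin_l _ _)).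
  assert (Hh2 := Rlt_le_trans _ _ _ Hh (Rmin_r _ _)).
  assert (A1 := Rlt_le_trans _ _ _ Hh1 (Rmin_l _ _)).
  assert (Hh3 := Rlt_le_trans _ _ _ Hh1 (Rmin_r _ _)).
  assert (A2 := Rlt_le_trans _ _ _ Hh3 (Rmin_l _ _)).
  assert (A3 := Rlt_le_trans _ _ _ Hh3 (Rmin_r _ _)).
  assert (A4 := Rlt_le_trans _ _ _ Hh2 (Rmin_l _ _)).
  assert (A5 := Rlt_le_trans _ _ _ Hh2 (Rmin_r _ _)).
  pose proof (fst_le_Cmod h) as Fa. pose proof (snd_le_Cmod h) as Fb.
  set (m := Cmod h) in *. destruct h as [a b]. simpl in Fa, Fb.
  assert (B1 := E1 a (Rle_lt_trans _ _ _ Fa A1)).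
  assert (B2 := E2 b (Rle_lt_trans _ _ _ Fb A2)).
  assert (B3 := E3 b (Rle_lt_trans _ _ _ Fb A3)).
  rewrite exp_0 in B1. rewrite cos_0 in B2. rewrite sin_0 in B3.
  eapply Rle_trans; [apply Cmod_le_sum|]. simpl.
  assert (Mn1 := Rmin_l 1 (e/8)). assert (Mn2 := Rmin_r 1 (e/8)).
  set (k := Rmin 1 (e/8)) in *.
  pose proof (Rabs_pos a) as Pa. pose proof (Rabs_pos b) as Pb.
  assert (B1a : Rabs (exp a - 1 - 1 * a) <= Rabs a) by nra.
  assert (B1b : Rabs (exp a - 1 - 1 * a) <= e/8 * m) by nra.
  assert (B2a : Rabs (cos b - 1 - 0 * b) <= e/16 * m) by nra.
  assert (B3a : Rabs (sin b - 0 - 1 * b) <= e/16 * m) by nra.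
  set (x := exp a - 1 - 1 * a) in *. set (y := cos b - 1 - 0 * b) in *.
  set (w := sin b - 0 - 1 * b) in *.
  replace (exp a * cos b + - (1) + - a) with (x + (1 + a + x) * y) by (unfold x, y; ring).
  replace (exp a * sin b + - 0 + - b) with ((1 + a + x) * w + (a + x) * b) by (unfold x, w; ring).
  pose proof (Rabs_triang x ((1 + a + x) * y)) as T1.
  pose proof (Rabs_triang ((1 + a + x) * w) ((a + x) * b)) as T2.
  rewrite Rabs_mult in T1. rewrite !Rabs_mult in T2.
  pose proof (Rabs_triang (1 + a) x) as T3. pose proof (Rabs_triang 1 a) as T4.
  pose proof (Rabs_triang a x) as T5. rewrite (Rabs_pos_eq 1) in T4 by lra.
  pose proof (Rabs_pos x). pose proof (Rabs_pos y). pose proof (Rabs_pos w).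
  pose proof (Rabs_pos (1+a+x)). pose proof (Rabs_pos (a+x)).
  assert (Rabs (1 + a + x) * Rabs y <= 2 * (e/16*m)) by (apply Rmult_le_compat; lra).
  assert (Rabs (1 + a + x) * Rabs w <= 2 * (e/16*m)) by (apply Rmult_le_compat; lra).
  assert (Rabs (a + x) * Rabs b <= (2 * m) * m) by (apply Rmult_le_compat; lra).
  assert (2 * m * m <= 2 * (e/8) * m) by (apply Rmult_le_compat_r; lra).
  lra.
Qed.

Lemma cdiff_Cexp (z : C) : cdiff Cexp z.
Proof.
  exists (fun w => if Ceq_dec w z then Cexp z else ((Cexp w - Cexp z) / (w - z))%C).
  split.
  - intros e He. assert (P : 0 < Cmod (Cexp z)) by (rewrite Cmod_Cexp; apply exp_pos).
    destruct (Cexp_error_0 (e / 2 / Cmod (Cexp z))) as [d [Hd H]].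
    { apply Rdiv_lt_0_compat; lra. }
    exists d. split; auto. intros w Hw.
    destruct (Ceq_dec z z) as [_|]; [|congruence].
    destruct (Ceq_dec w z) as [->|N].
    { replace (Cexp z - Cexp z)%C with (RtoC 0) by ring. rewrite Cmod_0. auto. }
    assert (N' := Csub_neq _ _ N). assert (P' := Cmod_pos _ N'). specialize (H _ Hw).
    replace (Cexp w) with (Cexp z * Cexp (w - z))%C by (rewrite <- Cexp_plus; f_equal; ring).
    replace ((Cexp z * Cexp (w - z) - Cexp z) / (w - z) - Cexp z)%C
      with (Cexp z * (Cexp (w - z) - 1 - (w - z)) / (w - z))%C by (field; auto).
    rewrite Cmod_div, Cmod_mult; auto.
    apply Rmult_lt_reg_r with (Cmod (w - z)); auto.
    unfold Rdiv. rewrite Rmult_assoc, Rinv_l, Rmult_1_r by lra.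
    apply Rle_lt_trans with (Cmod (Cexp z) * (e / 2 / Cmod (Cexp z) * Cmod (w - z))).
    + apply Rmult_le_compat_l; lra.
    + replace (Cmod (Cexp z) * (e / 2 / Cmod (Cexp z) * Cmod (w - z)))
        with (e / 2 * Cmod (w - z)) by (field; lra). nra.
  - intros w. destruct (Ceq_dec w z) as [->|N]; [ring|]. field. apply Csub_neq; auto.
Qed.

(** * Integrals of complex functions along the real axis *)

(** The integrand is a function on [C] restricted to the real axis, so that parametrised curves are
    compositions to which the rules for [ctn] apply. *)
Definition cint (f : C -> C) (a b : R) : C :=
  @RInt C_R_CompleteNormedModule (fun x => f (RtoC x)) a b.

Definition icont (f : C -> C) (a b : R) : Prop :=
  forall x, a <= x <= b -> ctn f (RtoC x).

Lemma ctn_continuous (f : C -> C) (x : R) :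
  ctn f (RtoC x) -> @continuous R_UniformSpace C_R_NormedModule (fun y => f (RtoC y)) x.
Proof.
  intros Hf P [e HP]. destruct (Hf e (cond_pos e)) as [d [Hd H]].
  exists (mkposreal d Hd). intros y Hy. apply HP.
  apply C_NormedModule_mixin_compat1. apply H.
  rewrite <- RtoC_minus, Cmod_R. exact Hy.
Qed.

Lemma icont_ex f a b : a <= b -> icont f a b ->
  @ex_RInt C_R_NormedModule (fun x => f (RtoC x)) a b.
Proof.
  intros Hab H. apply (@ex_RInt_continuous C_R_CompleteNormedModule).
  intros z Hz. rewrite Rmin_left, Rmax_right in Hz by auto. apply ctn_continuous; auto.
Qed.

Lemma icont_is f a b : a <= b -> icont f a b ->
  @is_RInt C_R_NormedModule (fun x => f (RtoC x)) a b (cint f a b).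
Proof. intros H H'. apply (@RInt_correct C_R_CompleteNormedModule), icont_ex; auto. Qed.

Lemma cint_fst f a b : a <= b -> icont f a b ->
  is_RInt (fun x => fst (f (RtoC x))) a b (fst (cint f a b)).
Proof.
  intros H H'. apply (@is_RInt_fct_extend_fst R_NormedModule R_NormedModule (fun x => f (RtoC x))), (icont_is f); auto.
Qed.

Lemma cint_snd f a b : a <= b -> icont f a b ->
  is_RInt (fun x => snd (f (RtoC x))) a b (snd (cint f a b)).
Proof.
  intros H H'. apply (@is_RInt_fct_extend_snd R_NormedModule R_NormedModule (fun x => f (RtoC x))), (icont_is f); auto.
Qed.

Lemma is_cint f a b (l : C) :
  is_RInt (fun x => fst (f (RtoC x))) a b (fst l) ->
  is_RInt (fun x => snd (f (RtoC x))) a b (snd l) -> cint f a b = l.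
Proof.
  intros H1 H2. apply (@is_RInt_unique C_R_CompleteNormedModule).
  destruct l as [l1 l2].
  apply (@is_RInt_fct_extend_pair R_NormedModule R_NormedModule (fun x => f (RtoC x)) a b l1 l2); auto.
Qed.

Lemma cint_ext f g a b : a <= b -> (forall x, a <= x <= b -> f (RtoC x) = g (RtoC x)) -> cint f a b = cint g a b.
Proof.
  intros H E. apply (@RInt_ext C_R_CompleteNormedModule (fun x => f (RtoC x)) (fun x => g (RtoC x))). intros x Hx. rewrite Rmin_left, Rmax_right in Hx by auto.
  apply E. lra.
Qed.

Lemma cint_plus f g a b : a <= b -> icont f a b -> icont g a b ->
  cint (fun x => (f x + g x)%C) a b = (cint f a b + cint g a b)%C.
Proof.
  intros H Hf Hg. apply is_cint.
  - apply (is_RInt_plus (V := R_NormedModule)); apply cint_fst; auto.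
  - apply (is_RInt_plus (V := R_NormedModule)); apply cint_snd; auto.
Qed.

Lemma cint_scal k f a b : a <= b -> icont f a b ->
  cint (fun x => (k * f x)%C) a b = (k * cint f a b)%C.
Proof.
  intros H Hf. apply is_cint.
  - apply (is_RInt_minus (V := R_NormedModule)); apply (is_RInt_scal (V := R_NormedModule)); [apply cint_fst|apply cint_snd]; auto.
  - apply (is_RInt_plus (V := R_NormedModule)); apply (is_RInt_scal (V := R_NormedModule)); [apply cint_snd|apply cint_fst]; auto.
Qed.

Lemma icont_const k a b : icont (fun _ => k) a b.
Proof. intros x _. apply ctn_const. Qed.

Lemma cint_const k a b : cint (fun _ => k) a b = (k * (b - a))%C.
Proof.
  apply is_cint; simpl.
  - replace (fst k * (b + - a) - snd k * (0 + - 0)) with ((b - a) * fst k) by ring.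
    apply (is_RInt_const (V := R_NormedModule)).
  - replace (fst k * (0 + - 0) + snd k * (b + - a)) with ((b - a) * snd k) by ring.
    apply (is_RInt_const (V := R_NormedModule)).
Qed.

Lemma cint_id a b : cint (fun x => x) a b = ((b * b - a * a) / 2)%C.
Proof.
  replace ((b * b - a * a) / 2)%C with (RtoC (b * b / 2 - a * a / 2)).
  2:{ rewrite RtoC_minus, !RtoC_div, !RtoC_mult by lra. field. }
  apply is_cint; simpl.
  - apply (is_RInt_derive (V := R_CompleteNormedModule) (fun x => x * x / 2)).
    + intros x _. auto_derive; auto. field.
    + intros x _. apply continuous_id.
  - assert (H : is_RInt (fun _ => 0) a b ((b - a) * 0)) by apply (is_RInt_const (V := R_NormedModule)).
    rewrite Rmult_0_r in H. exact H.
Qed.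

Lemma cint_Chasles f a b c : a <= b -> b <= c -> icont f a c ->
  cint f a c = (cint f a b + cint f b c)%C.
Proof.
  intros H1 H2 Hf. symmetry. apply (@RInt_Chasles C_R_CompleteNormedModule);
  apply icont_ex; auto; intros x Hx; apply Hf; lra.
Qed.

Lemma cint_norm f a b M : a <= b -> icont f a b ->
  (forall x, a <= x <= b -> Cmod (f (RtoC x)) <= M) -> Cmod (cint f a b) <= (b - a) * M.
Proof.
  intros H Hf HM. rewrite Cmod_norm.
  apply (@norm_RInt_le_const C_R_NormedModule (fun x => f (RtoC x)) a b); auto.
  - intros x Hx. specialize (HM x Hx). rewrite Cmod_norm in HM. exact HM.
  - apply icont_is; auto.
Qed.

(** * Goursat's theorem for rectangles *)

Definition hside (g : C -> C) (y a b : R) : C := cint (fun s => g (s + Ci * y)%C) a b.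
Definition vside (g : C -> C) (x c d : R) : C := cint (fun s => g (x + Ci * s)%C) c d.

(** The contour integral over the boundary, counterclockwise; the factor [Ci] comes from [dz] on the
    vertical sides. *)
Definition rect (g : C -> C) (a b c d : R) : C :=
  (hside g c a b - hside g d a b + Ci * (vside g b c d - vside g a c d))%C.

Definition on_rect (P : C -> Prop) (a b c d : R) : Prop :=
  forall x y, a <= x <= b -> c <= y <= d -> P (RtoC x + Ci * RtoC y)%C.

Lemma hside_icont g y a b c d :
  on_rect (ctn g) a b c d -> c <= y <= d -> icont (fun s => g (s + Ci * y)%C) a b.
Proof.
  intros H Hy x Hx. apply (ctn_comp g (fun s => s + Ci * y)%C); [|apply H; auto].
  apply ctn_plus; [apply ctn_id|apply ctn_const].
Qed.

Lemma vside_icont g x a b c d :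
  on_rect (ctn g) a b c d -> a <= x <= b -> icont (fun s => g (x + Ci * s)%C) c d.
Proof.
  intros H Hx y Hy. apply (ctn_comp g (fun s => x + Ci * s)%C); [|apply H; auto].
  apply ctn_plus; [apply ctn_const|]. apply ctn_mult; [apply ctn_const|apply ctn_id].
Qed.

Lemma rect_split_x g a m b c d : a <= m <= b -> c <= d -> on_rect (ctn g) a b c d ->
  rect g a b c d = (rect g a m c d + rect g m b c d)%C.
Proof.
  intros Hm Hd H. unfold rect, hside.
  rewrite (cint_Chasles (fun s => g (s + Ci * c)%C) a m b), (cint_Chasles (fun s => g (s + Ci * d)%C) a m b); try lra.
  - ring.
  - apply (hside_icont g d a b c d); auto; lra.
  - apply (hside_icont g c a b c d); auto; lra.
Qed.

Lemma rect_split_y g a b c m d : a <= b -> c <= m <= d -> on_rect (ctn g) a b c d ->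
  rect g a b c d = (rect g a b c m + rect g a b m d)%C.
Proof.
  intros Hb Hm H. unfold rect, vside.
  rewrite (cint_Chasles (fun s => g (a + Ci * s)%C) c m d), (cint_Chasles (fun s => g (b + Ci * s)%C) c m d); try lra.
  - ring.
  - apply (vside_icont g b a b c d); auto; lra.
  - apply (vside_icont g a a b c d); auto; lra.
Qed.

Lemma on_rect_sub P a b c d a' b' c' d' :
  on_rect P a b c d -> a <= a' -> b' <= b -> c <= c' -> d' <= d -> on_rect P a' b' c' d'.
Proof. intros H ? ? ? ? x y Hx Hy. apply H; lra. Qed.

Lemma rect_plus g h a b c d : a <= b -> c <= d ->
  on_rect (ctn g) a b c d -> on_rect (ctn h) a b c d ->
  rect (fun z => (g z + h z)%C) a b c d = (rect g a b c d + rect h a b c d)%C.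
Proof.
  intros Hb Hd Hg Hh. unfold rect, hside, vside.
  rewrite (cint_plus (fun s => g (s + Ci * c)%C) (fun s => h (s + Ci * c)%C)),
    (cint_plus (fun s => g (s + Ci * d)%C) (fun s => h (s + Ci * d)%C)),
    (cint_plus (fun s => g (a + Ci * s)%C) (fun s => h (a + Ci * s)%C)),
    (cint_plus (fun s => g (b + Ci * s)%C) (fun s => h (b + Ci * s)%C)); auto;
    first [ring | eapply hside_icont; eauto; lra | eapply vside_icont; eauto; lra].
Qed.

Lemma cint_affine k l a b : a <= b ->
  cint (fun s => (k + l * s)%C) a b = (k * (b - a) + l * ((b * b - a * a) / 2))%C.
Proof.
  intros H. assert (icont (fun s : C => s) a b) by (intros x _; apply ctn_id).
  rewrite cint_plus, cint_const, cint_scal, cint_id; auto.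
  - apply icont_const.
  - intros x _. apply ctn_mult; [apply ctn_const|apply ctn_id].
Qed.

Lemma rect_affine k l a b c d : a <= b -> c <= d -> rect (fun z => (k + l * z)%C) a b c d = 0.
Proof.
  intros Hb Hd. unfold rect, hside, vside.
  rewrite (cint_ext _ (fun s => (k + l * (Ci * c)) + l * s)%C a b) by (auto; intros; ring).
  rewrite (cint_ext (fun s => k + l * (s + Ci * d))%C (fun s => (k + l * (Ci * d)) + l * s)%C a b) by (auto; intros; ring).
  rewrite (cint_ext (fun s => k + l * (b + Ci * s))%C (fun s => (k + l * b) + (l * Ci) * s)%C c d) by (auto; intros; ring).
  rewrite (cint_ext (fun s => k + l * (a + Ci * s))%C (fun s => (k + l * a) + (l * Ci) * s)%C c d) by (auto; intros; ring).
  rewrite !cint_affine by auto. unfold Cdiv.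
  ring.
Qed.

Lemma rect_bound g a b c d M : a <= b -> c <= d -> on_rect (ctn g) a b c d ->
  on_rect (fun z => Cmod (g z) <= M) a b c d ->
  Cmod (rect g a b c d) <= 2 * ((b - a) + (d - c)) * M.
Proof.
  intros Hb Hd Hg HM. unfold rect.
  assert (A1 : Cmod (hside g c a b) <= (b - a) * M).
  { apply cint_norm; auto. eapply hside_icont; eauto; lra. intros; apply HM; lra. }
  assert (A2 : Cmod (hside g d a b) <= (b - a) * M).
  { apply cint_norm; auto. eapply hside_icont; eauto; lra. intros; apply HM; lra. }
  assert (A3 : Cmod (vside g a c d) <= (d - c) * M).
  { apply cint_norm; auto. eapply vside_icont; eauto; lra. intros; apply HM; lra. }
  assert (A4 : Cmod (vside g b c d) <= (d - c) * M).
  { apply cint_norm; auto. eapply vside_icont; eauto; lra. intros; apply HM; lra. }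
  eapply Rle_trans; [apply Cmod_triangle|]. rewrite Cmod_mult, Cmod_Ci.
  pose proof (Cmod_minus_le (hside g c a b) (hside g d a b)).
  pose proof (Cmod_minus_le (vside g b c d) (vside g a c d)). lra.
Qed.

Lemma on_rect_ctn g a b c d : on_rect (cdiff g) a b c d -> on_rect (ctn g) a b c d.
Proof. intros H x y Hx Hy. apply cdiff_ctn, H; auto. Qed.

Lemma on_rect_dist a b c d : on_rect (fun z => on_rect (fun w => Cmod (w - z) <= (b - a) + (d - c)) a b c d) a b c d.
Proof.
  intros x y Hx Hy x' y' Hx' Hy'. eapply Rle_trans; [apply Cmod_le_sum|]. simpl.
  apply Rplus_le_compat; apply Rabs_le; lra.
Qed.

(** The affine part [k + u z * w] of [g] contributes nothing. The remainder [(u w - u z) * (w - z)]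
    is at most [e / 2] times the half-perimeter [s], on a contour of length [2 * s]. *)
Lemma rect_local g a b c d p q : a <= p <= b -> c <= q <= d ->
  on_rect (cdiff g) a b c d ->
  forall e, 0 < e -> exists r, 0 < r /\ forall a' b' c' d',
    a <= a' <= p -> p <= b' <= b -> c <= c' <= q -> q <= d' <= d ->
    (b' - a') + (d' - c') < r ->
    Cmod (rect g a' b' c' d') <= e * ((b' - a') + (d' - c')) ^ 2.
Proof.
  intros Hp Hq Hg e He. set (z := (RtoC p + Ci * RtoC q)%C).
  destruct (Hg p q Hp Hq) as [u [Hu E]]. fold z in Hu, E.
  destruct (Hu (e/2)) as [r [Hr Hr']]; [lra|].
  exists r. split; auto. intros a' b' c' d' Ha Hb Hc Hd Hs.
  set (k := (g z - u z * z)%C).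
  set (h := fun w => ((u w - u z) * (w - z))%C).
  assert (Gc : on_rect (ctn g) a' b' c' d').
  { apply on_rect_ctn. eapply on_rect_sub; eauto; lra. }
  assert (Gk : on_rect (ctn (fun w => k + u z * w)%C) a' b' c' d').
  { intros x y _ _. apply ctn_plus; [apply ctn_const|apply ctn_mult; [apply ctn_const|apply ctn_id]]. }
  assert (Gh' : forall w, h w = (g w - (k + u z * w))%C).
  { intros w. unfold h, k. transitivity (u w * (w - z) - u z * (w - z))%C; [ring|]. rewrite <- E. ring. }
  assert (Gh : on_rect (ctn h) a' b' c' d').
  { intros x y Hx Hy. apply (ctn_ext (fun w => g w - (k + u z * w))%C). { intros; symmetry; auto. }
    apply ctn_minus; [apply Gc|apply Gk]; auto. }
  assert (Eg : rect g a' b' c' d' = rect (fun w => ((k + u z * w) + h w)%C) a' b' c' d').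
  { unfold rect, hside, vside. f_equal; [f_equal|f_equal; f_equal]; (apply cint_ext; [lra|]); intros; rewrite Gh'; ring. }
  rewrite Eg, rect_plus, rect_affine, Cplus_0_l; auto; try lra.
  set (s := b' - a' + (d' - c')) in *.
  replace (e * s ^ 2) with (2 * s * (e / 2 * s)) by field.
  apply rect_bound; auto; try lra.
  intros x y Hx Hy. unfold h. rewrite Cmod_mult.
  assert (D := on_rect_dist a' b' c' d' p q ltac:(lra) ltac:(lra) x y Hx Hy). fold z s in D.
  apply Rmult_le_compat; try apply Cmod_ge_0; auto.
  left. apply Hr'. lra.
Qed.

Lemma nested_point (x w : nat -> R) :
  (forall n, 0 <= w n) -> (forall n, x n <= x (S n)) ->
  (forall n, x (S n) + w (S n) <= x n + w n) ->
  exists p, forall n, x n <= p <= x n + w n.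
Proof.
  intros Hw Hx Hxw.
  assert (M1 : forall n k, x n <= x (n + k)%nat).
  { intros n k. induction k as [|k IH]. { rewrite Nat.add_0_r; lra. }
    rewrite Nat.add_succ_r. specialize (Hx (n + k)%nat). lra. }
  assert (M2 : forall n k, x (n + k)%nat + w (n + k)%nat <= x n + w n).
  { intros n k. induction k as [|k IH]. { rewrite Nat.add_0_r; lra. }
    rewrite Nat.add_succ_r. specialize (Hxw (n + k)%nat). lra. }
  assert (M3 : forall m n, x m <= x n + w n).
  { intros m n. destruct (Nat.le_ge_cases m n) as [L|L].
    - replace n with (m + (n - m))%nat by lia. pose proof (M1 m (n - m)%nat). pose proof (Hw (m + (n - m))%nat). lra.
    - replace m with (n + (m - n))%nat by lia. pose proof (M2 n (m - n)%nat). pose proof (Hw (n + (m - n))%nat). lra. }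
  destruct (completeness (fun y => exists n, y = x n)) as [p [Hp1 Hp2]].
  - exists (x 0%nat + w 0%nat). intros y [n ->]. apply M3.
  - exists (x 0%nat), 0%nat. reflexivity.
  - exists p. intros n. split.
    + apply Hp1. exists n; auto.
    + apply Hp2. intros y [m ->]. apply M3.
Qed.

(* If the boundary integral were nonzero, bisection would produce shrinking
   rectangles on which it stays bounded below by a multiple of the squared size,
   against [rect_local]. *)
Lemma goursat g a b c d : a < b -> c < d -> on_rect (cdiff g) a b c d ->
  rect g a b c d = 0.
Proof.
  intros Hab Hcd Hg. destruct (Ceq_dec (rect g a b c d) 0) as [E|N]; auto. exfalso.
  assert (PN := Cmod_pos _ N). set (s := (b - a) + (d - c)).
  assert (Hs : 0 < s) by (unfold s; lra).
  (* Quartering divides the squared half-perimeter by 4, so at least one of the four quarters keeps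
     the lower bound with the same [eta]. *)
  set (eta := Cmod (rect g a b c d) / s ^ 2).
  assert (Heta : 0 < eta) by (apply Rdiv_lt_0_compat; auto; nra).
  set (w := fun n => (b - a) / 2 ^ n). set (v := fun n => (d - c) / 2 ^ n).
  assert (P2 : forall n, 0 < 2 ^ n) by (intros; apply pow_lt; lra).
  assert (Ww : forall n, w n = w (S n) + w (S n)).
  { intros n. unfold w. simpl. pose proof (P2 n). field. lra. }
  assert (Vv : forall n, v n = v (S n) + v (S n)).
  { intros n. unfold v. simpl. pose proof (P2 n). field. lra. }
  assert (Pw : forall n, 0 < w n) by (intros n; apply Rdiv_lt_0_compat; auto; lra).
  assert (Pv : forall n, 0 < v n) by (intros n; apply Rdiv_lt_0_compat; auto; lra).
  set (Bad := fun n (p : R * R) =>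
    (a <= fst p /\ fst p + w n <= b /\ c <= snd p /\ snd p + v n <= d) /\
    eta * (w n + v n) ^ 2 <= Cmod (rect g (fst p) (fst p + w n) (snd p) (snd p + v n))).
  set (Next := fun n (p p' : R * R) =>
    fst p <= fst p' /\ fst p' + w (S n) <= fst p + w n /\
    snd p <= snd p' /\ snd p' + v (S n) <= snd p + v n).
  assert (Step : forall n p, Bad n p -> exists p', Bad (S n) p' /\ Next n p p').
  { intros n [x y] [[Hx1 [Hx2 [Hy1 Hy2]]] HB]. cbn [fst snd] in *.
    pose proof (Ww n) as Wn. pose proof (Vv n) as Vn.
    pose proof (Pw (S n)) as W1. pose proof (Pv (S n)) as V1.
    set (w1 := w (S n)) in *. set (v1 := v (S n)) in *. rewrite Wn, Vn in *.
    rewrite (rect_split_x g x (x + w1) (x + (w1 + w1)) y (y + (v1 + v1))) in HB; try lra.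
    2:{ apply on_rect_ctn; eapply on_rect_sub; eauto; lra. }
    rewrite (rect_split_y g x (x + w1) y (y + v1)) in HB; try lra.
    2:{ apply on_rect_ctn; eapply on_rect_sub; eauto; lra. }
    rewrite (rect_split_y g (x + w1) (x + (w1 + w1)) y (y + v1)) in HB; try lra.
    2:{ apply on_rect_ctn; eapply on_rect_sub; eauto; lra. }
    replace (x + (w1 + w1)) with (x + w1 + w1) in HB by ring.
    replace (y + (v1 + v1)) with (y + v1 + v1) in HB by ring.
    set (r1 := rect g x (x + w1) y (y + v1)) in *.
    set (r2 := rect g x (x + w1) (y + v1) (y + v1 + v1)) in *.
    set (r3 := rect g (x + w1) (x + w1 + w1) y (y + v1)) in *.
    set (r4 := rect g (x + w1) (x + w1 + w1) (y + v1) (y + v1 + v1)) in *.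
    pose proof (Cmod_triangle (r1 + r2) (r3 + r4)) as T1.
    pose proof (Cmod_triangle r1 r2) as T2. pose proof (Cmod_triangle r3 r4) as T3.
    replace (eta * (w1 + w1 + (v1 + v1)) ^ 2) with (4 * (eta * (w1 + v1) ^ 2)) in HB by ring.
    set (K := eta * (w1 + v1) ^ 2) in *.
    destruct (Rle_dec K (Cmod r1)) as [L1|L1].
    { exists (x, y). split; [split; [cbn [fst snd]; fold w1 v1; lra | exact L1] | unfold Next; cbn [fst snd]; fold w1 v1; rewrite Wn, Vn; lra]. }
    destruct (Rle_dec K (Cmod r2)) as [L2|L2].
    { exists (x, y + v1). split; [split; [cbn [fst snd]; fold w1 v1; lra | exact L2] | unfold Next; cbn [fst snd]; fold w1 v1; rewrite Wn, Vn; lra]. }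
    destruct (Rle_dec K (Cmod r3)) as [L3|L3].
    { exists (x + w1, y). split; [split; [cbn [fst snd]; fold w1 v1; lra | exact L3] | unfold Next; cbn [fst snd]; fold w1 v1; rewrite Wn, Vn; lra]. }
    exists (x + w1, y + v1).
    split; [split; [cbn [fst snd]; fold w1 v1; lra |] | unfold Next; cbn [fst snd]; fold w1 v1; rewrite Wn, Vn; lra].
    change (K <= Cmod r4). lra. }
  assert (B0 : Bad 0%nat (a, c)).
  { unfold Bad, w, v. simpl. rewrite !Rdiv_1_r.
    replace (a + (b - a)) with b by ring. replace (c + (d - c)) with d by ring.
    split; [lra|]. fold s. unfold eta. simpl. right. field. lra. }
  set (sq := fix sq n : {p | Bad n p} := match n with
    | O => exist _ (a, c) B0
    | S m => let (p, Hp) := sq m in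
       let (p', H') := constructive_indefinite_description _ (Step m p Hp) in
       exist _ p' (proj1 H') end).
  assert (Sq : forall n, Next n (proj1_sig (sq n)) (proj1_sig (sq (S n)))).
  { intros n. simpl. destruct (sq n) as [p Hp]. simpl.
    destruct (constructive_indefinite_description _ (Step n p Hp)) as [p' [H1 H2]]. exact H2. }
  destruct (nested_point (fun n => fst (proj1_sig (sq n))) w) as [p Hp].
  { intros; left; auto. } { intros n; apply (Sq n). } { intros n; apply (Sq n). }
  destruct (nested_point (fun n => snd (proj1_sig (sq n))) v) as [q Hq].
  { intros; left; auto. } { intros n; apply (Sq n). } { intros n; apply (Sq n). }
  assert (Bn : forall n, Bad n (proj1_sig (sq n))) by (intros n; destruct (sq n); auto).
  assert (Rp : a <= p <= b). { pose proof (Hp 0%nat). destruct (Bn 0%nat) as [? _]. lra. }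
  assert (Rq : c <= q <= d). { pose proof (Hq 0%nat). destruct (Bn 0%nat) as [? _]. lra. }
  (* The tolerance [eta / 2] contradicts [Bad] as soon as the half-perimeter is below [r]. *)
  destruct (rect_local g a b c d p q Rp Rq Hg (eta / 2)) as [r [Hr HL]]; [lra|].
  assert (exists n, w n + v n < r) as [n Hn].
  { destruct (pow_lt_1_zero (1/2)) with (y := r / s) as [N0 HN].
    - rewrite Rabs_pos_eq; lra.
    - apply Rdiv_lt_0_compat; auto.
    - exists N0. specialize (HN N0 (Nat.le_refl _)).
      rewrite Rabs_pos_eq in HN by (apply pow_le; lra).
      unfold w, v. replace ((b - a) / 2 ^ N0 + (d - c) / 2 ^ N0) with ((1 / 2) ^ N0 * s).
      + apply Rmult_lt_reg_r with (/ s). { apply Rinv_0_lt_compat; auto. }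
        rewrite Rmult_assoc, Rinv_r by lra. rewrite Rmult_1_r. exact HN.
      + unfold Rdiv at 1. rewrite Rmult_1_l, pow_inv. unfold s. pose proof (P2 N0). field. lra. }
  specialize (Hp n). specialize (Hq n). destruct (Bn n) as [Rn Ln].
  set (x := fst (proj1_sig (sq n))) in *. set (y := snd (proj1_sig (sq n))) in *.
  pose proof (Pw n). pose proof (Pv n).
  assert (HB := HL x (x + w n) y (y + v n) ltac:(lra) ltac:(lra) ltac:(lra) ltac:(lra) ltac:(lra)).
  replace (x + w n - x + (y + v n - y)) with (w n + v n) in HB by ring.
  assert (0 < (w n + v n) ^ 2) by (apply pow_lt; lra). nra.
Qed.

(** * Circle means and the Cauchy formula *)

(** Complex arguments allow [pol r] to be composed inside [cint] and [ctn]. *)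
Definition pol (r : C) (s : C) : C := (r * Cexp (Ci * s))%C.

Lemma Cmod_pol (r s : R) : 0 <= r -> Cmod (pol r s) = r.
Proof.
  intros H. unfold pol. rewrite Cmod_mult, Cmod_R, Cmod_Cexp, Rabs_pos_eq by auto.
  simpl. replace (0 * s - 1 * 0) with 0 by ring. rewrite exp_0. ring.
Qed.

Lemma ctn_pol_r r (s : C) : ctn (pol r) s.
Proof.
  unfold pol. apply ctn_mult; [apply ctn_const|].
  apply (ctn_comp Cexp (fun s => Ci * s)%C).
  - apply ctn_mult; [apply ctn_const|apply ctn_id].
  - apply cdiff_ctn, cdiff_Cexp.
Qed.

(** On the circle [du = i u ds], so Cauchy's integral of [phi u / (u - z)] divided by [2 pi i] is
    the mean of [phi u * (u / (u - z))]. Contour integrals over circles appear only in this form. *)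
Definition cmean (phi : C -> C) (r : R) : C :=
  (RtoC (/ (2 * PI)) * cint (fun s => phi (pol r s)) 0 (2 * PI))%C.

Definition ccirc (phi : C -> C) (r : R) : Prop := forall z, Cmod z = r -> ctn phi z.

Lemma two_PI_pos : 0 < 2 * PI.
Proof. pose proof PI_RGT_0. lra. Qed.

Lemma inv_two_PI_pos : 0 < / (2 * PI).
Proof. apply Rinv_0_lt_compat, two_PI_pos. Qed.

Lemma ccirc_icont phi r : 0 <= r -> ccirc phi r -> icont (fun s => phi (pol r s)) 0 (2 * PI).
Proof.
  intros Hr H s _. apply (ctn_comp phi (pol r)). { apply ctn_pol_r. }
  apply H, Cmod_pol; auto.
Qed.

Lemma cmean_ext phi psi r : 0 <= r -> (forall z, Cmod z = r -> phi z = psi z) -> cmean phi r = cmean psi r.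
Proof.
  intros Hr E. unfold cmean. f_equal. apply cint_ext. { left; apply two_PI_pos. }
  intros s _. apply E, Cmod_pol; auto.
Qed.

Lemma cmean_plus phi psi r : 0 <= r -> ccirc phi r -> ccirc psi r ->
  cmean (fun z => (phi z + psi z)%C) r = (cmean phi r + cmean psi r)%C.
Proof.
  intros Hr H1 H2. unfold cmean.
  rewrite (cint_plus (fun s => phi (pol r s)) (fun s => psi (pol r s))).
  - ring.
  - left; apply two_PI_pos.
  - apply ccirc_icont; auto.
  - apply ccirc_icont; auto.
Qed.

Lemma cmean_scal k phi r : 0 <= r -> ccirc phi r ->
  cmean (fun z => (k * phi z)%C) r = (k * cmean phi r)%C.
Proof.
  intros Hr H1. unfold cmean.
  rewrite (cint_scal k (fun s => phi (pol r s))).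
  - ring.
  - left; apply two_PI_pos.
  - apply ccirc_icont; auto.
Qed.

Lemma cmean_const k r : cmean (fun _ => k) r = k.
Proof.
  unfold cmean. rewrite cint_const. rewrite RtoC_inv.
  - field. intros E. apply RtoC_inj in E. pose proof two_PI_pos. lra.
  - pose proof two_PI_pos. lra.
Qed.

Lemma cmean_minus phi psi r : 0 <= r -> ccirc phi r -> ccirc psi r ->
  cmean (fun z => (phi z - psi z)%C) r = (cmean phi r - cmean psi r)%C.
Proof.
  intros Hr H1 H2. rewrite (cmean_ext _ (fun z => phi z + (-1) * psi z)%C) by (auto; intros; ring).
  rewrite cmean_plus, cmean_scal; auto.
  - ring.
  - intros z Hz. apply ctn_mult; [apply ctn_const|auto].
Qed.

Lemma cmean_norm phi r M : 0 <= r -> ccirc phi r ->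
  (forall z, Cmod z = r -> Cmod (phi z) <= M) -> Cmod (cmean phi r) <= M.
Proof.
  intros Hr H HM. unfold cmean. rewrite Cmod_mult, Cmod_R.
  pose proof inv_two_PI_pos as P. rewrite Rabs_pos_eq by lra.
  apply Rmult_le_reg_l with (2 * PI). { apply two_PI_pos. }
  rewrite <- Rmult_assoc, Rinv_r, Rmult_1_l by (pose proof two_PI_pos; lra).
  replace (2 * PI) with (2 * PI - 0) at 2 by ring.
  apply cint_norm. { left; apply two_PI_pos. } { apply ccirc_icont; auto. }
  intros s _. apply HM, Cmod_pol; auto.
Qed.

Lemma fst_scal (k : R) (z : C) : fst (RtoC k * z)%C = k * fst z.
Proof. simpl. ring. Qed.

Lemma cmean_fst_le phi psi r : 0 <= r -> ccirc phi r -> ccirc psi r ->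
  (forall z, Cmod z = r -> fst (phi z) <= fst (psi z)) -> fst (cmean phi r) <= fst (cmean psi r).
Proof.
  intros Hr H1 H2 HM. unfold cmean. rewrite !fst_scal.
  apply Rmult_le_compat_l. { left; apply inv_two_PI_pos. }
  pose proof two_PI_pos.
  apply (is_RInt_le (fun s => fst (phi (pol r (RtoC s)))) (fun s => fst (psi (pol r (RtoC s)))) 0 (2 * PI)).
  - lra.
  - apply (cint_fst (fun s => phi (pol r s))). lra. apply ccirc_icont; auto.
  - apply (cint_fst (fun s => psi (pol r s))). lra. apply ccirc_icont; auto.
  - intros s _. apply HM, Cmod_pol; auto.
Qed.

Lemma Cexp_ln_pol (r : R) (s : C) : 0 < r -> Cexp (RtoC (ln r) + Ci * s) = pol r s.
Proof.
  intros Hr. rewrite Cexp_plus. unfold pol. f_equal. unfold Cexp, RtoC. simpl.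
  rewrite exp_ln, cos_0, sin_0 by auto. f_equal; ring.
Qed.

Lemma Cmod_Cexp_RtoC (x y : R) : Cmod (Cexp (RtoC x + Ci * RtoC y)) = exp x.
Proof. rewrite Cmod_Cexp. f_equal. simpl. ring. Qed.

(* Goursat's theorem for [phi o exp]: the horizontal sides cancel by periodicity. *)
Lemma cmean_annulus phi r1 r2 : 0 < r1 -> r1 <= r2 ->
  (forall z, r1 <= Cmod z <= r2 -> cdiff phi z) -> cmean phi r1 = cmean phi r2.
Proof.
  intros H1 H12 Hd. destruct (Rle_lt_or_eq_dec _ _ H12) as [L| ->]; auto.
  set (g := fun s => phi (Cexp s)).
  assert (G : rect g (ln r1) (ln r2) 0 (2 * PI) = 0).
  { apply goursat. { apply ln_increasing; auto. } { apply two_PI_pos. }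
    intros x y Hx Hy. apply (cdiff_comp phi Cexp). { apply cdiff_Cexp. }
    apply Hd. rewrite Cmod_Cexp_RtoC. split.
    - rewrite <- (exp_ln r1) by auto. destruct Hx as [[Hx|Hx] _]; [left; apply exp_increasing; auto|right; rewrite Hx; auto].
    - rewrite <- (exp_ln r2) by lra. destruct Hx as [_ [Hx|Hx]]; [left; apply exp_increasing; auto|right; rewrite Hx; auto]. }
  unfold rect in G.
  assert (Ph : hside g 0 (ln r1) (ln r2) = hside g (2 * PI) (ln r1) (ln r2)).
  { unfold hside. apply cint_ext. { left. apply ln_increasing; auto. }
    intros x _. unfold g. f_equal. unfold Cexp. simpl.
    replace (0 + (0 * 0 + 1 * (2 * PI))) with (0 + 2 * PI) by ring.
    replace (0 + (0 * 0 + 1 * 0)) with 0 by ring.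
    rewrite cos_plus, sin_plus, cos_2PI, sin_2PI, cos_0, sin_0.
    replace (x + (0 * (2 * PI) - 1 * 0)) with (x + (0 * 0 - 1 * 0)) by ring. f_equal; ring. }
  rewrite Ph in G.
  assert (G' : vside g (ln r2) 0 (2 * PI) = vside g (ln r1) 0 (2 * PI)).
  { apply Csub_eq. replace (vside g (ln r2) 0 (2 * PI) - vside g (ln r1) 0 (2 * PI))%C
      with (/ Ci * (hside g (2 * PI) (ln r1) (ln r2) - hside g (2 * PI) (ln r1) (ln r2) +
     Ci * (vside g (ln r2) 0 (2 * PI) - vside g (ln r1) 0 (2 * PI))))%C.
    - rewrite G. ring.
    - field. apply Ci_nz. }
  assert (V : forall r, 0 < r -> vside g (ln r) 0 (2 * PI) = cint (fun s => phi (pol r s)) 0 (2 * PI)).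
  { intros r Hr. unfold vside. apply cint_ext. { left; apply two_PI_pos. }
    intros s _. unfold g. rewrite Cexp_ln_pol; auto. }
  unfold cmean. rewrite <- !V, G'; auto. lra.
Qed.

Lemma ctn_fst (f : C -> C) z : ctn f z -> ctn (fun w => RtoC (fst (f w))) z.
Proof.
  intros Hf e He. destruct (Hf e He) as [d [Hd H]]. exists d. split; auto.
  intros w Hw. rewrite <- RtoC_minus, Cmod_R.
  eapply Rle_lt_trans; [apply (fst_le_Cmod (f w - f z)%C)|]. auto.
Qed.

Lemma ctn_snd (f : C -> C) z : ctn f z -> ctn (fun w => RtoC (snd (f w))) z.
Proof.
  intros Hf e He. destruct (Hf e He) as [d [Hd H]]. exists d. split; auto.
  intros w Hw. rewrite <- RtoC_minus, Cmod_R.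
  eapply Rle_lt_trans; [apply (snd_le_Cmod (f w - f z)%C)|]. auto.
Qed.

Lemma Ceta (z : C) : z = (RtoC (fst z) + Ci * RtoC (snd z))%C.
Proof. destruct z as [x y]. unfold RtoC, Ci, Cplus, Cmult; simpl. f_equal; ring. Qed.

Lemma ctn_continuity_2d (f : C -> C) x y : ctn f (RtoC x + Ci * RtoC y)%C ->
  continuity_2d_pt (fun u v => fst (f (RtoC u + Ci * RtoC v)%C)) x y /\
  continuity_2d_pt (fun u v => snd (f (RtoC u + Ci * RtoC v)%C)) x y.
Proof.
  intros H. split; intros e; destruct (H e (cond_pos e)) as [d [Hd Hw]];
  (assert (Hd2 : 0 < d / 2) by lra); exists (mkposreal _ Hd2); simpl; intros u v Hu Hv;
  (eapply Rle_lt_trans; [|apply (Hw (RtoC u + Ci * RtoC v)%C)]).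
  1: apply (fst_le_Cmod (f (u + Ci * v) - f (x + Ci * y))%C).
  2: apply (snd_le_Cmod (f (u + Ci * v) - f (x + Ci * y))%C).
  all: eapply Rle_lt_trans; [apply Cmod_le_sum|]; simpl.
  all: replace (u + (0 * v - 1 * 0) + - (x + (0 * y - 1 * 0))) with (u - x) by ring.
  all: replace (0 + (0 * 0 + 1 * v) + - (0 + (0 * 0 + 1 * y))) with (v - y) by ring; lra.
Qed.

Lemma uniform_ctn f a b c d : on_rect (ctn f) a b c d -> forall e, 0 < e ->
  exists r, 0 < r /\ forall x y u v, a <= x <= b -> c <= y <= d -> a <= u <= b -> c <= v <= d ->
    Rabs (u - x) < r -> Rabs (v - y) < r ->
    Cmod (f (RtoC u + Ci * RtoC v)%C - f (RtoC x + Ci * RtoC y)%C) < e.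
Proof.
  intros H e He. assert (He2 : 0 < e / 2) by lra.
  destruct (uniform_continuity_2d (fun u v => fst (f (RtoC u + Ci * RtoC v)%C)) a b c d) with (eps := mkposreal _ He2) as [d1 H1].
  { intros x y Hx Hy. apply ctn_continuity_2d, H; auto. }
  destruct (uniform_continuity_2d (fun u v => snd (f (RtoC u + Ci * RtoC v)%C)) a b c d) with (eps := mkposreal _ He2) as [d2 H2].
  { intros x y Hx Hy. apply ctn_continuity_2d, H; auto. }
  exists (Rmin d1 d2). split. { apply Rmin_pos; apply cond_pos. }
  intros x y u v Hx Hy Hu Hv A B.
  specialize (H1 x y u v Hx Hy Hu Hv (Rlt_le_trans _ _ _ A (Rmin_l _ _)) (Rlt_le_trans _ _ _ B (Rmin_l _ _))).
  specialize (H2 x y u v Hx Hy Hu Hv (Rlt_le_trans _ _ _ A (Rmin_r _ _)) (Rlt_le_trans _ _ _ B (Rmin_r _ _))).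
  cbn [pos] in H1, H2. eapply Rle_lt_trans; [apply Cmod_le_sum|].
  set (p := f (RtoC u + Ci * RtoC v)%C) in *. set (q := f (RtoC x + Ci * RtoC y)%C) in *.
  change (Rabs (fst p - fst q) + Rabs (snd p - snd q) < e). lra.
Qed.

Lemma ctn_pol2 phi (x y : R) : ctn phi (pol x y) ->
  ctn (fun z => phi (pol (RtoC (fst z)) (RtoC (snd z)))) (RtoC x + Ci * RtoC y)%C.
Proof.
  intros H. apply (ctn_comp phi (fun z => pol (RtoC (fst z)) (RtoC (snd z)))).
  - unfold pol. apply ctn_mult. { apply (ctn_fst (fun z => z)), ctn_id. }
    apply (ctn_comp Cexp (fun z => Ci * RtoC (snd z))%C).
    + apply ctn_mult; [apply ctn_const|apply (ctn_snd (fun z => z)), ctn_id].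
    + apply cdiff_ctn, cdiff_Cexp.
  - replace (fst (RtoC x + Ci * RtoC y)%C) with x by (simpl; ring).
    replace (snd (RtoC x + Ci * RtoC y)%C) with y by (simpl; ring). exact H.
Qed.

(** Logarithmic coordinates can neither reach the centre nor cross a circle where differentiability
    fails. Continuity in the radius, from uniform continuity in polar coordinates, fills both
    gaps. *)
Lemma cmean_uniform phi r : 0 <= r -> (forall z, Cmod z <= r -> ctn phi z) ->
  forall e, 0 < e -> exists d, 0 < d /\ forall r1 r2, 0 <= r1 <= r -> 0 <= r2 <= r ->
    Rabs (r1 - r2) < d -> Cmod (cmean phi r1 - cmean phi r2) <= e.
Proof.
  intros Hr H e He.
  destruct (uniform_ctn (fun z => phi (pol (RtoC (fst z)) (RtoC (snd z)))) 0 r 0 (2 * PI)) with (e := e) as [d [Hd HU]]; auto.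
  { intros x y Hx Hy. apply ctn_pol2. apply H. rewrite Cmod_pol; lra. }
  exists d. split; auto. intros r1 r2 H1 H2 H12.
  assert (Cc : forall r', 0 <= r' <= r -> icont (fun s => phi (pol r' s)) 0 (2 * PI)).
  { intros r' Hr'. apply ccirc_icont; [lra|]. intros z Hz. apply H. lra. }
  pose proof two_PI_pos as P2. pose proof inv_two_PI_pos as P2'.
  unfold cmean.
  replace (RtoC (/ (2 * PI)) * cint (fun s => phi (pol r1 s)) 0 (2 * PI) -
     RtoC (/ (2 * PI)) * cint (fun s => phi (pol r2 s)) 0 (2 * PI))%C
    with (RtoC (/ (2 * PI)) * cint (fun s => phi (pol r1 s) + (-1) * phi (pol r2 s)) 0 (2 * PI))%C.
  - rewrite Cmod_mult, Cmod_R, Rabs_pos_eq by lra.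
    apply Rmult_le_reg_l with (2 * PI); auto.
    rewrite <- Rmult_assoc, Rinv_r, Rmult_1_l by lra.
    replace (2 * PI) with (2 * PI - 0) at 2 by ring.
    apply cint_norm; [lra| |].
    + intros s Hs. apply ctn_plus; [apply (Cc r1); auto|].
      apply ctn_mult; [apply ctn_const|apply (Cc r2); auto].
    + intros s Hs. replace (phi (pol r1 s) + (-1) * phi (pol r2 s))%C with (phi (pol r1 s) - phi (pol r2 s))%C by ring.
      specialize (HU r2 s r1 s H2 Hs H1 Hs H12).
      rewrite Rminus_diag, Rabs_R0 in HU. specialize (HU Hd).
      assert (F : forall x y : R, pol (RtoC (fst (RtoC x + Ci * RtoC y)%C)) (RtoC (snd (RtoC x + Ci * RtoC y)%C)) = pol x y).
      { intros x y. f_equal; f_equal; simpl; ring. }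
      rewrite !F in HU. lra.
  - rewrite (cint_plus (fun s => phi (pol r1 s)) (fun s => (-1) * phi (pol r2 s))%C), (cint_scal (-1) (fun s => phi (pol r2 s))); auto; try lra.
    + ring.
    + intros s Hs. apply ctn_mult; [apply ctn_const|apply (Cc r2); auto].
Qed.

Lemma cmean_0 phi : cmean phi 0 = phi 0.
Proof.
  rewrite <- (cmean_const (phi 0) 0). apply cmean_ext; [lra|].
  intros z Hz. apply Cmod_eq_0 in Hz. rewrite Hz. auto.
Qed.

Lemma Cmod_le_all_eps (z : C) : (forall e, 0 < e -> Cmod z <= e) -> z = 0.
Proof.
  intros H. apply Cmod_zero_le. destruct (Rle_dec (Cmod z) 0) as [L|L]; auto.
  specialize (H (Cmod z / 2)). lra.
Qed.

(* Differentiability may fail on one intermediate circle, which is crossed using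
   the continuity of the mean in the radius. *)
Lemma cmean_center phi r0 r : 0 <= r0 < r -> (forall z, Cmod z <= r -> ctn phi z) ->
  (forall z, Cmod z <= r -> Cmod z <> r0 -> cdiff phi z) -> cmean phi r = phi 0.
Proof.
  intros Hr0 Hc Hd. rewrite <- cmean_0. apply Csub_eq, Cmod_le_all_eps. intros e He.
  destruct (cmean_uniform phi r ltac:(lra) Hc (e/2)) as [d [Hdp HU]]; [lra|].
  assert (A : forall r1 r2, 0 < r1 -> r1 <= r2 -> r2 <= r -> (r2 < r0 \/ r0 < r1) -> cmean phi r1 = cmean phi r2).
  { intros r1 r2 A1 A2 A3 A4. apply cmean_annulus; auto.
    intros z Hz. apply Hd; [lra|]. destruct A4; lra. }
  destruct (Req_dec r0 0) as [E|N].
  - set (r1 := Rmin r (d/2)).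
    assert (0 < r1) by (apply Rmin_pos; lra).
    assert (r1 <= r) by apply Rmin_l. assert (r1 <= d/2) by apply Rmin_r.
    rewrite <- (A r1 r); auto; try lra.
    specialize (HU r1 0). rewrite Rminus_0_r, Rabs_pos_eq in HU by lra.
    assert (Cmod (cmean phi r1 - cmean phi 0) <= e/2) by (apply HU; lra). lra.
  (* [r1] is close to 0, and [r2 < r0 < r3] are close to each other. The mean is constant on
     [[r1, r2]] and on [[r3, r]], and each of the two gaps costs at most [e / 2]. *)
  - set (r1 := Rmin (r0/2) (d/2)). set (r2 := Rmax (r0/2) (r0 - d/4)). set (r3 := Rmin r (r0 + d/4)).
    assert (0 < r1) by (apply Rmin_pos; lra).
    assert (r1 <= r0/2) by apply Rmin_l. assert (r1 <= d/2) by apply Rmin_r.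
    assert (r0/2 <= r2) by apply Rmax_l. assert (r0 - d/4 <= r2) by apply Rmax_r.
    assert (r2 < r0) by (apply Rmax_lub_lt; lra).
    assert (r0 < r3) by (apply Rmin_glb_lt; lra).
    assert (r3 <= r) by apply Rmin_l. assert (r3 <= r0 + d/4) by apply Rmin_r.
    assert (U1 := HU r1 0). rewrite Rminus_0_r, Rabs_pos_eq in U1 by lra.
    assert (U2 := HU r3 r2). rewrite Rabs_pos_eq in U2 by lra.
    rewrite <- (A r3 r); try lra.
    assert (V1 : Cmod (cmean phi r1 - cmean phi 0) <= e/2) by (apply U1; lra).
    assert (V2 : Cmod (cmean phi r3 - cmean phi r2) <= e/2) by (apply U2; lra).
    rewrite (A r1 r2) in V1; try lra.
    pose proof (Cmod_triangle (cmean phi r3 - cmean phi r2) (cmean phi r2 - cmean phi 0)) as T.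
    replace (cmean phi r3 - cmean phi r2 + (cmean phi r2 - cmean phi 0))%C
      with (cmean phi r3 - cmean phi 0)%C in T by ring. lra.
Qed.

Lemma circle_neq z w r : Cmod z < r -> Cmod w = r -> (w - z)%C <> 0.
Proof. intros Hz Hw E. apply Csub_eq in E. subst. lra. Qed.

Lemma ctn_kernel z w : w <> z -> ctn (fun u => (/ (u - z))%C) w.
Proof.
  intros H. apply ctn_inv.
  - apply ctn_minus; [apply ctn_id|apply ctn_const].
  - apply Csub_neq; auto.
Qed.

Lemma cdiff_kernel z w : w <> z -> cdiff (fun u => (/ (u - z))%C) w.
Proof.
  intros H. apply cdiff_inv.
  - apply cdiff_minus; [apply cdiff_id|apply cdiff_const].
  - apply Csub_neq; auto.
Qed.

(** The mean is independent of the radius beyond [|z|] and tends to 0 as the radius grows: on the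
    circle of radius [r2] the distance to [z] exceeds [/ e]. *)
Lemma cmean_kernel0 z r : Cmod z < r -> cmean (fun u => / (u - z))%C r = 0.
Proof.
  intros Hz. pose proof (Cmod_ge_0 z) as Pz.
  apply Cmod_le_all_eps. intros e He.
  set (r2 := r + / e + 1). assert (0 < / e) by (apply Rinv_0_lt_compat; auto).
  rewrite (cmean_annulus _ r r2).
  - apply cmean_norm; [unfold r2; lra| |].
    + intros w Hw. apply ctn_kernel. intros ->. unfold r2 in Hw. lra.
    + intros w Hw. assert (w - z <> 0)%C by (apply circle_neq with r2; unfold r2; lra || auto).
      rewrite Cmod_inv; auto. pose proof (Cmod_minus_ge w z). rewrite Hw in *.
      rewrite <- (Rinv_inv e). apply Rinv_le_contravar; auto. unfold r2 in *. lra.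
  - lra.
  - unfold r2; lra.
  - intros w Hw. apply cdiff_kernel. intros ->. lra.
Qed.

Lemma cmean_kernel z r : Cmod z < r -> cmean (fun u => u / (u - z))%C r = 1.
Proof.
  intros Hz. pose proof (Cmod_ge_0 z) as Pz.
  rewrite (cmean_ext _ (fun u => 1 + z * / (u - z))%C); [|lra|].
  - assert (ccirc (fun u => / (u - z))%C r).
    { intros w Hw. apply ctn_kernel. intros ->. lra. }
    rewrite cmean_plus, cmean_const, cmean_scal, cmean_kernel0; auto; try lra.
    + ring.
    + intros w Hw. apply ctn_const.
    + intros w Hw. apply ctn_mult; [apply ctn_const|auto].
  - intros w Hw. field. apply circle_neq with r; auto.
Qed.

(** Writing [f u = f z + q u * (u - z)] leaves the mean of [q u * u], which equals its central value
    0. At [z] only the continuity of [q] is available, so [cmean_center] is applied with the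
    exceptional circle of radius [|z|]. *)
Lemma cauchy_formula f z r : Cmod z < r -> (forall w, Cmod w <= r -> cdiff f w) ->
  cmean (fun u => f u * (u / (u - z)))%C r = f z.
Proof.
  intros Hz Hf. pose proof (Cmod_ge_0 z) as Pz.
  destruct (Hf z ltac:(lra)) as [q [Hq E]].
  assert (Qd : forall w, Cmod w <= r -> w <> z -> cdiff q w).
  { intros w Hw N. assert (P := Cmod_pos _ (Csub_neq _ _ N)).
    apply (cdiff_ext_loc (fun u => (f u - f z) * / (u - z))%C q w (Cmod (w - z))); auto.
    - intros u Hu. assert (u <> z). { intros ->. rewrite Cmod_sub_sym in Hu. lra. }
      rewrite E. field. apply Csub_neq; auto.
    - apply cdiff_mult; [apply cdiff_minus; [auto|apply cdiff_const]|apply cdiff_kernel; auto]. }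
  assert (Z0 : cmean (fun u => q u * u)%C r = 0).
  { rewrite (cmean_center _ (Cmod z) r).
    - ring.
    - lra.
    - intros w Hw. apply ctn_mult; [|apply ctn_id].
      destruct (Ceq_dec w z) as [->|N]; auto. apply cdiff_ctn, Qd; auto.
    - intros w Hw N. apply cdiff_mult; [|apply cdiff_id]. apply Qd; auto. intros ->. auto. }
  assert (K : ccirc (fun u => (u / (u - z)))%C r).
  { intros w Hw. apply ctn_mult; [apply ctn_id|apply ctn_kernel]. intros ->; lra. }
  rewrite (cmean_ext _ (fun u => q u * u + f z * (u / (u - z)))%C); [|lra|].
  - rewrite cmean_plus, cmean_scal, cmean_kernel, Z0; auto; try lra.
    + ring.
    + intros w Hw. apply ctn_mult; [|apply ctn_id]. apply cdiff_ctn, Qd; [lra|]. intros ->; lra.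
    + intros w Hw. apply ctn_mult; [apply ctn_const|auto].
  - intros w Hw. assert (w - z <> 0)%C by (apply circle_neq with r; auto).
    replace (f w) with (f z + q w * (w - z))%C by (rewrite <- E; ring). field; auto.
Qed.

Lemma circle_param (r : R) (u : C) : 0 < r -> Cmod u = r ->
  exists s, 0 <= s <= 2 * PI /\ u = pol r s.
Proof.
  intros Hr Hu. destruct u as [x y].
  assert (Hxy : (x / r) ^ 2 + (y / r) ^ 2 = 1).
  { assert (Cmod (x, y) ^ 2 = x ^ 2 + y ^ 2).
    { unfold Cmod. simpl fst; simpl snd. rewrite pow2_sqrt; nra. }
    rewrite Hu in H. replace ((x / r) ^ 2 + (y / r) ^ 2) with ((x ^ 2 + y ^ 2) / r ^ 2) by (field; lra).
    rewrite <- H. field. lra. }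
  assert (Bx : -1 <= x / r <= 1) by (split; nra).
  pose proof (acos_bound (x / r)) as Ba. pose proof (cos_acos (x / r) Bx) as Ca.
  pose proof (sin_acos (x / r) Bx) as Sa. pose proof PI_RGT_0.
  assert (Ex : x = r * (x / r)) by (field; lra). assert (Ey : y = r * (y / r)) by (field; lra).
  assert (G : exists s, 0 <= s <= 2 * PI /\ cos s = x / r /\ sin s = y / r).
  { destruct (Rle_dec 0 (y / r)) as [L|L].
    - exists (acos (x / r)). split; [lra|]. split; auto. rewrite Sa.
      replace (1 - (x / r) ²) with ((y / r) ²) by (unfold Rsqr; lra). apply sqrt_Rsqr; auto.
    - exists (2 * PI - acos (x / r)). split; [lra|].
      rewrite cos_minus, sin_minus, cos_2PI, sin_2PI, Ca, Sa.
      split; [ring|].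
      replace (1 - (x / r) ²) with ((- (y / r)) ²) by (unfold Rsqr; lra).
      rewrite sqrt_Rsqr by lra. ring. }
  destruct G as [s [Hs [E1 E2]]]. exists s. split; auto.
  unfold pol, Cexp, Ci, RtoC, Cmult. simpl.
  replace (0 * s - 1 * 0) with 0 by ring. replace (0 * 0 + 1 * s) with s by ring.
  rewrite exp_0, E1, E2. f_equal; [rewrite Ex at 1|rewrite Ey at 1]; ring.
Qed.

Lemma circle_bounded phi r : 0 < r -> ccirc phi r ->
  exists M, 0 < M /\ forall u, Cmod u = r -> Cmod (phi u) <= M.
Proof.
  intros Hr H.
  destruct (continuity_ab_maj (fun s => Cmod (phi (pol r (RtoC s)))) 0 (2 * PI)) as [s0 [Hs0 _]].
  - left; apply two_PI_pos.
  - intros s _ e He.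
    assert (Hc : ctn (fun s => phi (pol r s)) (RtoC s)).
    { apply (ctn_comp phi (pol r)); [apply ctn_pol_r|]. apply H, Cmod_pol. lra. }
    destruct (Hc e He) as [d [Hd Hw]]. exists d. split; auto.
    intros s' [_ Hs']. simpl in *. unfold R_dist in *.
    eapply Rle_lt_trans; [apply Cmod_diff_le|]. apply Hw.
    rewrite <- RtoC_minus, Cmod_R. exact Hs'.
  - exists (Cmod (phi (pol r s0)) + 1). split. { pose proof (Cmod_ge_0 (phi (pol r s0))). lra. }
    intros u Hu. destruct (circle_param r u Hr Hu) as [s [Hs ->]]. specialize (Hs0 s Hs). simpl in Hs0. lra.
Qed.

(** * Cauchy transforms of densities on a circle *)

Definition ctrans (phi : C -> C) (r : R) (z : C) : C := cmean (fun u => phi u * / (u - z))%C r.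

Lemma ccirc_kernel phi r z : ccirc phi r -> Cmod z < r -> ccirc (fun u => phi u * / (u - z))%C r.
Proof.
  intros H Hz u Hu. apply ctn_mult; auto. apply ctn_kernel. intros ->. lra.
Qed.

(** By the resolvent identity the difference quotient of a transform is again a transform, of the
    density [phi u / (u - z)]. Continuity of transforms therefore yields their differentiability. *)
Lemma ctrans_quotient phi r z w : ccirc phi r -> Cmod z < r -> Cmod w < r ->
  (ctrans phi r w - ctrans phi r z = ctrans (fun u => phi u * / (u - z)) r w * (w - z))%C.
Proof.
  intros H Hz Hw. pose proof (Cmod_ge_0 z). unfold ctrans.
  rewrite <- cmean_minus; try lra; try (apply ccirc_kernel; auto).
  rewrite Cmult_comm, <- cmean_scal; try lra.
  - apply cmean_ext; [lra|]. intros u Hu.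
    assert (u - z <> 0)%C by (apply circle_neq with r; auto).
    assert (u - w <> 0)%C by (apply circle_neq with r; auto). field; auto.
  - apply (ccirc_kernel (fun u => phi u * / (u - z))%C); auto. apply ccirc_kernel; auto.
Qed.

Lemma ctrans_ctn phi r z : ccirc phi r -> Cmod z < r -> ctn (ctrans phi r) z.
Proof.
  intros H Hz e He. pose proof (Cmod_ge_0 z) as Pz.
  destruct (circle_bounded phi r ltac:(lra) H) as [M [HM HM']].
  set (d := r - Cmod z). assert (Hd : 0 < d) by (unfold d; lra).
  (* Bounds the transform of [phi u / (u - z)] at points [w] within [d / 2] of [z]: there
     [|u - z| >= d] and [|u - w| >= d / 2]. *)
  set (K := M * / d * / (d / 2)).
  assert (HK : 0 < K). { unfold K. repeat apply Rmult_lt_0_compat; auto; apply Rinv_0_lt_compat; lra. }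
  exists (Rmin (d / 2) (e / K)). split. { apply Rmin_pos; [lra|apply Rdiv_lt_0_compat; auto]. }
  intros w Hw. assert (A1 := Rlt_le_trans _ _ _ Hw (Rmin_l _ _)). assert (A2 := Rlt_le_trans _ _ _ Hw (Rmin_r _ _)).
  pose proof (Cmod_minus_ge w z) as Tw.
  assert (Hwr : Cmod w < r) by (unfold d in *; lra).
  rewrite ctrans_quotient; auto. rewrite Cmod_mult.
  assert (B : Cmod (ctrans (fun u => phi u * / (u - z))%C r w) <= K).
  { apply cmean_norm; [lra| |].
    - apply (ccirc_kernel (fun u => phi u * / (u - z))%C); auto. apply ccirc_kernel; auto.
    - intros u Hu.
      assert (N1 : (u - z <> 0)%C) by (apply circle_neq with r; auto).
      assert (N2 : (u - w <> 0)%C) by (apply circle_neq with r; auto).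
      rewrite !Cmod_mult, !Cmod_inv; auto.
      pose proof (Cmod_minus_ge u z) as T1. pose proof (Cmod_minus_ge u w) as T2. rewrite Hu in T1, T2.
      apply Cmod_pos in N1. apply Cmod_pos in N2.
      unfold K. apply Rmult_le_compat.
      + apply Rmult_le_pos; [apply Cmod_ge_0|left; apply Rinv_0_lt_compat; auto].
      + left; apply Rinv_0_lt_compat; auto.
      + apply Rmult_le_compat; [apply Cmod_ge_0|left; apply Rinv_0_lt_compat; auto|auto|].
        apply Rinv_le_contravar; auto.
      + apply Rinv_le_contravar; unfold d in *; lra. }
  apply Rle_lt_trans with (K * Cmod (w - z)). { apply Rmult_le_compat_r; auto; apply Cmod_ge_0. }
  apply Rmult_lt_reg_r with (/ K). { apply Rinv_0_lt_compat; auto. }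
  replace (K * Cmod (w - z) * / K) with (Cmod (w - z)) by (field; lra). exact A2.
Qed.

Lemma ctrans_cdiff phi r z : ccirc phi r -> Cmod z < r -> cdiff (ctrans phi r) z.
Proof.
  intros H Hz.
  assert (Hq : ccirc (fun u => phi u * / (u - z))%C r) by (apply ccirc_kernel; auto).
  (* The integral formula for the quotient is available only inside the disc; elsewhere the plain
     difference quotient is taken. *)
  exists (fun w => if Rlt_dec (Cmod w) r then ctrans (fun u => phi u * / (u - z))%C r w
           else ((ctrans phi r w - ctrans phi r z) / (w - z))%C).
  split.
  - apply (ctn_ext_loc (ctrans (fun u => phi u * / (u - z))%C r) _ z (r - Cmod z)); [lra| |].
    + intros w Hw. pose proof (Cmod_minus_ge w z). destruct (Rlt_dec (Cmod w) r); auto. lra.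
    + apply ctrans_ctn; auto.
  - intros w. destruct (Rlt_dec (Cmod w) r) as [L|L].
    + apply ctrans_quotient; auto.
    + field. apply Csub_neq. intros ->. lra.
Qed.

Lemma cauchy_ctrans f z r : Cmod z < r -> (forall w, Cmod w <= r -> cdiff f w) ->
  ctrans (fun u => f u * u)%C r z = f z.
Proof.
  intros Hz Hf. rewrite <- (cauchy_formula f z r); auto. unfold ctrans.
  pose proof (Cmod_ge_0 z). apply cmean_ext; [lra|].
  intros u Hu. field. apply circle_neq with r; auto.
Qed.

(** * Maximum modulus, division by linear factors, Liouville *)

(** Taking n-th roots of the bounds removes the constant [K]. *)
Lemma pow_bounded_le (x M K : R) : 0 <= M -> (forall n, x ^ n <= K * M ^ n) -> x <= M.
Proof.
  intros HM H. destruct (Rle_lt_dec x M) as [L|L]; auto. exfalso.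
  destruct (Req_dec M 0) as [->|N].
  { specialize (H 1%nat). simpl in H. lra. }
  assert (P : 0 < M) by lra.
  assert (X : 1 < x / M). { apply Rmult_lt_reg_r with M; auto. unfold Rdiv. rewrite Rmult_assoc, Rinv_l; lra. }
  destruct (Pow_x_infinity (x / M)) with (b := K + 1) as [N0 HN].
  { rewrite Rabs_pos_eq; lra. }
  specialize (HN N0 (Nat.le_refl _)). rewrite Rabs_pos_eq in HN by (apply pow_le; lra).
  unfold Rdiv in HN. rewrite Rpow_mult_distr, pow_inv in HN.
  assert (PM : 0 < M ^ N0) by (apply pow_lt; auto).
  specialize (H N0).
  assert (x ^ N0 * / M ^ N0 <= K); [|lra].
  apply Rmult_le_reg_r with (M ^ N0); auto. rewrite Rmult_assoc, Rinv_l; lra.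
Qed.

(* Cauchy's formula loses a constant factor; applying it to the powers of [f]
   removes the loss. *)
Lemma max_modulus f r M z : 0 < r -> (forall w, Cmod w <= r -> cdiff f w) ->
  (forall w, Cmod w = r -> Cmod (f w) <= M) -> Cmod z <= r -> Cmod (f z) <= M.
Proof.
  intros Hr Hf HM [Hz|Hz]; auto.
  assert (PM : 0 <= M).
  { eapply Rle_trans; [apply Cmod_ge_0|apply (HM (RtoC r))]. rewrite Cmod_R, Rabs_pos_eq; lra. }
  apply pow_bounded_le with (r * / (r - Cmod z)); auto. intros n.
  rewrite <- Cmod_pow, <- (cauchy_formula (fun w => f w ^ n)%C z r); auto.
  2:{ intros w Hw. apply cdiff_pow; auto. }
  apply cmean_norm; [lra| |].
  - intros u Hu. apply ctn_mult.
    + apply ctn_pow, cdiff_ctn, Hf. lra.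
    + apply ctn_mult; [apply ctn_id|apply ctn_kernel]. intros ->; lra.
  - intros u Hu. assert (N : (u - z <> 0)%C) by (apply circle_neq with r; auto).
    rewrite Cmod_mult, Cmod_pow, Cmod_div, Hu; auto. rewrite Rmult_comm.
    pose proof (Cmod_minus_ge u z) as T. rewrite Hu in T.
    apply Rmult_le_compat.
    + apply Rmult_le_pos; [lra|left; apply Rinv_0_lt_compat, Cmod_pos; auto].
    + apply pow_le, Cmod_ge_0.
    + apply Rmult_le_compat_l; [lra|]. apply Rinv_le_contravar; lra.
    + apply pow_incr. split; [apply Cmod_ge_0|auto].
Qed.

(** A removable singularity at [w]: near [w] but off it, the quotient [q] agrees with a Cauchy
    transform [p] that is differentiable at [w], and both are continuous there. *)
Lemma entire_quotient f w : (forall z, cdiff f z) ->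
  exists q, (forall z, cdiff q z) /\ forall z, (f z - f w = q z * (z - w))%C.
Proof.
  intros Hf. destruct (Hf w) as [q [Hq E]]. exists q. split; auto.
  intros z. destruct (Ceq_dec z w) as [->|N].
  - set (r := Cmod w + 1). assert (Hw : Cmod w < r) by (unfold r; lra).
    set (phi := (fun u => f u * u)%C).
    assert (Hphi : ccirc phi r).
    { intros u _. apply ctn_mult; [apply cdiff_ctn, Hf|apply ctn_id]. }
    set (p := ctrans (fun u => phi u * / (u - w))%C r).
    assert (Hp : cdiff p w) by (apply ctrans_cdiff; auto; apply ccirc_kernel; auto).
    assert (Epq : forall u, Cmod (u - w) < 1 -> u <> w -> p u = q u).
    { intros u Hu N. assert (N' := Csub_neq _ _ N).
      assert (Hur : Cmod u < r). { pose proof (Cmod_minus_ge u w). unfold r. lra. }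
      assert (T := ctrans_quotient phi r w u Hphi Hw Hur).
      unfold phi in T. rewrite !cauchy_ctrans in T by auto. rewrite E in T.
      assert (T' : (q u * (u - w) * / (u - w) = p u * (u - w) * / (u - w))%C) by (f_equal; exact T).
      rewrite <- !Cmult_assoc, Cinv_r, !Cmult_1_r in T' by auto. auto. }
    apply (cdiff_ext_loc p q w 1); auto; [lra|].
    intros u Hu. destruct (Ceq_dec u w) as [->|N]; auto.
    apply Csub_eq, Cmod_le_all_eps. intros e He.
    destruct (cdiff_ctn _ _ Hp (e/2)) as [d1 [H1 H1']]; [lra|].
    destruct (Hq (e/2)) as [d2 [H2 H2']]; [lra|].
    set (d := Rmin 1 (Rmin d1 d2)). assert (Hd : 0 < d) by (repeat apply Rmin_pos; lra).
    assert (d <= 1) by apply Rmin_l.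
    assert (d <= Rmin d1 d2) by apply Rmin_r. pose proof (Rmin_l d1 d2). pose proof (Rmin_r d1 d2).
    (* A point different from [w], but so close that the common value [p u = q u] is within [e / 2]
       of both [p w] and [q w]. *)
    set (u := (w + RtoC (d/2))%C).
    assert (Eu : Cmod (u - w) = d/2).
    { unfold u. replace (w + RtoC (d/2) - w)%C with (RtoC (d/2)) by ring. rewrite Cmod_R, Rabs_pos_eq; lra. }
    assert (Nu : u <> w). { intros E'. rewrite E' in Eu. replace (w - w)%C with (RtoC 0) in Eu by ring. rewrite Cmod_0 in Eu. lra. }
    specialize (H1' u ltac:(lra)). specialize (H2' u ltac:(lra)).
    rewrite (Epq u ltac:(lra) Nu) in H1'.
    pose proof (Cmod_minus_le (q u - q w) (q u - p w)) as T.
    replace (q u - q w - (q u - p w))%C with (p w - q w)%C in T by ring. lra.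
  - assert (P := Cmod_pos _ (Csub_neq _ _ N)).
    apply (cdiff_ext_loc (fun u => (f u - f w) * / (u - w))%C q z (Cmod (z - w))); auto.
    + intros u Hu. assert (u <> w). { intros ->. rewrite Cmod_sub_sym in Hu. lra. }
      rewrite E. field. apply Csub_neq; auto.
    + apply cdiff_mult; [apply cdiff_minus; [auto|apply cdiff_const]|apply cdiff_kernel; auto].
Qed.

Lemma cdiff_shift f b z : cdiff f (b + z)%C -> cdiff (fun u => f (b + u)%C) z.
Proof.
  intros H. apply (cdiff_comp f (fun u => b + u)%C); auto.
  apply cdiff_plus; [apply cdiff_const|apply cdiff_id].
Qed.

(** If division by [z - w] never stopped, the maximum modulus of the k-th quotient on the circle of
    radius [2 * d] about [w], with [d = |z0 - w|], would give [|B z0| <= M / 2 ^ k] for every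
    [k]. *)
Lemma zero_order B w : (forall z, cdiff B z) -> (exists z, B z <> 0) ->
  exists k g, (forall z, cdiff g z) /\ g w <> 0 /\ forall z, (B z = (z - w) ^ k * g z)%C.
Proof.
  intros HB [z0 Hz0].
  destruct (excluded_middle_informative (exists k g, (forall z, cdiff g z) /\ g w <> 0 /\ forall z, (B z = (z - w) ^ k * g z)%C)) as [Y|N]; auto.
  exfalso.
  assert (A : forall k, exists g, (forall z, cdiff g z) /\ forall z, (B z = (z - w) ^ k * g z)%C).
  { induction k as [|k [g [Hg E]]].
    - exists B. split; auto. intros z. simpl. ring.
    - destruct (Ceq_dec (g w) 0) as [G0|G0].
      + destruct (entire_quotient g w Hg) as [q [Hq Eq]]. exists q. split; auto.
        intros z. rewrite E. replace (g z) with (q z * (z - w))%C by (rewrite <- Eq, G0; ring).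
        simpl. ring.
      + exfalso. apply N. exists k, g. auto. }
  assert (Nw : z0 <> w).
  { intros ->. destruct (A 1%nat) as [g [_ E]]. apply Hz0. rewrite E. simpl. ring. }
  assert (P := Cmod_pos _ (Csub_neq _ _ Nw)). set (d := Cmod (z0 - w)) in *.
  destruct (circle_bounded (fun u => B (w + u)%C) (2 * d)) as [M [HM HM']]; [lra| |].
  { intros u _. apply cdiff_ctn, cdiff_shift, HB. }
  assert (K : Cmod (B z0) <= 0).
  { destruct (Rle_lt_dec (Cmod (B z0)) 0) as [L|L]; auto. exfalso.
    (* [pow_bounded_le] turns [2 ^ n <= M / |B z0|] for all [n] into this absurdity. *)
    assert (X : 2 <= 1); [|lra].
    apply pow_bounded_le with (M / Cmod (B z0)); [lra|]. intros n. rewrite pow1, Rmult_1_r.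
    destruct (A n) as [g [Hg E]].
    assert (P2 : 0 < (2 * d) ^ n) by (apply pow_lt; lra).
    assert (G : Cmod (g z0) <= M / (2 * d) ^ n).
    { replace z0 with (w + (z0 - w))%C by ring.
      apply (max_modulus (fun u => g (w + u)%C) (2 * d)); [lra| | |unfold d; fold d; lra].
      - intros u _. apply cdiff_shift, Hg.
      - intros u Hu. specialize (HM' u Hu). rewrite E, Cmod_mult, Cmod_pow in HM'.
        replace (w + u - w)%C with u in HM' by ring. rewrite Hu in HM'.
        apply Rmult_le_reg_l with ((2 * d) ^ n); auto.
        replace ((2 * d) ^ n * (M / (2 * d) ^ n)) with M by (field; lra). auto. }
    assert (Bd : Cmod (B z0) <= d ^ n * (M / (2 * d) ^ n)).
    { rewrite E, Cmod_mult, Cmod_pow. fold d. apply Rmult_le_compat_l; auto. apply pow_le; lra. }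
    rewrite Rpow_mult_distr in Bd. assert (0 < 2 ^ n) by (apply pow_lt; lra).
    assert (0 < d ^ n) by (apply pow_lt; lra).
    replace (d ^ n * (M / (2 ^ n * d ^ n))) with (M / 2 ^ n) in Bd by (field; lra).
    apply Rmult_le_reg_r with (Cmod (B z0) * / 2 ^ n).
    { apply Rmult_lt_0_compat; auto. apply Rinv_0_lt_compat; auto. }
    replace (2 ^ n * (Cmod (B z0) * / 2 ^ n)) with (Cmod (B z0)) by (field; lra).
    replace (M / Cmod (B z0) * (Cmod (B z0) * / 2 ^ n)) with (M / 2 ^ n) by (field; lra). auto. }
  apply Cmod_zero_le in K. auto.
Qed.

(** The quotient of [f z - f 0] by [z] is entire and at most [2 * M / r] on the circle of radius
    [r]. *)
Lemma liouville f M : (forall z, cdiff f z) -> (forall z, Cmod (f z) <= M) -> forall z, f z = f 0.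
Proof.
  intros Hf HM z. destruct (entire_quotient f 0 Hf) as [q [Hq E]].
  assert (PM : 0 <= M) by (eapply Rle_trans; [apply Cmod_ge_0|apply (HM 0)]).
  apply Csub_eq. rewrite E.
  replace (q z) with (RtoC 0); [ring|]. symmetry. apply Cmod_le_all_eps. intros e He.
  set (r := Cmod z + 2 * M / e + 1). pose proof (Cmod_ge_0 z).
  assert (0 <= 2 * M / e) by (apply Rdiv_le_0_compat; lra).
  apply (max_modulus q r); auto; try (unfold r; lra).
  intros u Hu. assert (Hr : 0 < r) by (unfold r; lra).
  apply Rmult_le_reg_r with r; auto. rewrite <- Hu at 1.
  replace u with (u - 0)%C at 2 by ring. rewrite <- Cmod_mult, <- E.
  eapply Rle_trans; [apply Cmod_minus_le|]. pose proof (HM u). pose proof (HM 0).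
  assert (e * (2 * M / e) = 2 * M) by (field; lra). unfold r. nra.
Qed.

(** * The Poisson-Jensen inequality *)

Definition rctn (g : C -> R) (z : C) : Prop := ctn (fun w => RtoC (g w)) z.

Definition rmean (g : C -> R) (r : R) : R := fst (cmean (fun u => RtoC (g u)) r).

Definition rcirc (g : C -> R) (r : R) : Prop := forall z, Cmod z = r -> rctn g z.

Lemma rmean_le g h r : 0 <= r -> rcirc g r -> rcirc h r ->
  (forall z, Cmod z = r -> g z <= h z) -> rmean g r <= rmean h r.
Proof. intros Hr Hg Hh H. apply cmean_fst_le; auto. Qed.

Lemma rmean_ext g h r : 0 <= r -> (forall z, Cmod z = r -> g z = h z) -> rmean g r = rmean h r.
Proof. intros Hr H. unfold rmean. f_equal. apply cmean_ext; auto. intros z Hz. rewrite H; auto. Qed.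

Lemma rmean_const k r : rmean (fun _ => k) r = k.
Proof. unfold rmean. rewrite cmean_const. reflexivity. Qed.

Lemma rctn_plus g h z : rctn g z -> rctn h z -> rctn (fun w => g w + h w) z.
Proof.
  intros Hg Hh. apply (ctn_ext (fun w => RtoC (g w) + RtoC (h w))%C).
  - intros w. rewrite RtoC_plus. auto.
  - apply ctn_plus; auto.
Qed.

Lemma rctn_mult g h z : rctn g z -> rctn h z -> rctn (fun w => g w * h w) z.
Proof.
  intros Hg Hh. apply (ctn_ext (fun w => RtoC (g w) * RtoC (h w))%C).
  - intros w. rewrite RtoC_mult. auto.
  - apply ctn_mult; auto.
Qed.

Lemma rctn_const k z : rctn (fun _ => k) z.
Proof. apply (ctn_const (RtoC k)). Qed.

Lemma rmean_plus g h r : 0 <= r -> rcirc g r -> rcirc h r ->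
  rmean (fun z => g z + h z) r = rmean g r + rmean h r.
Proof.
  intros Hr Hg Hh. unfold rmean.
  rewrite (cmean_ext _ (fun u => RtoC (g u) + RtoC (h u))%C) by (auto; intros; apply RtoC_plus).
  rewrite cmean_plus; auto.
Qed.

Lemma rmean_scal k g r : 0 <= r -> rcirc g r -> rmean (fun z => k * g z) r = k * rmean g r.
Proof.
  intros Hr Hg. unfold rmean.
  rewrite (cmean_ext _ (fun u => RtoC k * RtoC (g u))%C) by (auto; intros; apply RtoC_mult).
  rewrite cmean_scal, fst_scal; auto.
Qed.

Lemma rmean_fst phi r : 0 <= r -> ccirc phi r -> rmean (fun u => fst (phi u)) r = fst (cmean phi r).
Proof.
  intros Hr H.
  assert (H' : ccirc (fun u => RtoC (fst (phi u))) r) by (intros z Hz; apply ctn_fst; auto).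
  apply Rle_antisym; apply cmean_fst_le; auto; intros; simpl; lra.
Qed.

(** The truncation is taken inside the logarithm, which keeps the function continuous at zeros of
    [f]. Level 0 is log^+; the levels [- K] serve Jensen's inequality for [B]. *)
Definition logmax (k : R) (f : C -> C) (z : C) : R := ln (Rmax (Cmod (f z)) (exp k)).

Lemma logmax_arg_pos k (f : C -> C) z : 0 < Rmax (Cmod (f z)) (exp k).
Proof. eapply Rlt_le_trans; [apply exp_pos|apply Rmax_r]. Qed.

Lemma logmax_ge k f z : k <= logmax k f z.
Proof.
  unfold logmax. rewrite <- (ln_exp k) at 1. apply ln_le; [apply exp_pos|apply Rmax_r].
Qed.

Lemma Cmod_le_exp_logmax k f z : Cmod (f z) <= exp (logmax k f z).
Proof. unfold logmax. rewrite exp_ln by apply logmax_arg_pos. apply Rmax_l. Qed.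

Lemma logmax_le k f z M : Cmod (f z) <= exp M -> k <= M -> logmax k f z <= M.
Proof.
  intros H1 H2. unfold logmax. rewrite <- (ln_exp M). apply ln_le; [apply logmax_arg_pos|].
  apply Rmax_lub; auto. destruct H2 as [H2| ->]; [left; apply exp_increasing; auto|lra].
Qed.

Lemma logmax_rctn k f z : ctn f z -> rctn (logmax k f) z.
Proof.
  intros Hf. unfold rctn, logmax.
  apply (ctn_real (fun x => ln (Rmax x (exp k))) (fun w => Cmod (f w))).
  2:{ apply ctn_Cmod; auto. }
  apply (continuity_pt_comp (fun x => Rmax x (exp k)) ln).
  - intros e He. exists e. split; auto. intros x [_ Hx]. simpl in *. unfold R_dist in *.
    eapply Rle_lt_trans; [|exact Hx]. unfold Rmax.
    destruct (Rle_dec x (exp k)), (Rle_dec (Cmod (f z)) (exp k)); unfold Rabs; repeat destruct Rcase_abs; lra.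
  - apply derivable_continuous_pt. exists (/ Rmax (Cmod (f z)) (exp k)).
    apply derivable_pt_lim_ln, logmax_arg_pos.
Qed.

(** The interior point comes first. In this form a Poisson integral is visibly the real part of a
    holomorphic function; [poisson_formula] recovers the usual kernel. *)
Definition poisson (z u : C) : R := fst ((u + z) / (u - z))%C.

Lemma poisson_ctn_C r z u : Cmod z < r -> Cmod u = r -> ctn (fun u => (u + z) / (u - z))%C u.
Proof.
  intros Hz Hu. apply ctn_mult.
  - apply ctn_plus; [apply ctn_id|apply ctn_const].
  - apply ctn_kernel. intros ->; lra.
Qed.

Lemma poisson_rcirc r z : Cmod z < r -> rcirc (poisson z) r.
Proof. intros Hz u Hu. apply (ctn_fst (fun u => (u + z) / (u - z))%C). apply (poisson_ctn_C r); auto. Qed.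

Lemma Cmod_sq (z : C) : Cmod z ^ 2 = fst z ^ 2 + snd z ^ 2.
Proof. unfold Cmod. rewrite pow2_sqrt; auto. nra. Qed.

Lemma fst_cayley z u : u <> z ->
  fst ((u + z) / (u - z))%C = (Cmod u ^ 2 - Cmod z ^ 2) / Cmod (u - z) ^ 2.
Proof.
  intros N. assert (P := Cmod_pos _ (Csub_neq _ _ N)).
  assert (P2 : 0 < Cmod (u - z) ^ 2) by (apply pow_lt; auto).
  rewrite !Cmod_sq in *. destruct u as [x y], z as [a b]. simpl in *. field. nra.
Qed.

Lemma poisson_formula r z u : Cmod z < r -> Cmod u = r ->
  poisson z u = (r ^ 2 - Cmod z ^ 2) / Cmod (u - z) ^ 2.
Proof. intros Hz Hu. unfold poisson. rewrite fst_cayley, Hu; auto. intros ->; lra. Qed.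

Lemma cmean_cayley r z : Cmod z < r -> cmean (fun u => (u + z) / (u - z))%C r = 1.
Proof.
  intros Hz. pose proof (Cmod_ge_0 z).
  rewrite (cmean_ext _ (fun u => 2 * (u / (u - z)) + (-1))%C); [|lra|].
  - assert (ccirc (fun u => u / (u - z))%C r).
    { intros u Hu. apply ctn_mult; [apply ctn_id|apply ctn_kernel]. intros ->; lra. }
    rewrite cmean_plus, cmean_scal, cmean_kernel, cmean_const; auto; try lra.
    + ring.
    + intros u Hu. apply ctn_mult; [apply ctn_const|auto].
    + intros u Hu. apply ctn_const.
  - intros u Hu. field. apply circle_neq with r; auto.
Qed.

Lemma rmean_poisson r z : Cmod z < r -> rmean (poisson z) r = 1.
Proof.
  intros Hz. pose proof (Cmod_ge_0 z). unfold poisson.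
  rewrite (rmean_fst (fun u => (u + z) / (u - z))%C), cmean_cayley; auto; try lra.
  intros u Hu. apply (poisson_ctn_C r); auto.
Qed.

Lemma poisson_pos r z u : Cmod z < r -> Cmod u = r -> 0 <= poisson z u.
Proof.
  intros Hz Hu. rewrite (poisson_formula r); auto. pose proof (Cmod_ge_0 z).
  assert (N : (u - z <> 0)%C) by (apply circle_neq with r; auto). apply Cmod_pos in N.
  apply Rdiv_le_0_compat; [nra|]. apply pow_lt; auto.
Qed.

(* Mass of the Poisson kernel far from [w] is negligible, near [w] the function
   [g] is almost constant. *)
Lemma poisson_lower g r G : 0 < r -> (forall z, rctn g z) ->
  (forall z, Cmod z <= r -> Rabs (g z) <= G) -> forall e, 0 < e ->
  exists r1, r1 < r /\ forall w, r1 <= Cmod w < r ->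
    g w - e <= rmean (fun u => g u * poisson w u) r.
Proof.
  intros Hr Hg HG e He.
  assert (HG0 : 0 <= G). { eapply Rle_trans; [apply Rabs_pos|apply (HG 0)]. rewrite Cmod_0; lra. }
  destruct (uniform_ctn (fun z => RtoC (g z)) (-r) r (-r) r) with (e := e/2) as [d [Hd HU]].
  { intros x y _ _. apply Hg. } { lra. }
  assert (HK : 0 < 4 * G * (2 * r) + 1) by nra.
  (* For [|w| >= r - s] and [|u - w| >= d] the kernel is at most the [b] below, and [s] is chosen so
     that [2 * G * b <= e / 2]. The summand 1 keeps the denominator positive when [G = 0]. *)
  set (s := e * d ^ 2 / (4 * G * (2 * r) + 1)).
  assert (Hs : 0 < s). { apply Rdiv_lt_0_compat; auto. apply Rmult_lt_0_compat; auto. apply pow_lt; auto. }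
  exists (r - s). split; [lra|]. intros w [Hw1 Hw2]. pose proof (Cmod_ge_0 w) as Pw.
  set (b := (r ^ 2 - Cmod w ^ 2) / d ^ 2).
  assert (Hd2 : 0 < d ^ 2) by (apply pow_lt; auto).
  assert (Hb0 : 0 <= b). { apply Rdiv_le_0_compat; auto. nra. }
  assert (Hb : 2 * G * b <= e / 2).
  { assert (r ^ 2 - Cmod w ^ 2 <= s * (2 * r)) by nra.
    assert (b <= s * (2 * r) / d ^ 2) by (apply Rmult_le_compat_r; [left; apply Rinv_0_lt_compat; auto|auto]).
    assert (2 * G * b <= 2 * G * (s * (2 * r) / d ^ 2)) by (apply Rmult_le_compat_l; lra).
    assert (E : 2 * G * (s * (2 * r) / d ^ 2) = e / 2 * ((4 * G * (2 * r)) / (4 * G * (2 * r) + 1))).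
    { unfold s. field. split; lra. }
    assert ((4 * G * (2 * r)) / (4 * G * (2 * r) + 1) <= 1).
    { apply Rmult_le_reg_r with (4 * G * (2 * r) + 1); auto. unfold Rdiv. rewrite Rmult_assoc, Rinv_l; lra. }
    nra. }
  assert (Pc : rcirc (poisson w) r) by (apply poisson_rcirc; auto).
  apply Rle_trans with (rmean (fun u => (g w - e / 2) * poisson w u + - (2 * G * b)) r).
  - rewrite rmean_plus, rmean_scal, rmean_const, rmean_poisson; auto; try lra.
    + intros z Hz. apply rctn_mult; [apply rctn_const|apply Pc; auto].
    + intros z Hz. apply rctn_const.
  - apply rmean_le; [lra| | |].
    + intros z Hz. apply rctn_plus; [|apply rctn_const]. apply rctn_mult; [apply rctn_const|apply Pc; auto].
    + intros z Hz. apply rctn_mult; [apply Hg|apply Pc; auto].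
    + intros u Hu. pose proof (poisson_pos r w u Hw2 Hu) as Pp.
      destruct (Rlt_dec (Cmod (u - w)) d) as [L|L].
      * assert (Cg : Rabs (g u - g w) < e / 2).
        { pose proof (fst_le_Cmod u) as F1. pose proof (snd_le_Cmod u) as F2.
          pose proof (fst_le_Cmod w) as F3. pose proof (snd_le_Cmod w) as F4.
          pose proof (fst_le_Cmod (u - w)%C) as F5. pose proof (snd_le_Cmod (u - w)%C) as F6.
          assert (forall x a, Rabs x <= a -> -a <= x <= a) as Ab.
          { intros x a Hx. apply Rabs_le_between. auto. }
          apply Ab in F1, F2, F3, F4. simpl in F5, F6.
          assert (HU' := HU (fst w) (snd w) (fst u) (snd u) ltac:(lra) ltac:(lra) ltac:(lra) ltac:(lra)
            ltac:(unfold Rminus; lra) ltac:(unfold Rminus; lra)).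
          rewrite <- !Ceta, <- RtoC_minus, Cmod_R in HU'. exact HU'. }
        apply Rabs_def2 in Cg. assert (0 <= G * b) by (apply Rmult_le_pos; auto). nra.
      * assert (Pb : poisson w u <= b).
        { rewrite (poisson_formula r); auto. unfold b. apply Rmult_le_compat_l; [nra|].
          apply Rinv_le_contravar; auto. apply pow_incr. lra. }
        pose proof (HG u ltac:(lra)) as G1. pose proof (HG w ltac:(lra)) as G2.
        apply Rabs_le_between in G1. apply Rabs_le_between in G2.
        assert (Q : (g w - g u) * poisson w u <= 2 * G * b).
        { apply Rle_trans with (2 * G * poisson w u).
          - apply Rmult_le_compat_r; lra.
          - apply Rmult_le_compat_l; lra. }
        assert (0 <= e / 2 * poisson w u) by (apply Rmult_le_pos; lra). lra.
Qed.

Lemma logmax_bounded k f r : 0 < r -> (forall z, cdiff f z) ->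
  exists G, forall z, Cmod z <= r -> Rabs (logmax k f z) <= G.
Proof.
  intros Hr Hf. destruct (circle_bounded f r Hr) as [M [HM HM']].
  { intros z _. apply cdiff_ctn, Hf. }
  exists (Rabs k + Rabs (ln M)). intros z Hz.
  assert (Hz' : Cmod (f z) <= M) by (apply (max_modulus f r); auto).
  pose proof (logmax_ge k f z) as L1.
  assert (L2 : logmax k f z <= Rmax (ln M) k).
  { apply logmax_le; [|apply Rmax_r]. eapply Rle_trans; [exact Hz'|].
    rewrite <- (exp_ln M HM) at 1. destruct (Rmax_l (ln M) k) as [L|L]; [left; apply exp_increasing; auto|rewrite <- L; lra]. }
  apply Rabs_le. unfold Rmax in L2. destruct (Rle_dec (ln M) k);
  pose proof (Rle_abs k); pose proof (Rle_abs (ln M)); pose proof (Rle_abs (-k));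
  rewrite Rabs_Ropp in *; pose proof (Rabs_pos k); pose proof (Rabs_pos (ln M)); lra.
Qed.

(* Divide [f] by [exp h], where Re h is the Poisson integral of [g = logmax k f]:
   near the circle [Re h] is almost at least [g]. *)
Lemma poisson_jensen k f r z : 0 < r -> (forall z, cdiff f z) -> Cmod z < r ->
  Cmod (f z) <= exp (rmean (fun u => logmax k f u * poisson z u) r).
Proof.
  intros Hr Hf Hz. set (g := logmax k f).
  assert (Hg : forall z, rctn g z) by (intros; apply logmax_rctn, cdiff_ctn, Hf).
  destruct (logmax_bounded k f r Hr Hf) as [G HG]. fold g in HG.
  (* Since [2 * u / (u - w) - 1 = (u + w) / (u - w)], the real part of [h] is the Poisson integral
     of [g]. *)
  set (h := fun w => (2 * ctrans (fun u => RtoC (g u) * u)%C r w - cmean (fun u => RtoC (g u)) r)%C).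
  assert (Gu : ccirc (fun u => RtoC (g u) * u)%C r).
  { intros u _. apply ctn_mult; [apply Hg|apply ctn_id]. }
  assert (Hh : forall w, Cmod w < r -> cdiff h w).
  { intros w Hw. apply cdiff_minus; [|apply cdiff_const]. apply cdiff_mult; [apply cdiff_const|].
    apply ctrans_cdiff; auto. }
  assert (Eh : forall w, Cmod w < r -> fst (h w) = rmean (fun u => g u * poisson w u) r).
  { intros w Hw.
    assert (Kw : ccirc (fun u => RtoC (g u) * ((u + w) / (u - w)))%C r).
    { intros u Hu. apply ctn_mult; [apply Hg|apply (poisson_ctn_C r); auto]. }
    rewrite (rmean_ext _ (fun u => fst (RtoC (g u) * ((u + w) / (u - w)))%C)); [|lra|].
    - rewrite rmean_fst; auto; [|lra]. f_equal. unfold h, ctrans.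
      rewrite <- cmean_scal, <- cmean_minus; try lra.
      + apply cmean_ext; [lra|]. intros u Hu. field. apply circle_neq with r; auto.
      + intros u Hu. apply ctn_mult; [apply ctn_const|]. apply (ccirc_kernel _ r); auto.
      + intros u Hu. apply Hg.
      + apply ccirc_kernel; auto.
    - intros u Hu. rewrite fst_scal. reflexivity. }
  destruct (Req_dec (Cmod (f z)) 0) as [E|N].
  { rewrite E. left; apply exp_pos. }
  assert (Pf : 0 < Cmod (f z)) by (pose proof (Cmod_ge_0 (f z)); lra).
  rewrite <- (exp_ln _ Pf), <- Eh by auto.
  assert (L : ln (Cmod (f z)) <= fst (h z)).
  2:{ destruct L as [L|L]; [left; apply exp_increasing; auto|rewrite L; lra]. }
  apply le_epsilon. intros e He.
  destruct (poisson_lower g r G Hr Hg HG e He) as [r1 [Hr1 HL]].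
  (* [h] is differentiable inside the circle only, so the maximum principle is applied on a radius
     below [r], beyond [|z|] and close enough to [r] for [poisson_lower]. *)
  set (r2 := Rmax r1 ((Cmod z + r) / 2)).
  assert (r1 <= r2) by apply Rmax_l. assert ((Cmod z + r) / 2 <= r2) by apply Rmax_r.
  assert (r2 < r) by (apply Rmax_lub_lt; lra). pose proof (Cmod_ge_0 z).
  assert (B : Cmod (f z * Cexp (- h z)) <= exp e).
  { apply (max_modulus (fun w => f w * Cexp (- h w))%C r2); try lra.
    - intros w Hw. apply cdiff_mult; [apply Hf|]. apply (cdiff_comp Cexp (fun w => - h w)%C).
      + apply cdiff_opp, Hh; lra.
      + apply cdiff_Cexp.
    - intros w Hw. rewrite Cmod_mult, Cmod_Cexp.
      assert (Lw := HL w ltac:(lra)). rewrite <- Eh in Lw by lra.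
      pose proof (Cmod_le_exp_logmax k f w) as Lf. fold g in Lf.
      apply Rle_trans with (exp (g w) * exp (fst (- h w)%C)).
      + apply Rmult_le_compat_r; auto. left; apply exp_pos.
      + rewrite <- exp_plus. change (fst (- h w)%C) with (- fst (h w)).
        assert (D : g w + - fst (h w) <= e) by lra.
        destruct D as [D|D]; [left; apply exp_increasing; exact D|right; f_equal; exact D]. }
  rewrite Cmod_mult, Cmod_Cexp in B. change (fst (- h z)%C) with (- fst (h z)) in B.
  rewrite <- (exp_ln _ Pf), <- exp_plus in B.
  destruct (Rle_lt_dec (ln (Cmod (f z)) + - fst (h z)) e) as [D|D]; [lra|].
  apply exp_increasing in D. lra.
Qed.

Lemma jensen k f r : 0 < r -> (forall z, cdiff f z) -> Cmod (f 0) <= exp (rmean (logmax k f) r).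
Proof.
  intros Hr Hf. rewrite (rmean_ext _ (fun u => logmax k f u * poisson 0 u)); [|lra|].
  - apply poisson_jensen; auto. rewrite Cmod_0; auto.
  - intros u Hu. rewrite (poisson_formula r); auto; [|rewrite Cmod_0; lra].
    replace (u - 0)%C with u by ring. rewrite Hu, Cmod_0. field. lra.
Qed.

(** For [|z| <= r / 2] the Poisson kernel is at most [(r + |z|) / (r - |z|) <= 3], and log^+ is
    nonnegative. *)
Lemma logmax_harnack f r z : 0 < r -> (forall z, cdiff f z) -> Cmod z <= r / 2 ->
  logmax 0 f z <= 3 * rmean (logmax 0 f) r.
Proof.
  intros Hr Hf Hz. pose proof (Cmod_ge_0 z) as Pz.
  assert (Hg : forall z, rctn (logmax 0 f) z) by (intros; apply logmax_rctn, cdiff_ctn, Hf).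
  assert (M0 : 0 <= rmean (logmax 0 f) r).
  { apply Rle_trans with (rmean (fun _ => 0) r); [rewrite rmean_const; lra|]. apply rmean_le; [lra| | |].
    - intros u _. apply rctn_const.
    - intros u _. apply Hg.
    - intros u _. apply logmax_ge. }
  apply logmax_le; [|lra].
  eapply Rle_trans; [apply (poisson_jensen 0 f r z); auto; lra|].
  assert (L : rmean (fun u => logmax 0 f u * poisson z u) r <= 3 * rmean (logmax 0 f) r).
  { rewrite <- rmean_scal; [|lra|intros u _; apply Hg]. apply rmean_le; [lra| | |].
    - intros u Hu. apply rctn_mult; [apply Hg|]. apply (poisson_rcirc r); auto. lra.
    - intros u Hu. apply rctn_mult; [apply rctn_const|apply Hg].
    - intros u Hu. rewrite (Rmult_comm 3). apply Rmult_le_compat_l; [apply logmax_ge|].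
      rewrite (poisson_formula r); auto; [|lra].
      pose proof (Cmod_minus_ge u z) as T. rewrite Hu in T.
      assert (P : 0 < Cmod (u - z) ^ 2) by (apply pow_lt; lra).
      apply Rmult_le_reg_r with (Cmod (u - z) ^ 2); auto.
      unfold Rdiv. rewrite Rmult_assoc, Rinv_l, Rmult_1_r by lra.
      assert ((r - Cmod z) ^ 2 <= Cmod (u - z) ^ 2) by (apply pow_incr; lra). nra. }
  destruct L as [L|L]; [left; apply exp_increasing; auto|rewrite L; lra].
Qed.

(** * Growth of quotients *)

Lemma exp_le_compat x y : x <= y -> exp x <= exp y.
Proof. intros [H|H]; [left; apply exp_increasing; auto|right; f_equal; auto]. Qed.

Lemma logmax_large k f z : exp k <= Cmod (f z) -> logmax k f z = ln (Cmod (f z)).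
Proof. intros H. unfold logmax. rewrite Rmax_left; auto. Qed.

Lemma logmax_small k f z : Cmod (f z) <= exp k -> logmax k f z = k.
Proof. intros H. unfold logmax. rewrite Rmax_right, ln_exp; auto. Qed.

(* Jensen's inequality for [B] at the origin bounds the mean of the negative part
   of log|B|, hence that of log^+ |S|, and [logmax_harnack] turns the mean into
   a pointwise bound. *)
Lemma quotient_log_bound F B S R MF MB : 0 < R ->
  (forall z, cdiff B z) -> (forall z, cdiff S z) ->
  (forall z, F z = (S z * B z)%C) -> B 0 <> 0 -> 0 <= MF -> 0 <= MB ->
  (forall z, Cmod z = 2 * R -> Cmod (F z) <= exp MF /\ Cmod (B z) <= exp MB) ->
  forall z, Cmod z <= R -> logmax 0 S z <= 3 * (MF + MB - ln (Cmod (B 0))).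
Proof.
  intros HR HB HS E B0 HMF HMB H z Hz.
  assert (HR2 : 0 < 2 * R) by lra.
  eapply Rle_trans; [apply (logmax_harnack S (2 * R)); auto; lra|].
  apply Rmult_le_compat_l; [lra|].
  destruct (logmax_bounded 0 S (2 * R) HR2 HS) as [K0 HK0].
  (* The truncation level [- K] fits the bound for [S]: where [|B| < exp (- K)], one has
     [logmax 0 S <= K = - logmax (- K) B]. *)
  set (K := Rabs K0).
  assert (HK : forall z, Cmod z <= 2 * R -> logmax 0 S z <= K).
  { intros w Hw. unfold K. eapply Rle_trans; [apply Rle_abs|]. eapply Rle_trans; [apply HK0; auto|]. apply Rle_abs. }
  assert (HKp : 0 <= K) by apply Rabs_pos.
  assert (J : ln (Cmod (B 0)) <= rmean (logmax (- K) B) (2 * R)).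
  { rewrite <- (ln_exp (rmean (logmax (- K) B) (2 * R))). apply ln_le; [apply Cmod_pos; auto|].
    apply jensen; auto. }
  assert (CB : rcirc (logmax (- K) B) (2 * R)) by (intros u _; apply logmax_rctn, cdiff_ctn, HB).
  apply Rle_trans with (rmean (fun u => (MF + MB) + (-1) * logmax (- K) B u) (2 * R)).
  - apply rmean_le; [lra| | |].
    + intros u _. apply logmax_rctn, cdiff_ctn, HS.
    + intros u Hu. apply rctn_plus; [apply rctn_const|apply rctn_mult; [apply rctn_const|apply CB; auto]].
    + intros u Hu. destruct (H u Hu) as [H1 H2].
      destruct (Rle_dec (exp (- K)) (Cmod (B u))) as [L|L].
      * rewrite (logmax_large (- K) B) by auto.
        assert (PB : 0 < Cmod (B u)) by (eapply Rlt_le_trans; [apply exp_pos|exact L]).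
        assert (L2 : ln (Cmod (B u)) <= MB). { rewrite <- (ln_exp MB). apply ln_le; auto. }
        apply logmax_le; [|lra].
        apply Rmult_le_reg_r with (Cmod (B u)); auto.
        rewrite <- Cmod_mult, <- E. rewrite <- (exp_ln _ PB) at 2. rewrite <- exp_plus.
        eapply Rle_trans; [exact H1|]. apply exp_le_compat. lra.
      * rewrite (logmax_small (- K) B) by lra. specialize (HK u ltac:(lra)). lra.
  - rewrite rmean_plus, rmean_const, rmean_scal; auto; try lra.
    + intros u _. apply rctn_const.
    + intros u Hu. apply rctn_mult; [apply rctn_const|apply CB; auto].
Qed.

(** Finite order in a form that is easily combined under sums, products and translations: the
    exponent is natural, and [1 + Cmod z] lets the bound hold on the whole plane. *)
Definition growth (f : C -> C) : Prop := exists (N : nat) (K : R), 0 < K /\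
  forall z, Cmod (f z) <= exp (K * (1 + Cmod z) ^ N).

Lemma one_le_pow x n : 1 <= x -> 1 <= x ^ n.
Proof. intros H. apply pow_R1_Rle; auto. Qed.

Lemma growth_ext f g : (forall z, f z = g z) -> growth f -> growth g.
Proof. intros E [N [K [HK H]]]. exists N, K. split; auto. intros z. rewrite <- E. auto. Qed.

Lemma pow_le_add x n m : 1 <= x -> x ^ n <= x ^ (n + m).
Proof. intros H. apply Rle_pow; auto. lia. Qed.

Lemma growth_common f g : growth f -> growth g -> exists N K, 0 < K /\
  forall z, Cmod (f z) <= exp (K * (1 + Cmod z) ^ N) /\ Cmod (g z) <= exp (K * (1 + Cmod z) ^ N).
Proof.
  intros [N [K [HK H]]] [N' [K' [HK' H']]]. exists (N + N')%nat, (K + K'). split; [lra|].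
  intros z. pose proof (Cmod_ge_0 z) as P. specialize (H z). specialize (H' z).
  assert (A := pow_le_add (1 + Cmod z) N N' ltac:(lra)).
  assert (A' := pow_le_add (1 + Cmod z) N' N ltac:(lra)). rewrite (Nat.add_comm N' N) in A'.
  assert (B := one_le_pow (1 + Cmod z) N ltac:(lra)). assert (B' := one_le_pow (1 + Cmod z) N' ltac:(lra)).
  split; (eapply Rle_trans; [eassumption|]); apply exp_le_compat; nra.
Qed.

Lemma growth_mult f g : growth f -> growth g -> growth (fun z => (f z * g z)%C).
Proof.
  intros Hf Hg. destruct (growth_common f g Hf Hg) as [N [K [HK H]]].
  exists N, (K + K). split; [lra|]. intros z. destruct (H z) as [H1 H2].
  rewrite Cmod_mult, Rmult_plus_distr_r, exp_plus.
  apply Rmult_le_compat; auto; apply Cmod_ge_0.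
Qed.

Lemma growth_plus f g : growth f -> growth g -> growth (fun z => (f z + g z)%C).
Proof.
  intros Hf Hg. destruct (growth_common f g Hf Hg) as [N [K [HK H]]].
  (* The extra 1 absorbs the factor 2 of a sum of two bounds, since [exp ((1 + |z|) ^ N) >= 2]. *)
  exists N, (K + 1). split; [lra|]. intros z. destruct (H z) as [H1 H2].
  eapply Rle_trans; [apply Cmod_triangle|]. rewrite Rmult_plus_distr_r, exp_plus, Rmult_1_l.
  pose proof (Cmod_ge_0 z). pose proof (one_le_pow (1 + Cmod z) N ltac:(lra)).
  assert (2 <= exp ((1 + Cmod z) ^ N)). { pose proof (exp_ineq1_le ((1 + Cmod z) ^ N)). lra. }
  pose proof (exp_pos (K * (1 + Cmod z) ^ N)). nra.
Qed.

Lemma growth_const k : growth (fun _ => k).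
Proof.
  pose proof (Cmod_ge_0 k). exists 0%nat, (Cmod k + 1). split; [lra|]. intros z. simpl.
  rewrite Rmult_1_r. pose proof (exp_ineq1_le (Cmod k + 1)). lra.
Qed.

Lemma growth_id : growth (fun z => z).
Proof.
  exists 1%nat, 1. split; [lra|]. intros z. simpl.
  pose proof (exp_ineq1_le (1 * ((1 + Cmod z) * 1))). lra.
Qed.

Lemma growth_shift f b : growth f -> growth (fun z => f (b + z)%C).
Proof.
  intros [N [K [HK H]]]. pose proof (Cmod_ge_0 b) as Pb.
  exists N, (K * (1 + Cmod b) ^ N). split.
  - apply Rmult_lt_0_compat; auto. apply pow_lt. lra.
  - intros z. eapply Rle_trans; [apply H|]. apply exp_le_compat.
    rewrite Rmult_assoc, <- Rpow_mult_distr. apply Rmult_le_compat_l; [lra|].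
    pose proof (Cmod_ge_0 z). pose proof (Cmod_ge_0 (b + z)%C). pose proof (Cmod_triangle b z).
    apply pow_incr. nra.
Qed.

Lemma finite_order_growth f : finite_order f -> growth f.
Proof.
  intros [He [rho [R0 [Hrho [HR0 H]]]]]. rewrite entire_cdiff in He.
  destruct (INR_unbounded rho) as [N HN].
  assert (P : 0 < Rpower R0 rho) by apply exp_pos.
  exists N, (1 + Rpower R0 rho). split; [lra|]. intros z.
  pose proof (Cmod_ge_0 z) as Pz. pose proof (one_le_pow (1 + Cmod z) N ltac:(lra)) as P1.
  destruct (Rle_lt_dec R0 (Cmod z)) as [L|L].
  - eapply Rle_trans; [apply H; auto|]. apply exp_le_compat.
    apply Rle_trans with ((1 + Cmod z) ^ N); [|nra].
    rewrite <- Rpower_pow by lra.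
    apply Rle_trans with (Rpower (Cmod z) (INR N)).
    + apply Rle_Rpower; lra.
    + apply Rle_Rpower_l; [apply pos_INR|lra].
  - apply Rle_trans with (exp (Rpower R0 rho)).
    (* The definition gives no bound inside the disc of radius [R0]; the one on its boundary extends
       inwards. *)
    + apply (max_modulus f R0); auto; try lra.
      intros w Hw. eapply Rle_trans; [apply H; lra|]. rewrite Hw. lra.
    + apply exp_le_compat. nra.
Qed.

(** Translation by [b] moves a point where [B] does not vanish to the origin, where Jensen's
    inequality needs it. *)
Lemma growth_quotient F B S b : (forall z, cdiff B z) -> (forall z, cdiff S z) ->
  (forall z, F z = (S z * B z)%C) -> B b <> 0 -> growth F -> growth B -> growth S.
Proof.
  intros HB HS E Bb GF GB.
  assert (G : growth (fun z => S (b + z)%C)).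
  { destruct (growth_common _ _ (growth_shift F b GF) (growth_shift B b GB)) as [N [K [HK H]]].
    set (L := Rabs (ln (Cmod (B b)))). assert (HL : 0 <= L) by apply Rabs_pos.
    assert (P3 : 0 < 3 ^ N) by (apply pow_lt; lra).
    exists N, (3 * (K * 3 ^ N + K * 3 ^ N + L)). split. { nra. }
    intros z. pose proof (Cmod_ge_0 z) as Pz. set (R := 1 + Cmod z).
    assert (HR : 1 <= R) by (unfold R; lra).
    assert (PN : 1 <= R ^ N) by (apply one_le_pow; auto).
    (* For [|u| = 2 * R] one has [1 + |u| <= 3 * R]. *)
    set (M := K * 3 ^ N * R ^ N).
    assert (HM : 0 <= M) by (unfold M; repeat apply Rmult_le_pos; lra).
    eapply Rle_trans; [apply (Cmod_le_exp_logmax 0 (fun z => S (b + z)%C))|]. apply exp_le_compat.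
    eapply Rle_trans.
    - apply (quotient_log_bound (fun z => F (b + z)%C) (fun z => B (b + z)%C) (fun z => S (b + z)%C) R M M); auto.
      + lra.
      + intros u. apply cdiff_shift, HB.
      + intros u. apply cdiff_shift, HS.
      + replace (b + 0)%C with b by ring. auto.
      + intros u Hu. destruct (H u) as [H1 H2].
        assert (X : K * (1 + Cmod u) ^ N <= M).
        { unfold M. rewrite Rmult_assoc, <- Rpow_mult_distr. apply Rmult_le_compat_l; [lra|].
          apply pow_incr. lra. }
        apply exp_le_compat in X. split; eapply Rle_trans; eauto.
      + unfold R; lra.
    - replace (b + 0)%C with b by ring.
      pose proof (Rle_abs (- ln (Cmod (B b)))) as A. rewrite Rabs_Ropp in A. fold L in A.
      unfold M. assert (L <= L * R ^ N) by nra. lra. }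
  apply (growth_shift _ (- b)) in G. apply (growth_ext (fun z => S (b + (- b + z))%C)); auto.
  intros z. f_equal. ring.
Qed.

(** * Circles on which a discrete potential is small in the mean *)

(** Indices run strictly below [n], so the empty sum is included; [sum_n] contains its upper index,
    hence the shift in [fsum_sum_n]. *)
Fixpoint fsum (f : nat -> R) (n : nat) : R :=
  match n with O => 0 | S m => fsum f m + f m end.

Lemma fsum_le f g n : (forall k, (k < n)%nat -> f k <= g k) -> fsum f n <= fsum g n.
Proof.
  induction n as [|n IH]; intros H; simpl; [lra|].
  apply Rplus_le_compat; [apply IH; intros; apply H; lia|apply H; lia].
Qed.

Lemma fsum_nonneg f n : (forall k, 0 <= f k) -> 0 <= fsum f n.
Proof. intros H. induction n; simpl; [lra|]. specialize (H n). lra. Qed.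

Lemma fsum_term_le f n k : (forall k, 0 <= f k) -> (k < n)%nat -> f k <= fsum f n.
Proof.
  intros H. induction n as [|n IH]; intros L; [lia|]. simpl.
  pose proof (H n). pose proof (fsum_nonneg f n H).
  destruct (Nat.eq_dec k n) as [->|N]; [lra|]. specialize (IH ltac:(lia)). lra.
Qed.

Lemma fsum_scal c f n : fsum (fun k => c * f k) n = c * fsum f n.
Proof. induction n as [|n IH]; simpl; [ring|]. rewrite IH. ring. Qed.

Lemma fsum_plus f g n : fsum (fun k => f k + g k) n = fsum f n + fsum g n.
Proof. induction n as [|n IH]; simpl; [ring|]. rewrite IH. ring. Qed.

Lemma fsum_sum_n f n : fsum f (S n) = sum_n f n.
Proof.
  induction n as [|n IH].
  - rewrite sum_O. simpl. ring.
  - rewrite sum_Sn, <- IH. reflexivity.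
Qed.

Lemma fsum_le_Series f n : (forall k, 0 <= f k) -> ex_series f -> fsum f n <= Series f.
Proof.
  intros H [l Hl]. rewrite (is_series_unique f l Hl).
  apply (is_lim_seq_incr_compare (fun n => fsum f n)).
  - apply is_lim_seq_incr_1. apply (is_lim_seq_ext (sum_n f)); [intros; symmetry; apply fsum_sum_n|exact Hl].
  - intros k. simpl. specialize (H k). lra.
Qed.

Lemma Series_le_fsum f B : ex_series f -> (forall M, fsum f M <= B) -> Series f <= B.
Proof.
  intros [l Hl] HM. rewrite (is_series_unique f l Hl).
  apply (is_lim_seq_le (fun n => fsum f (S n)) (fun _ => B) l B); auto.
  - apply (is_lim_seq_ext (sum_n f)); [intros; symmetry; apply fsum_sum_n|exact Hl].
  - apply is_lim_seq_const.
Qed.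

(** Keeps the indexing of [f], for termwise comparison in [good_circles]. *)
Definition tail (f : nat -> R) (N n : nat) : R := if Nat.ltb n N then 0 else f n.

Lemma fsum_tail f N M : (forall n, 0 <= f n) -> fsum (tail f N) M + fsum f N <= fsum f (N + M).
Proof.
  intros H.
  assert (A : forall k, fsum (tail f N) k <= 0 + (fsum f (Nat.max N k) - fsum f N)).
  { induction k as [|k IH].
    - rewrite Nat.max_l by lia. simpl. lra.
    - simpl. unfold tail at 2. destruct (Nat.ltb_spec k N) as [L|L].
      + rewrite Nat.max_l in * by lia. lra.
      + rewrite (Nat.max_r N (S k)) by lia. rewrite Nat.max_r in IH by lia. simpl. lra. }
  assert (B : forall a b, (a <= b)%nat -> fsum f a <= fsum f b).
  { intros a b L. induction L; simpl; [lra|]. specialize (H m). lra. }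
  specialize (A M). pose proof (B (Nat.max N M) (N + M)%nat ltac:(lia)). lra.
Qed.

Lemma small_tail f : (forall n, 0 <= f n) -> ex_series f -> forall e, 0 < e ->
  exists N, forall M, fsum (tail f N) M <= e.
Proof.
  intros H Hf e He. destruct (Hf) as [l Hl].
  assert (L : is_lim_seq (sum_n f) l) by exact Hl.
  apply is_lim_seq_spec in L. destruct (L (mkposreal e He)) as [N HN].
  exists (S N). intros M. specialize (HN N (Nat.le_refl _)). simpl in HN.
  rewrite <- fsum_sum_n in HN. apply Rabs_def2 in HN.
  pose proof (fsum_tail f (S N) M H). pose proof (fsum_le_Series f (S N + M) H Hf) as B.
  rewrite (is_series_unique f l Hl) in B. lra.
Qed.

(** A smooth substitute for [sqrt |x|]. Accordingly [2 * x / smooth4 eta x] replaces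
    [2 sign(x) sqrt |x|], the antiderivative of [1 / sqrt |x|] that is not differentiable at 0. *)
Definition smooth4 (eta x : R) : R := sqrt (sqrt (x ^ 2 + eta ^ 2)).

Lemma smooth4_pos eta x : 0 < eta -> 0 < smooth4 eta x.
Proof. intros H. unfold smooth4. apply sqrt_lt_R0, sqrt_lt_R0. nra. Qed.

Lemma smooth4_pow4 eta x : smooth4 eta x ^ 4 = x ^ 2 + eta ^ 2.
Proof.
  unfold smooth4. replace (sqrt (sqrt (x ^ 2 + eta ^ 2)) ^ 4) with ((sqrt (sqrt (x ^ 2 + eta ^ 2)) ^ 2) ^ 2) by ring.
  rewrite pow2_sqrt by apply sqrt_pos. rewrite pow2_sqrt; nra.
Qed.

Lemma smooth4_derive eta x : 0 < eta ->
  derivable_pt_lim (fun x => 2 * x / smooth4 eta x) x (2 / smooth4 eta x - x ^ 2 / smooth4 eta x ^ 5).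
Proof.
  intros H. pose proof (smooth4_pos eta x H) as P. pose proof (smooth4_pow4 eta x) as E.
  apply is_derive_Reals. unfold smooth4 at 1.
  assert (P1 : 0 < x * (x * 1) + eta * (eta * 1)) by nra.
  assert (P2 : 0 < sqrt (x * (x * 1) + eta * (eta * 1))) by (apply sqrt_lt_R0; auto).
  assert (P3 : 0 < sqrt (sqrt (x * (x * 1) + eta * (eta * 1)))) by (apply sqrt_lt_R0; auto).
  auto_derive.
  - repeat split; auto; lra.
  - assert (S2 : sqrt (x * (x * 1) + eta * (eta * 1)) = smooth4 eta x ^ 2).
    { unfold smooth4. rewrite pow2_sqrt; [reflexivity|apply sqrt_pos]. }
    change (sqrt (sqrt (x * (x * 1) + eta * (eta * 1)))) with (smooth4 eta x).
    rewrite ?S2. set (y := smooth4 eta x) in *. field. lra.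
Qed.

Lemma smooth4_bound eta x : 0 < eta -> 2 * x / smooth4 eta x <= 2 * sqrt (Rabs x).
Proof.
  intros H. pose proof (smooth4_pos eta x H) as P. pose proof (smooth4_pow4 eta x) as E.
  set (y := smooth4 eta x) in *. set (a := sqrt (Rabs x)).
  assert (Ha : 0 <= a) by apply sqrt_pos.
  assert (Ea : a * a = Rabs x) by (apply sqrt_sqrt, Rabs_pos).
  assert (L : a <= y).
  { destruct (Rle_lt_dec a y) as [L|L]; auto. exfalso.
    assert (y ^ 4 < a ^ 4). { simpl. assert (y * y < a * a) by nra. nra. }
    assert (a ^ 4 = x ^ 2). { replace (a ^ 4) with ((a * a) * (a * a)) by ring. rewrite Ea, <- Rabs_mult, Rabs_pos_eq; nra. }
    nra. }
  apply Rmult_le_reg_r with y; auto. unfold Rdiv. rewrite Rmult_assoc, Rinv_l, Rmult_1_r by lra.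
  pose proof (Rle_abs x). nra.
Qed.

Lemma smooth4_odd eta x : smooth4 eta (- x) = smooth4 eta x.
Proof. unfold smooth4. f_equal. f_equal. ring. Qed.

(** As [x ^ 2 <= smooth4 eta x ^ 4], the subtracted term is at most [/ smooth4 eta x]. *)
Lemma smooth4_deriv_ge eta x : 0 < eta -> / smooth4 eta x <= 2 / smooth4 eta x - x ^ 2 / smooth4 eta x ^ 5.
Proof.
  intros H. pose proof (smooth4_pos eta x H) as P. pose proof (smooth4_pow4 eta x) as E.
  set (y := smooth4 eta x) in *.
  assert (P5 : 0 < y ^ 5) by (apply pow_lt; auto).
  assert (x ^ 2 / y ^ 5 <= / y); [|unfold Rdiv in *; lra].
  apply Rmult_le_reg_r with (y ^ 5); auto. unfold Rdiv. rewrite Rmult_assoc, Rinv_l, Rmult_1_r by lra.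
  replace (/ y * y ^ 5) with (y ^ 4) by (field; lra). rewrite E. nra.
Qed.

Lemma fsum_derive (f f' : nat -> R -> R) n x :
  (forall k, derivable_pt_lim (f k) x (f' k x)) ->
  derivable_pt_lim (fun x => fsum (fun k => f k x) n) x (fsum (fun k => f' k x) n).
Proof.
  intros H. induction n as [|n IH]; simpl.
  - apply derivable_pt_lim_const.
  - apply (derivable_pt_lim_plus (fun x => fsum (fun k => f k x) n) (f n)); auto.
Qed.

Lemma finite_pos_lower (c : nat -> R) n : (forall k, 0 < c k) -> exists e, 0 < e /\ forall k, (k < n)%nat -> e <= c k.
Proof.
  intros H. induction n as [|n [e [He IH]]].
  - exists 1. split; [lra|]. intros; lia.
  - exists (Rmin e (c n)). split. { apply Rmin_pos; auto. }
    intros k Hk. destruct (Nat.eq_dec k n) as [->|N]; [apply Rmin_r|].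
    eapply Rle_trans; [apply Rmin_l|apply IH; lia].
Qed.

(* The mean value theorem applied to [x |-> sum w_k * 2 (x - s_k) / smooth4 eta (x - s_k)],
   a smoothed antiderivative of [sum w_k / sqrt |x - s_k|]; a small [eta] keeps the
   radius found away from the [s_k]. *)
Lemma good_radius (w s : nat -> R) (N : nat) (R : R) : 0 < R ->
  (forall k, 0 <= w k) -> (forall k, 0 <= s k) -> (forall k, 0 < w k -> s k < 4 * R) ->
  exists rho, R < rho < 2 * R /\ (forall k, (k < N)%nat -> 0 < w k -> rho <> s k) /\
    fsum (fun k => w k / sqrt (Rabs (rho - s k))) N <= 16 * fsum w N / sqrt R.
Proof.
  intros HR Hw Hs Hws.
  assert (SR : 0 < sqrt R) by (apply sqrt_lt_R0; auto).
  set (K := 8 * fsum w N / sqrt R).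
  assert (HK : 0 <= K). { apply Rdiv_le_0_compat; auto. pose proof (fsum_nonneg w N Hw). lra. }
  (* If [w k / smooth4 eta (rho - s k) <= K], this choice forces the fourth power of [smooth4] to be
     at least [4 * eta ^ 2], hence [|rho - s k| >= eta]. Indices of weight zero get the dummy value
     1. *)
  destruct (finite_pos_lower (fun k => if Rlt_dec 0 (w k) then (w k / (K + 1)) ^ 2 / 2 else 1) N) as [eta [He Heta]].
  { intros k. destruct (Rlt_dec 0 (w k)); [|lra].
    assert (0 < (w k / (K + 1)) ^ 2) by (apply pow_lt, Rdiv_lt_0_compat; lra). lra. }
  set (Psi := fun k x => w k * (2 * (x - s k) / smooth4 eta (x - s k))).
  set (Psi' := fun k x => w k * (2 / smooth4 eta (x - s k) - (x - s k) ^ 2 / smooth4 eta (x - s k) ^ 5)).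
  assert (D : forall k x, derivable_pt_lim (Psi k) x (Psi' k x)).
  { intros k x. apply (derivable_pt_lim_scal (fun x => 2 * (x - s k) / smooth4 eta (x - s k))).
    replace (2 / smooth4 eta (x - s k) - (x - s k) ^ 2 / smooth4 eta (x - s k) ^ 5)
      with ((2 / smooth4 eta (x - s k) - (x - s k) ^ 2 / smooth4 eta (x - s k) ^ 5) * (1 - 0)) by ring.
    apply (derivable_pt_lim_comp (fun x => x - s k) (fun x => 2 * x / smooth4 eta x)).
    - apply (derivable_pt_lim_minus (fun x => x) (fun _ => s k)); [apply derivable_pt_lim_id|apply derivable_pt_lim_const].
    - apply smooth4_derive; auto. }
  destruct (MVT_cor2 (fun x => fsum (fun k => Psi k x) N) (fun x => fsum (fun k => Psi' k x) N) R (2 * R)) as [rho [E Hrho]].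
  { lra. } { intros x _. apply fsum_derive; auto. }
  (* Both ends of [[R, 2 * R]] are within [4 * R] of every [s k] of positive weight, so each end
     contributes at most [2 * sqrt (4 * R)] per unit of weight. *)
  assert (B : fsum (fun k => Psi k (2 * R)) N - fsum (fun k => Psi k R) N <= 8 * sqrt R * fsum w N).
  { rewrite <- fsum_scal. replace (fsum (fun k => Psi k (2 * R)) N - fsum (fun k => Psi k R) N)
      with (fsum (fun k => Psi k (2 * R)  + (-1) * Psi k R) N) by (rewrite fsum_plus, fsum_scal; ring).
    apply fsum_le. intros k _. unfold Psi.
    destruct (Rle_lt_or_eq_dec 0 (w k) (Hw k)) as [P|<-]; [|lra].
    specialize (Hws k P). specialize (Hs k).
    replace (w k * (2 * (2 * R - s k) / smooth4 eta (2 * R - s k)) + -1 * (w k * (2 * (R - s k) / smooth4 eta (R - s k))))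
      with (w k * (2 * (2 * R - s k) / smooth4 eta (2 * R - s k) + 2 * - (R - s k) / smooth4 eta (- (R - s k))))
      by (rewrite smooth4_odd; unfold Rdiv; ring).
    rewrite (Rmult_comm (8 * sqrt R)). apply Rmult_le_compat_l; [lra|].
    assert (S4 : forall x, Rabs x <= 4 * R -> 2 * sqrt (Rabs x) <= 4 * sqrt R).
    { intros x Hx. replace (4 * sqrt R) with (2 * sqrt (4 * R)).
      - apply Rmult_le_compat_l; [lra|]. apply sqrt_le_1; auto; [apply Rabs_pos|lra].
      - rewrite sqrt_mult by lra. replace 4 with (2 * 2) at 1 by ring. rewrite sqrt_square; lra. }
    eapply Rle_trans; [apply Rplus_le_compat; apply smooth4_bound; auto|].
    replace (8 * sqrt R) with (4 * sqrt R + 4 * sqrt R) by ring.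
    apply Rplus_le_compat; apply S4; apply Rabs_le; lra. }
  assert (Q : fsum (fun k => w k / smooth4 eta (rho - s k)) N <= K).
  { apply Rle_trans with (fsum (fun k => Psi' k rho) N).
    - apply fsum_le. intros k _. apply Rmult_le_compat_l; auto. apply smooth4_deriv_ge; auto.
    - rewrite E in B. apply Rmult_le_reg_r with R; auto. unfold K.
      replace (8 * fsum w N / sqrt R * R) with (8 * fsum w N / sqrt R * (sqrt R * sqrt R)) by (rewrite sqrt_sqrt; lra).
      replace (8 * fsum w N / sqrt R * (sqrt R * sqrt R)) with (8 * sqrt R * fsum w N) by (field; lra). lra. }
  assert (T : forall k, (k < N)%nat -> 0 < w k -> eta <= Rabs (rho - s k)).
  { intros k Hk P. specialize (Heta k Hk). destruct (Rlt_dec 0 (w k)) as [_|]; [|lra].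
    pose proof (smooth4_pos eta (rho - s k) He) as Py. pose proof (smooth4_pow4 eta (rho - s k)) as Ey.
    set (y := smooth4 eta (rho - s k)) in *.
    assert (Qk : w k / y <= K).
    { eapply Rle_trans; [|exact Q]. apply (fsum_term_le (fun k => w k / smooth4 eta (rho - s k))); auto.
      intros j. apply Rdiv_le_0_compat; auto. apply smooth4_pos; auto. }
    assert (Yl : w k / (K + 1) <= y).
    { apply Rmult_le_reg_r with ((K + 1) * / y). { apply Rmult_lt_0_compat; [lra|apply Rinv_0_lt_compat; auto]. }
      replace (w k / (K + 1) * ((K + 1) * / y)) with (w k / y) by (field; lra).
      replace (y * ((K + 1) * / y)) with (K + 1) by (field; lra). lra. }
    set (q := w k / (K + 1)) in *. assert (0 < q) by (apply Rdiv_lt_0_compat; lra).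
    assert (q ^ 2 <= y ^ 2) by (apply pow_incr; lra).
    assert (2 * eta <= y ^ 2) by lra.
    assert (4 * eta ^ 2 <= y ^ 4). { replace (y ^ 4) with (y ^ 2 * y ^ 2) by ring. nra. }
    destruct (Rle_lt_dec eta (Rabs (rho - s k))) as [L|L]; auto. exfalso.
    assert (Rabs (rho - s k) ^ 2 < eta ^ 2). { pose proof (Rabs_pos (rho - s k)). nra. }
    pose proof (pow2_abs (rho - s k)). nra. }
  exists rho. split; [lra|]. split.
  - intros k Hk P E'. specialize (T k Hk P). rewrite E', Rminus_diag, Rabs_R0 in T. lra.
  (* At distance at least [eta] from [s k], [smooth4] is at most [2 * sqrt |rho - s k|]. Undoing the
     smoothing therefore doubles the 8 in [K]. *)
  - apply Rle_trans with (2 * fsum (fun k => w k / smooth4 eta (rho - s k)) N).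
    + rewrite <- fsum_scal. apply fsum_le. intros k Hk.
      destruct (Rle_lt_or_eq_dec 0 (w k) (Hw k)) as [P|<-]; [|unfold Rdiv; lra].
      specialize (T k Hk P).
      pose proof (smooth4_pos eta (rho - s k) He) as Py. pose proof (smooth4_pow4 eta (rho - s k)) as Ey.
      set (y := smooth4 eta (rho - s k)) in *. set (a := Rabs (rho - s k)) in *.
      assert (Pa : 0 < sqrt a) by (apply sqrt_lt_R0; lra).
      assert (Ea : sqrt a * sqrt a = a) by (apply sqrt_sqrt; lra).
      assert (L : y <= 2 * sqrt a).
      { destruct (Rle_lt_dec y (2 * sqrt a)) as [L|L]; auto. exfalso.
        assert (4 * a < y ^ 2) by nra.
        assert (16 * a ^ 2 < y ^ 4). { replace (y ^ 4) with (y ^ 2 * y ^ 2) by ring. nra. }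
        assert (a ^ 2 = (rho - s k) ^ 2) by apply pow2_abs. nra. }
      replace (2 * (w k / y)) with (w k * (2 / y)) by (field; lra).
      apply Rmult_le_compat_l; [lra|].
      apply Rmult_le_reg_r with (y * sqrt a). { apply Rmult_lt_0_compat; auto. }
      replace (/ sqrt a * (y * sqrt a)) with y by (field; lra).
      replace (2 / y * (y * sqrt a)) with (2 * sqrt a) by (field; lra). auto.
    + unfold K in Q. unfold Rdiv in *. lra.
Qed.

Lemma fsum_mono f a b : (forall k, 0 <= f k) -> (a <= b)%nat -> fsum f a <= fsum f b.
Proof. intros H L. induction L; simpl; [lra|]. specialize (H m). lra. Qed.

Lemma fsum_support f N M : (forall k, 0 <= f k) -> (forall k, (N <= k)%nat -> f k = 0) -> fsum f M <= fsum f N.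
Proof.
  intros H HN. destruct (Nat.le_ge_cases M N) as [L|L].
  - apply fsum_mono; auto.
  - right. induction L; auto. simpl. rewrite HN, IHL by lia. ring.
Qed.

Lemma ex_series_fsum_bounded f B : (forall k, 0 <= f k) -> (forall M, fsum f M <= B) -> ex_series f.
Proof.
  intros H HB.
  destruct (ex_finite_lim_seq_incr (sum_n f) B) as [l Hl].
  - intros n. rewrite <- !fsum_sum_n. apply fsum_mono; auto.
  - intros n. rewrite <- fsum_sum_n. auto.
  - exists l. exact Hl.
Qed.

(** * Circle means of inverse distances *)

Lemma rctn_inv_dist t u : u <> t -> rctn (fun u => / Cmod (u - t)) u.
Proof.
  intros N. apply (ctn_real Rinv (fun u => Cmod (u - t)%C)).
  - apply (continuity_pt_inv (fun x => x)).
    + apply derivable_continuous_pt, derivable_pt_id.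
    + apply Rgt_not_eq, Cmod_pos, Csub_neq; auto.
  - apply ctn_Cmod, ctn_minus; [apply ctn_id|apply ctn_const].
Qed.

(** For [|t| < rho] the integrand is a multiple of the Poisson kernel, of mean 1. For [|t| > rho] it
    is a multiple of the real part of [(t + u) / (t - u)], which is holomorphic in the disc with
    value 1 at the centre. *)
Lemma rmean_inv_sq rho t : 0 < rho -> Cmod t <> rho ->
  rmean (fun u => / Cmod (u - t) * / Cmod (u - t)) rho = / Rabs (rho ^ 2 - Cmod t ^ 2).
Proof.
  intros Hr N. pose proof (Cmod_ge_0 t) as Pt.
  assert (Nt : forall u, Cmod u = rho -> u <> t) by (intros u Hu ->; auto).
  assert (Cc : rcirc (fun u => / Cmod (u - t) * / Cmod (u - t)) rho).
  { intros u Hu. apply rctn_mult; apply rctn_inv_dist; auto. }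
  assert (D : forall u, Cmod u = rho -> / Cmod (u - t) * / Cmod (u - t) = / Cmod (u - t) ^ 2).
  { intros u Hu. field. apply Rgt_not_eq, Cmod_pos, Csub_neq; auto. }
  destruct (Rlt_dec (Cmod t) rho) as [L|L].
  - assert (P : 0 < rho ^ 2 - Cmod t ^ 2) by nra. rewrite Rabs_pos_eq by lra.
    apply Rmult_eq_reg_l with (rho ^ 2 - Cmod t ^ 2); [|lra].
    rewrite <- rmean_scal, Rinv_r; auto; try lra.
    rewrite <- (rmean_poisson rho t L). apply rmean_ext; [lra|].
    intros u Hu. rewrite D, (poisson_formula rho); auto.
  - assert (P : 0 < Cmod t ^ 2 - rho ^ 2) by nra. rewrite Rabs_left by lra.
    apply Rmult_eq_reg_l with (Cmod t ^ 2 - rho ^ 2); [|lra].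
    rewrite <- rmean_scal; auto; try lra.
    replace ((Cmod t ^ 2 - rho ^ 2) * / - (rho ^ 2 - Cmod t ^ 2)) with 1 by (field; lra).
    set (phi := (fun u => (t + u) / (t - u))%C).
    assert (Hphi : forall u, Cmod u <= rho -> cdiff phi u).
    { intros u Hu. apply cdiff_mult.
      - apply cdiff_plus; [apply cdiff_const|apply cdiff_id].
      - apply cdiff_inv; [apply cdiff_minus; [apply cdiff_const|apply cdiff_id]|].
        apply Csub_neq. intros ->. lra. }
    rewrite (rmean_ext _ (fun u => fst (phi u))); [|lra|].
    + rewrite rmean_fst, (cmean_center phi 0 rho); try lra.
      * unfold phi. replace ((t + 0) / (t - 0))%C with (RtoC 1); auto. field.
        intros E. rewrite E, Cmod_0 in *. lra.
      * intros u Hu. apply cdiff_ctn; auto.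
      * intros u Hu _. auto.
      * intros u Hu. apply cdiff_ctn, Hphi. lra.
    + intros u Hu. unfold phi. rewrite D by auto.
      rewrite fst_cayley by (intros ->; apply (Nt u Hu); auto).
      rewrite Hu, (Cmod_sub_sym t u). reflexivity.
Qed.

(** The square of a mean is at most the mean of the square, and [|rho ^ 2 - |t| ^ 2|] has the factor
    [rho + |t| >= rho]. *)
Lemma rmean_inv_dist rho t : 0 < rho -> Cmod t <> rho ->
  rmean (fun u => / Cmod (u - t)) rho <= / sqrt (rho * Rabs (rho - Cmod t)).
Proof.
  intros Hr N. pose proof (Cmod_ge_0 t) as Pt.
  assert (Nt : forall u, Cmod u = rho -> u <> t) by (intros u Hu ->; auto).
  set (D := Rabs (rho ^ 2 - Cmod t ^ 2)).
  assert (E : D = (rho + Cmod t) * Rabs (rho - Cmod t)).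
  { unfold D. replace (rho ^ 2 - Cmod t ^ 2) with ((rho + Cmod t) * (rho - Cmod t)) by ring.
    rewrite Rabs_mult, (Rabs_pos_eq (rho + Cmod t)); lra. }
  assert (PA : 0 < Rabs (rho - Cmod t)) by (apply Rabs_pos_lt; lra).
  assert (PD : 0 < D) by (rewrite E; apply Rmult_lt_0_compat; lra).
  set (l := / sqrt D). assert (Ps : 0 < sqrt D) by (apply sqrt_lt_R0; auto).
  assert (Pl : 0 < l) by (apply Rinv_0_lt_compat; auto).
  apply Rle_trans with l.
  - (* AM-GM: [x <= (l + x^2 / l) / 2] *)
    apply Rle_trans with (rmean (fun u => l / 2 + / (2 * l) * (/ Cmod (u - t) * / Cmod (u - t))) rho).
    + apply rmean_le; [lra| | |].
      * intros u Hu. apply rctn_inv_dist; auto.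
      * intros u Hu. apply rctn_plus; [apply rctn_const|]. apply rctn_mult; [apply rctn_const|].
        apply rctn_mult; apply rctn_inv_dist; auto.
      * intros u Hu. set (x := / Cmod (u - t)).
        apply Rmult_le_reg_l with (2 * l); [lra|].
        replace (2 * l * (l / 2 + / (2 * l) * (x * x))) with (l * l + x * x) by (field; lra).
        pose proof (Rle_0_sqr (l - x)) as Q. unfold Rsqr in Q. lra.
    + rewrite rmean_plus, rmean_const, rmean_scal, rmean_inv_sq; auto; try lra.
      * fold D. assert (/ D = l * l). { unfold l. rewrite <- (sqrt_sqrt D) at 1 by lra. field. lra. }
        rewrite H. right. field. lra.
      * intros u Hu. apply rctn_mult; apply rctn_inv_dist; auto.
      * intros u Hu. apply rctn_const.
      * intros u Hu. apply rctn_mult; [apply rctn_const|]. apply rctn_mult; apply rctn_inv_dist; auto.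
  - unfold l. apply Rinv_le_contravar.
    + apply sqrt_lt_R0, Rmult_lt_0_compat; auto.
    + apply sqrt_le_1; [left; apply Rmult_lt_0_compat; auto|lra|]. rewrite E. apply Rmult_le_compat_r; lra.
Qed.

Lemma rctn_fsum (f : nat -> C -> R) n u : (forall k, (k < n)%nat -> rctn (f k) u) -> rctn (fun u => fsum (fun k => f k u) n) u.
Proof.
  induction n as [|n IH]; intros H; simpl.
  - apply rctn_const.
  - apply (rctn_plus (fun u => fsum (fun k => f k u) n) (f n)); auto.
Qed.

Lemma rmean_fsum (f : nat -> C -> R) n r : 0 <= r -> (forall k, (k < n)%nat -> rcirc (f k) r) ->
  rmean (fun u => fsum (fun k => f k u) n) r = fsum (fun k => rmean (f k) r) n.
Proof.
  intros Hr. induction n as [|n IH]; intros H; simpl.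
  - apply rmean_const.
  - rewrite <- IH by auto. rewrite rmean_plus; auto.
    intros u Hu. apply rctn_fsum. intros k Hk. apply H; auto.
Qed.

(** [T] is the potential of the finitely many points with [|t_n| < 4 R], small in the mean; the
    other points contribute little anywhere on the circle. Where [T u < 1 / 2] the whole potential
    is below 1, and the mean of [T] controls the size of the rest of the circle. *)
Lemma good_circles (t : nat -> C) (nu : nat -> R) :
  is_lim_seq (fun n => Cmod (t n)) p_infty -> (forall n, 0 < nu n) ->
  ex_series (fun n => nu n / (Cmod (t n) + 1)) ->
  forall e, 0 < e -> exists R0, 1 <= R0 /\ forall R, R0 <= R ->
    exists rho T, R < rho < 2 * R /\ rcirc T rho /\ (forall u, 0 <= T u) /\
      rmean T rho <= e /\
      forall u, Cmod u = rho -> (forall n, u <> t n) /\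
        (T u < 1 / 2 -> ex_series (fun n => nu n / Cmod (u - t n)) /\ Series (fun n => nu n / Cmod (u - t n)) < 1).
Proof.
  intros Ht Hnu Hs e He. set (s := fun n => Cmod (t n)).
  assert (Ps : forall n, 0 <= s n) by (intros; apply Cmod_ge_0).
  set (f := fun n => nu n / (s n + 1)).
  assert (Pf : forall n, 0 < f n) by (intros n; specialize (Ps n); apply Rdiv_lt_0_compat; auto; lra).
  (* The tail beyond [N1] will enter the mean as [80 * e1 <= e / 2], and the potential of the far
     points as [4 * e1 <= 1 / 4]. *)
  set (e1 := Rmin (e / 160) (1 / 16)). assert (He1 : 0 < e1) by (apply Rmin_pos; lra).
  assert (Le1 : e1 <= e / 160) by apply Rmin_l. assert (Le2 : e1 <= 1 / 16) by apply Rmin_r.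
  destruct (small_tail f ltac:(intros; left; auto) Hs e1 He1) as [N1 HN1].
  set (A := fsum nu N1). assert (PA : 0 <= A) by (apply fsum_nonneg; intros; left; auto).
  set (Bs := fsum s N1). assert (PB : 0 <= Bs) by (apply fsum_nonneg; auto).
  assert (PAe : 0 <= 32 * A / e) by (apply Rdiv_le_0_compat; lra).
  (* [Bs] puts the first [N1] points into [|t_n| < 4 R], and [32 * A / e] makes their share
     [16 * A / R] of the mean at most [e / 2]. *)
  exists (1 + Bs + 32 * A / e). split; [lra|]. intros R HR.
  assert (HRp : 0 < R) by lra.
  assert (Near : forall n, (n < N1)%nat -> s n < 4 * R).
  { intros n Hn. pose proof (fsum_term_le s N1 n Ps Hn) as Q. fold Bs in Q. lra. }
  assert (HAR : 16 * A / R <= e / 2).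
  { apply Rmult_le_reg_r with R; auto. unfold Rdiv at 1. rewrite Rmult_assoc, Rinv_l, Rmult_1_r by lra.
    assert (32 * A / e * e = 32 * A) by (field; lra). nra. }
  apply is_lim_seq_spec in Ht. destruct (Ht (4 * R)) as [N HN].
  set (w := fun n => if Rlt_dec (s n) (4 * R) then nu n else 0).
  assert (Pw : forall n, 0 <= w n). { intros n. unfold w. destruct (Rlt_dec (s n) (4 * R)); [left; auto|lra]. }
  assert (Pws : forall n, 0 < w n -> s n < 4 * R). { intros n. unfold w. destruct (Rlt_dec (s n) (4 * R)); lra. }
  (* A near point of index at least [N1] has [nu k <= (4 R + 1) * f k <= 5 R * f k]. *)
  assert (W : fsum w N <= A + 5 * R * e1).
  { apply Rle_trans with (fsum (fun k => (if Nat.ltb k N1 then nu k else 0) + 5 * R * tail f N1 k) N).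
    - apply fsum_le. intros k _. unfold w, tail. specialize (Ps k). specialize (Hnu k).
      assert (0 <= 5 * R * f k) by (apply Rmult_le_pos; [lra|left; auto]).
      destruct (Rlt_dec (s k) (4 * R)) as [L|L]; destruct (Nat.ltb k N1); try lra.
      rewrite Rplus_0_l. unfold f.
      apply Rmult_le_reg_r with (s k + 1); [lra|].
      replace (5 * R * (nu k / (s k + 1)) * (s k + 1)) with (5 * R * nu k) by (field; lra). nra.
    - rewrite fsum_plus, fsum_scal. apply Rplus_le_compat.
      + eapply Rle_trans; [apply (fsum_support _ N1)|].
        * intros k. destruct (Nat.ltb k N1); [left; auto|lra].
        * intros k Hk. destruct (Nat.ltb_spec k N1); [lia|auto].
        * apply fsum_le. intros k _. destruct (Nat.ltb k N1); [lra|left; auto].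
      + apply Rmult_le_compat_l; [lra|auto]. }
  destruct (good_radius w s N R HRp Pw Ps Pws) as [rho [Hrho [Hne Hsum]]].
  set (T := fun u => fsum (fun k => w k * / Cmod (u - t k)) N).
  assert (NT : forall u n, Cmod u = rho -> u <> t n).
  { intros u n Hu E. assert (Es : s n = rho) by (unfold s; rewrite <- E; auto).
    destruct (Nat.lt_ge_cases n N) as [L|L].
    - apply (Hne n L); auto. unfold w. destruct (Rlt_dec (s n) (4 * R)); auto. lra.
    - specialize (HN n L). fold (s n) in HN. lra. }
  (* At [u = t k] this rests on the convention [/ 0 = 0]. *)
  assert (Pinv : forall u k, 0 <= / Cmod (u - t k)).
  { intros u k. destruct (Ceq_dec u (t k)) as [->|Nq].
    - replace (t k - t k)%C with (RtoC 0) by ring. rewrite Cmod_0, Rinv_0. lra.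
    - left. apply Rinv_0_lt_compat, Cmod_pos, Csub_neq; auto. }
  exists rho, T. split; [lra|]. split; [|split; [|split]].
  - intros u Hu. apply rctn_fsum. intros k _. apply rctn_mult; [apply rctn_const|apply rctn_inv_dist; auto].
  - intros u. apply fsum_nonneg. intros k. apply Rmult_le_pos; auto.
  - unfold T. rewrite (rmean_fsum (fun k u => w k * / Cmod (u - t k))); [|lra|].
    2:{ intros k _ u Hu. apply rctn_mult; [apply rctn_const|apply rctn_inv_dist; auto]. }
    apply Rle_trans with (/ sqrt R * fsum (fun k => w k / sqrt (Rabs (rho - s k))) N).
    + rewrite <- fsum_scal. apply fsum_le. intros k Hk.
      assert (Nk : s k <> rho).
      { intros E. apply (NT (t k) k); auto. }
      rewrite rmean_scal; [|lra|intros u Hu; apply rctn_inv_dist; auto].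
      replace (/ sqrt R * (w k / sqrt (Rabs (rho - s k)))) with (w k * (/ sqrt R * / sqrt (Rabs (rho - s k)))) by (unfold Rdiv; ring).
      apply Rmult_le_compat_l; auto.
      eapply Rle_trans; [apply rmean_inv_dist; [lra|exact Nk]|]. fold (s k).
      assert (PR : 0 < Rabs (rho - s k)) by (apply Rabs_pos_lt; lra).
      rewrite <- Rinv_mult, <- sqrt_mult by lra.
      apply Rinv_le_contravar; [apply sqrt_lt_R0, Rmult_lt_0_compat; auto|].
      apply sqrt_le_1; try (apply Rmult_le_pos; lra). apply Rmult_le_compat_r; lra.
    + assert (SR : 0 < sqrt R) by (apply sqrt_lt_R0; auto).
      apply Rle_trans with (/ sqrt R * (16 * fsum w N / sqrt R)).
      { apply Rmult_le_compat_l; auto. left; apply Rinv_0_lt_compat; auto. }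
      replace (/ sqrt R * (16 * fsum w N / sqrt R)) with (16 * fsum w N / R).
      2:{ rewrite <- (sqrt_sqrt R) at 1 by lra. field. lra. }
      apply Rle_trans with (16 * (A + 5 * R * e1) / R).
      { apply Rmult_le_compat_r; [left; apply Rinv_0_lt_compat; auto|lra]. }
      replace (16 * (A + 5 * R * e1) / R) with (16 * A / R + 80 * e1) by (field; lra). lra.
  - intros u Hu. split; [intros n; apply NT; auto|]. intros HT.
    (* For a far point, [|u - t_k| >= |t_k| - 2 R >= (|t_k| + 1) / 4]. *)
    assert (Term : forall k, nu k / Cmod (u - t k) <= w k * / Cmod (u - t k) + 4 * tail f N1 k).
    { intros k. unfold w, tail. specialize (Pf k). destruct (Rlt_dec (s k) (4 * R)) as [L|L].
      - unfold Rdiv. destruct (Nat.ltb k N1); lra.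
      - destruct (Nat.ltb_spec k N1) as [L'|L']; [specialize (Near k L'); lra|].
        rewrite Rmult_0_l, Rplus_0_l. unfold f.
        pose proof (Cmod_minus_ge (t k) u) as D. rewrite Cmod_sub_sym, Hu in D. fold (s k) in D.
        replace (4 * (nu k / (s k + 1))) with (nu k * (4 / (s k + 1))) by (field; lra).
        apply Rmult_le_compat_l; [left; auto|].
        replace (4 / (s k + 1)) with (/ ((s k + 1) / 4)) by (field; lra).
        apply Rinv_le_contravar; lra. }
    assert (Part : forall M, fsum (fun n => nu n / Cmod (u - t n)) M <= T u + 4 * e1).
    { intros M. eapply Rle_trans; [apply fsum_le; intros k _; apply Term|].
      rewrite fsum_plus, fsum_scal. apply Rplus_le_compat.
      - apply fsum_support.
        + intros k. apply Rmult_le_pos; auto.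
        + intros k Hk. specialize (HN k Hk). fold (s k) in HN. unfold w.
          destruct (Rlt_dec (s k) (4 * R)); [lra|ring].
      - apply Rmult_le_compat_l; [lra|auto]. }
    assert (Pos : forall k, 0 <= nu k / Cmod (u - t k)) by (intros k; apply Rmult_le_pos; [left; auto|auto]).
    assert (Ex := ex_series_fsum_bounded _ _ Pos Part). split; auto.
    pose proof (Series_le_fsum _ _ Ex Part). lra.
Qed.

(* With [l = log^+ |S|] the good circles give [max_{|z| <= r} l <= e * max_{|z| <= 4 r} l]
   for every [e] and large [r], which is incompatible with finite order unless [l = 0]. *)
Lemma potential_bound_unit (S : C -> C) (t : nat -> C) (nu : nat -> R) :
  (forall z, cdiff S z) -> growth S ->
  is_lim_seq (fun n => Cmod (t n)) p_infty -> (forall n, 0 < nu n) ->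
  ex_series (fun n => nu n / (Cmod (t n) + 1)) ->
  (forall u, (forall n, u <> t n) -> ex_series (fun n => nu n / Cmod (u - t n)) ->
    Series (fun n => nu n / Cmod (u - t n)) < 1 -> Cmod (S u) <= 1) ->
  forall z, Cmod (S z) <= 1.
Proof.
  intros HS [N [K [HK HG]]] Ht Hnu Hs HB.
  set (l := logmax 0 S).
  assert (Pl : forall z, 0 <= l z) by (intros; apply logmax_ge).
  assert (Cl : forall z, rctn l z) by (intros; apply logmax_rctn, cdiff_ctn, HS).
  assert (P4 : 0 < 4 ^ N) by (apply pow_lt; lra).
  (* Each step multiplies the radius by 4 and thus the growth bound by [4 ^ N]. As
     [e * 4 ^ N = 1 / 2], the iteration still gains a factor 2. *)
  set (e := / (2 * 4 ^ N)). assert (He : 0 < e) by (apply Rinv_0_lt_compat; lra).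
  destruct (good_circles t nu Ht Hnu Hs (e / 6)) as [R0 [HR0 HC]]; [lra|].
  (* On a good circle with radius in [(2 r, 4 r)], [l] vanishes where [T < 1 / 2], and elsewhere
     [l <= X <= 2 * X * T]. With the Harnack factor 3 the tolerance [e / 6] becomes [e]. *)
  assert (Decay : forall r X, R0 <= r -> 0 <= X -> (forall z, Cmod z <= 4 * r -> l z <= X) ->
    forall z, Cmod z <= r -> l z <= e * X).
  { intros r X Hr HX Hl z Hz.
    destruct (HC (2 * r) ltac:(lra)) as [rho [T [Hrho [CT [PT [MT HT]]]]]].
    apply Rle_trans with (3 * rmean l rho). { apply logmax_harnack; auto; lra. }
    apply Rle_trans with (3 * (2 * X * rmean T rho)).
    - apply Rmult_le_compat_l; [lra|]. rewrite <- rmean_scal by (auto; lra).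
      apply rmean_le; [lra|intros u _; apply Cl| |].
      + intros u Hu. apply rctn_mult; [apply rctn_const|auto].
      + intros u Hu. destruct (HT u Hu) as [H1 H2]. specialize (PT u).
        destruct (Rlt_dec (T u) (1 / 2)) as [L|L].
        * destruct (H2 L) as [H3 H4]. unfold l. rewrite logmax_small; [nra|]. rewrite exp_0. auto.
        * specialize (Hl u ltac:(lra)). nra.
    - assert (2 * X * rmean T rho <= 2 * X * (e / 6)) by (apply Rmult_le_compat_l; lra). lra. }
  assert (Iter : forall k r X, R0 <= r -> 0 <= X -> (forall z, Cmod z <= 4 ^ k * r -> l z <= X) ->
    forall z, Cmod z <= r -> l z <= e ^ k * X).
  { induction k as [|k IH]; intros r X Hr HX Hl z Hz.
    - simpl. rewrite Rmult_1_l. apply Hl. simpl. lra.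
    - simpl. rewrite Rmult_assoc. apply (Decay r); auto.
      + apply Rmult_le_pos; auto. apply pow_le; lra.
      + apply IH; auto; [lra|]. intros w Hw. apply Hl. simpl. lra. }
  intros z. rewrite <- exp_0.
  eapply Rle_trans; [apply (Cmod_le_exp_logmax 0)|]. apply exp_le_compat. fold l.
  apply le_epsilon. intros d Hd. rewrite Rplus_0_l.
  set (r := Rmax R0 (Cmod z)).
  assert (R0 <= r) by apply Rmax_l. assert (Cmod z <= r) by apply Rmax_r.
  assert (Pr : 0 < K * (2 * r) ^ N) by (apply Rmult_lt_0_compat; auto; apply pow_lt; lra).
  destruct (pow_lt_1_zero (/ 2)) with (y := d / (K * (2 * r) ^ N)) as [k Hk].
  { rewrite Rabs_pos_eq; lra. } { apply Rdiv_lt_0_compat; auto. }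
  specialize (Hk k (Nat.le_refl _)). rewrite Rabs_pos_eq in Hk by (apply pow_le; lra).
  assert (Q : l z <= e ^ k * (K * (4 ^ k * (2 * r)) ^ N)).
  { apply (Iter k r); auto.
    - left. apply Rmult_lt_0_compat; auto. apply pow_lt. apply Rmult_lt_0_compat; [apply pow_lt; lra|lra].
    - intros w Hw. pose proof (Cmod_ge_0 w) as Pw. pose proof (one_le_pow 4 k ltac:(lra)) as P1.
      assert (X : (1 + Cmod w) ^ N <= (4 ^ k * (2 * r)) ^ N) by (apply pow_incr; nra).
      apply logmax_le.
      + eapply Rle_trans; [apply HG|]. apply exp_le_compat. apply Rmult_le_compat_l; lra.
      + apply Rmult_le_pos; [lra|]. apply pow_le. nra. }
  eapply Rle_trans; [exact Q|].
  rewrite Rpow_mult_distr, <- pow_mult, Nat.mul_comm, pow_mult.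
  replace (e ^ k * (K * ((4 ^ N) ^ k * (2 * r) ^ N))) with ((e * 4 ^ N) ^ k * (K * (2 * r) ^ N))
    by (rewrite Rpow_mult_distr; ring).
  replace (e * 4 ^ N) with (/ 2) by (unfold e; field; lra).
  apply Rmult_le_reg_r with (/ (K * (2 * r) ^ N)). { apply Rinv_0_lt_compat; auto. }
  rewrite Rmult_assoc, Rinv_r, Rmult_1_r by lra. left. exact Hk.
Qed.

Lemma potential_bound (S : C -> C) (t : nat -> C) (nu : nat -> R) (M : R) : 0 < M ->
  (forall z, cdiff S z) -> growth S ->
  is_lim_seq (fun n => Cmod (t n)) p_infty -> (forall n, 0 < nu n) ->
  ex_series (fun n => nu n / (Cmod (t n) + 1)) ->
  (forall u, (forall n, u <> t n) -> ex_series (fun n => nu n / Cmod (u - t n)) ->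
    Series (fun n => nu n / Cmod (u - t n)) < 1 -> Cmod (S u) <= M) ->
  forall z, Cmod (S z) <= M.
Proof.
  intros HM HS HG Ht Hnu Hs HB z.
  assert (Sc : forall w, Cmod (RtoC (/ M) * S w) <= 1 <-> Cmod (S w) <= M).
  { intros w. rewrite Cmod_mult, Cmod_R, Rabs_pos_eq by (left; apply Rinv_0_lt_compat; auto).
    split; intros H.
    - apply Rmult_le_reg_l with (/ M); [apply Rinv_0_lt_compat; auto|]. rewrite Rinv_l; lra.
    - apply Rmult_le_reg_l with M; auto. rewrite <- Rmult_assoc, Rinv_r; lra. }
  apply Sc. apply (potential_bound_unit (fun w => RtoC (/ M) * S w)%C t nu); auto.
  - intros w. apply cdiff_mult; [apply cdiff_const|auto].
  - apply growth_mult; [apply growth_const|auto].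
  - intros u H1 H2 H3. apply Sc. auto.
Qed.

(** * Entire quotients *)

(** With [k] the order of [B] at [w], both functions are [(z - w) ^ k] times entire functions [g]
    and [h] with [g w <> 0], so near [w] the quotient is [h / g]. *)
Lemma vanishing_quotient B F : (forall z, cdiff B z) -> (exists z, B z <> 0) -> vanishes_on_zeros B F ->
  exists S, (forall z, cdiff S z) /\ forall z, F z = (S z * B z)%C.
Proof.
  intros HB HB0 HV.
  (* Only the value [s] is chosen at each point, with the local factors kept existential. The global
     identity [E] then forces [S = h / g] at points near [w], where [B] does not vanish except
     possibly at [w]. *)
  assert (L : forall w, exists s : C, exists k g h, (forall z, cdiff g z) /\ (forall z, cdiff h z) /\ g w <> 0 /\
    (forall z, B z = (z - w) ^ k * g z)%C /\ (forall z, F z = (z - w) ^ k * h z)%C /\ s = (h w / g w)%C).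
  { intros w. destruct (zero_order B w HB HB0) as [k [g [Hg [Gw E]]]].
    destruct (HV w k) as [h [Hh E']].
    { exists g. split; auto. apply entire_cdiff; auto. }
    exists (h w / g w)%C, k, g, h. repeat split; auto. apply entire_cdiff; auto. }
  set (S := fun w => proj1_sig (constructive_indefinite_description _ (L w))).
  assert (HS : forall w, exists k g h, (forall z, cdiff g z) /\ (forall z, cdiff h z) /\ g w <> 0 /\
    (forall z, B z = (z - w) ^ k * g z)%C /\ (forall z, F z = (z - w) ^ k * h z)%C /\ S w = (h w / g w)%C).
  { intros w. unfold S. destruct (constructive_indefinite_description _ (L w)) as [s Hs]. exact Hs. }
  clearbody S.
  assert (E : forall z, F z = (S z * B z)%C).
  { intros w. destruct (HS w) as [k [g [h [Hg [Hh [Gw [EB [EF ES]]]]]]]].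
    rewrite ES, EB, EF. field. auto. }
  exists S. split; auto. intros w.
  destruct (HS w) as [k [g [h [Hg [Hh [Gw [EB [EF ES]]]]]]]].
  destruct (ctn_neq g w 0 (cdiff_ctn _ _ (Hg w)) Gw) as [d [Hd Hn]].
  apply (cdiff_ext_loc (fun z => h z * / g z)%C S w d); auto.
  - intros u Hu. destruct (Hn u Hu) as [_ Gu]. destruct (Ceq_dec u w) as [->|N]; [symmetry; exact ES|].
    assert (Pk : ((u - w) ^ k <> 0)%C) by (apply Cpow_nz, Csub_neq; auto).
    specialize (E u). rewrite EB, EF in E.
    assert (X : ((u - w) ^ k * h u * / ((u - w) ^ k * g u) = S u * ((u - w) ^ k * g u) * / ((u - w) ^ k * g u))%C) by (f_equal; exact E).
    replace (S u * ((u - w) ^ k * g u) * / ((u - w) ^ k * g u))%C with (S u) in X by (field; auto).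
    rewrite <- X. field. auto.
  - apply cdiff_mult; auto. apply cdiff_inv; auto.
Qed.

(** * Absolutely convergent complex series *)

Lemma ex_series_Cmod u : ex_series (fun n => Cmod (u n)) ->
  ex_series (fun n => fst (u n)) /\ ex_series (fun n => snd (u n)).
Proof.
  intros H. split; apply ex_series_Rabs; apply (@ex_series_le R_AbsRing R_CompleteNormedModule _ (fun n => Cmod (u n))); auto;
  intros n; unfold norm; simpl; rewrite Rabs_Rabsolu; [apply fst_le_Cmod|apply snd_le_Cmod].
Qed.

Lemma CSeries_ext u v : (forall n, u n = v n) -> CSeries u = CSeries v.
Proof. intros E. unfold CSeries. f_equal; apply Series_ext; intros n; rewrite E; auto. Qed.

Lemma CSeries_plus u v : ex_series (fun n => Cmod (u n)) -> ex_series (fun n => Cmod (v n)) ->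
  CSeries (fun n => u n + v n)%C = (CSeries u + CSeries v)%C.
Proof.
  intros Hu Hv. apply ex_series_Cmod in Hu, Hv. destruct Hu, Hv.
  unfold CSeries. simpl. rewrite !Series_plus; auto.
Qed.

Lemma CSeries_scal k u : ex_series (fun n => Cmod (u n)) -> CSeries (fun n => k * u n)%C = (k * CSeries u)%C.
Proof.
  intros Hu. apply ex_series_Cmod in Hu. destruct Hu as [H1 H2].
  assert (S : forall (c : R) v, ex_series v -> ex_series (fun n => c * v n)).
  { intros c v Hv. apply (ex_series_scal (K := R_AbsRing) (V := R_NormedModule)); auto. }
  unfold CSeries. simpl. rewrite Series_minus, Series_plus, !Series_scal_l; auto.
Qed.

(** Estimating the two components separately would cost a constant. Multiplying by the conjugate of
    the sum [z] expresses [|z| ^ 2] as a sum of real parts. *)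
Lemma CSeries_Cmod_le u : ex_series (fun n => Cmod (u n)) -> Cmod (CSeries u) <= Series (fun n => Cmod (u n)).
Proof.
  intros Hu. set (z := CSeries u).
  destruct (Ceq_dec z 0) as [E|N].
  { rewrite E, Cmod_0. apply (fsum_le_Series (fun n => Cmod (u n)) 0); auto. intros; apply Cmod_ge_0. }
  apply Cmod_pos in N. apply Rmult_le_reg_l with (Cmod z); auto.
  rewrite <- Series_scal_l.
  assert (E : Cmod z * Cmod z = Series (fun n => fst (Cconj z * u n)%C)).
  { change (Series (fun n => fst (Cconj z * u n)%C)) with (fst (CSeries (fun n => Cconj z * u n)%C)).
    rewrite CSeries_scal by auto. fold z. rewrite Cmult_comm, <- Cmod2_conj. cbn [fst RtoC]. ring. }
  rewrite E. clear E.
  assert (Hs : ex_series (fun n => Cmod (Cconj z * u n))).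
  { apply (ex_series_ext (fun n => Cmod z * Cmod (u n))).
    - intros n. rewrite Cmod_mult, Cmod_conj. auto.
    - apply (ex_series_scal (K := R_AbsRing) (V := R_NormedModule)); auto. }
  apply Rle_trans with (Series (fun n => Rabs (fst (Cconj z * u n)%C))).
  - eapply Rle_trans; [apply Rle_abs|]. apply Series_Rabs.
    apply (@ex_series_le R_AbsRing R_CompleteNormedModule _ (fun n => Cmod (Cconj z * u n))); auto.
    intros n. unfold norm; simpl. rewrite Rabs_Rabsolu. apply (fst_le_Cmod (Cconj z * u n)%C).
  - apply Series_le.
    + intros n. split; [apply Rabs_pos|]. eapply Rle_trans; [apply fst_le_Cmod|].
      rewrite Cmod_mult, Cmod_conj. lra.
    + apply (ex_series_scal (K := R_AbsRing) (V := R_NormedModule)); auto.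
Qed.

Lemma is_series_single (f : nat -> R) m : (forall n, n <> m -> f n = 0) -> is_series f (f m).
Proof.
  intros H.
  assert (A : forall n, (n <= m)%nat -> fsum f n = 0).
  { induction n as [|n IH]; intros L; simpl; auto. rewrite IH, H by lia. ring. }
  assert (B : forall k, fsum f (S m + k) = f m).
  { induction k as [|k IH].
    - rewrite Nat.add_0_r. simpl. rewrite A by lia. ring.
    - rewrite Nat.add_succ_r. simpl in *. rewrite IH, (H (S (m + k))) by lia. ring. }
  apply (is_lim_seq_ext_loc (fun _ => f m) (sum_n f) (f m)).
  - exists m. intros n Hn. rewrite <- fsum_sum_n. replace (S n) with (S m + (n - m))%nat by lia. rewrite B. auto.
  - apply is_lim_seq_const.
Qed.

Lemma CSeries_single (u : nat -> C) m : (forall n, n <> m -> u n = 0) -> CSeries u = u m.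
Proof.
  intros H. unfold CSeries.
  rewrite (is_series_unique _ _ (is_series_single (fun n => fst (u n)) m (fun n N => f_equal fst (H n N)))).
  rewrite (is_series_unique _ _ (is_series_single (fun n => snd (u n)) m (fun n N => f_equal snd (H n N)))).
  destruct (u m); auto.
Qed.

Lemma ex_series_eventually_le (f g : nat -> R) K N :
  (forall n, (N <= n)%nat -> 0 <= f n <= K * g n) -> ex_series g -> ex_series f.
Proof.
  intros H Hg. apply (ex_series_incr_n f N).
  apply (@ex_series_le R_AbsRing R_CompleteNormedModule _ (fun k => K * g (N + k)%nat)).
  - intros k. unfold norm; simpl. specialize (H (N + k)%nat ltac:(lia)).
    change (Rabs (f (N + k)%nat) <= K * g (N + k)%nat). rewrite Rabs_pos_eq; lra.
  - apply (ex_series_scal (K := R_AbsRing) (V := R_NormedModule)).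
    apply (ex_series_incr_n g N). auto.
Qed.

Lemma ex_series_lincomb (f g : nat -> R) a b : ex_series f -> ex_series g -> ex_series (fun n => a * f n + b * g n).
Proof.
  intros Hf Hg. apply (ex_series_plus (K := R_AbsRing) (V := R_NormedModule));
  apply (ex_series_scal (K := R_AbsRing) (V := R_NormedModule)); auto.
Qed.

Lemma ex_series_le_pos (f g : nat -> R) : (forall n, 0 <= f n <= g n) -> ex_series g -> ex_series f.
Proof.
  intros H. apply (ex_series_eventually_le f g 1 0). intros n _. specialize (H n). lra.
Qed.

(** * Cauchy transforms of the coefficients *)

Lemma far_points (t : nat -> C) : is_lim_seq (fun n => Cmod (t n)) p_infty -> forall z, exists N, forall n, (N <= n)%nat ->
  (Cmod (t n) + 1) / 2 <= Cmod (z - t n).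
Proof.
  intros Ht z. apply is_lim_seq_spec in Ht. destruct (Ht (2 * Cmod z + 1)) as [N HN].
  exists N. intros n Hn. specialize (HN n Hn). rewrite Cmod_sub_sym.
  pose proof (Cmod_minus_ge (t n) z). lra.
Qed.

Lemma kernel_summable t (a : nat -> C) z : is_lim_seq (fun n => Cmod (t n)) p_infty ->
  ex_series (fun n => Cmod (a n) / (Cmod (t n) + 1)) ->
  ex_series (fun n => Cmod (a n / (z - t n))).
Proof.
  intros Ht Ha. destruct (far_points t Ht z) as [N HN].
  apply (ex_series_eventually_le _ (fun n => Cmod (a n) / (Cmod (t n) + 1)) 2 N); auto.
  intros n Hn. specialize (HN n Hn). pose proof (Cmod_ge_0 (t n)) as Pt. pose proof (Cmod_ge_0 (a n)) as Pa.
  split; [apply Cmod_ge_0|].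
  assert (Nz : (z - t n <> 0)%C). { intros E. rewrite E, Cmod_0 in HN. lra. }
  rewrite Cmod_div by auto.
  replace (2 * (Cmod (a n) / (Cmod (t n) + 1))) with (Cmod (a n) * / ((Cmod (t n) + 1) / 2)) by (field; lra).
  apply Rmult_le_compat_l; auto. apply Rinv_le_contravar; lra.
Qed.

Lemma Kq_off (t : nat -> C) (A : C -> C) n z : z <> t n -> Kq t A n z = (A z / (z - t n))%C.
Proof. intros H. unfold Kq. destruct (excluded_middle_informative (z = t n)); [contradiction|auto]. Qed.

Lemma Kq_at (t : nat -> C) (A : C -> C) n : Kq t A n (t n) = C_derive A (t n).
Proof. unfold Kq. destruct (excluded_middle_informative (t n = t n)); [auto|congruence]. Qed.

Lemma Kq_summable (t : nat -> C) (A : C -> C) (a : nat -> C) z : is_lim_seq (fun n => Cmod (t n)) p_infty ->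
  ex_series (fun n => Cmod (a n) / (Cmod (t n) + 1)) ->
  ex_series (fun n => Cmod (a n * Kq t A n z)).
Proof.
  intros Ht Ha. destruct (far_points t Ht z) as [N HN].
  apply (ex_series_eventually_le _ (fun n => Cmod (a n / (z - t n))) (Cmod (A z)) N).
  2:{ apply kernel_summable; auto. }
  intros n Hn. specialize (HN n Hn). pose proof (Cmod_ge_0 (t n)) as Pt.
  split; [apply Cmod_ge_0|].
  assert (Nz : z <> t n). { intros E. rewrite E in HN. replace (t n - t n)%C with (RtoC 0) in HN by ring. rewrite Cmod_0 in HN. lra. }
  rewrite Kq_off by auto. rewrite <- Cmod_mult. right. f_equal. field. apply Csub_neq; auto.
Qed.

Lemma CSeries_Kq_off (t : nat -> C) (A : C -> C) (a : nat -> C) z : is_lim_seq (fun n => Cmod (t n)) p_infty ->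
  ex_series (fun n => Cmod (a n) / (Cmod (t n) + 1)) -> (forall n, z <> t n) ->
  CSeries (fun n => a n * Kq t A n z)%C = (A z * CSeries (fun n => a n / (z - t n)))%C.
Proof.
  intros Ht Ha Hz. rewrite <- CSeries_scal by (apply kernel_summable; auto).
  apply CSeries_ext. intros n. rewrite Kq_off by auto. field. apply Csub_neq; auto.
Qed.

Lemma CSeries_Kq_at (t : nat -> C) (A : C -> C) (a : nat -> C) m : (forall n, A (t n) = 0) -> (forall i j, t i = t j -> i = j) ->
  CSeries (fun n => a n * Kq t A n (t m))%C = (a m * C_derive A (t m))%C.
Proof.
  intros HA Hinj. rewrite (CSeries_single _ m), Kq_at; auto.
  intros n Hn. rewrite Kq_off, HA; [unfold Cdiv; ring|]. intros E. apply Hn. symmetry. apply Hinj, E.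
Qed.

Lemma Cauchy_sum_bound t (a : nat -> C) z : is_lim_seq (fun n => Cmod (t n)) p_infty ->
  ex_series (fun n => Cmod (a n) / (Cmod (t n) + 1)) -> (forall n, z <> t n) ->
  Cmod (CSeries (fun n => a n / (z - t n))%C) <= Series (fun n => Cmod (a n) / Cmod (z - t n)).
Proof.
  intros Ht Ha Hz. eapply Rle_trans; [apply CSeries_Cmod_le, kernel_summable; auto|].
  right. apply Series_ext. intros n. apply Cmod_div, Csub_neq; auto.
Qed.

Lemma Series_le_scal (f g : nat -> R) k : (forall n, 0 <= f n <= k * g n) -> ex_series g -> Series f <= k * Series g.
Proof.
  intros H Hg. rewrite <- Series_scal_l. apply Series_le; auto.
  apply (ex_series_scal (K := R_AbsRing) (V := R_NormedModule)); auto.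
Qed.

(** Brings the elements of the space into the class of Cauchy transforms that [good_circles]
    handles. It is the inequality of arithmetic and geometric means together with
    [(|t| + 1) ^ 2 >= |t| ^ 2 + 1]. *)
Lemma l2_weight_summable (t : nat -> C) (mu : nat -> R) (c : nat -> C) :
  (forall n, 0 < mu n) -> ex_series (fun n => mu n / (Cmod (t n) ^ 2 + 1)) ->
  ex_series (fun n => Cmod (c n) ^ 2) ->
  ex_series (fun n => Cmod (c n * RtoC (sqrt (mu n))) / (Cmod (t n) + 1)).
Proof.
  intros Hmu Hs Hc.
  apply (ex_series_le_pos _ (fun n => / 2 * Cmod (c n) ^ 2 + / 2 * (mu n / (Cmod (t n) ^ 2 + 1)))).
  2:{ apply ex_series_lincomb; auto. }
  intros n. pose proof (Cmod_ge_0 (t n)) as Pt. pose proof (Cmod_ge_0 (c n)) as Pc.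
  specialize (Hmu n). rewrite Cmod_mult, Cmod_R, Rabs_pos_eq by apply sqrt_pos.
  assert (Ps : 0 < sqrt (mu n)) by (apply sqrt_lt_R0; auto).
  assert (Es : sqrt (mu n) * sqrt (mu n) = mu n) by (apply sqrt_sqrt; lra).
  set (x := sqrt (mu n) / (Cmod (t n) + 1)).
  assert (Px : 0 < x) by (apply Rdiv_lt_0_compat; lra).
  replace (Cmod (c n) * sqrt (mu n) / (Cmod (t n) + 1)) with (Cmod (c n) * x) by (unfold x; field; lra).
  split; [apply Rmult_le_pos; lra|].
  assert (X : x * x <= mu n / (Cmod (t n) ^ 2 + 1)).
  { replace (x * x) with (mu n * / ((Cmod (t n) + 1) ^ 2)) by (rewrite <- Es; unfold x; field; lra).
    apply Rmult_le_compat_l; [lra|]. apply Rinv_le_contravar; nra. }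
  pose proof (Rle_0_sqr (Cmod (c n) - x)) as Q. unfold Rsqr in Q. simpl. simpl in X. lra.
Qed.

(** * The space and the functions [Bgamma] *)

Lemma CdB_funE (t : nat -> C) (A : C -> C) (mu : nat -> R) c z : CdB_fun t A mu c z = CSeries (fun n => c n * RtoC (sqrt (mu n)) * Kq t A n z)%C.
Proof. reflexivity. Qed.

Lemma simple_zero_nearby (A : C -> C) (b : C) : cdiff A b -> A b = 0 -> C_derive A b <> 0 -> exists w, A w <> 0.
Proof.
  intros HA Ab DA. destruct (C_derive_quotient A b HA) as [q [Hq [Eq E]]].
  rewrite <- Eq in DA. destruct (ctn_neq q b 0 Hq DA) as [d [Hd H]].
  set (w := (b + RtoC (d / 2))%C). assert (Ew : (w - b)%C = RtoC (d / 2)) by (unfold w; ring).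
  exists w. intros Aw.
  destruct (H w) as [_ Qw]. { rewrite Ew, Cmod_R, Rabs_pos_eq; lra. }
  specialize (E w). rewrite Aw, Ab, Ew in E.
  apply (Cmult_neq_0 (q w) (RtoC (d / 2))); auto.
  - intros X. apply RtoC_inj in X. lra.
  - rewrite <- E. ring.
Qed.

Lemma RtoC_sqrt_sqr m : 0 < m -> (RtoC (sqrt m) * RtoC (sqrt m) = RtoC m)%C.
Proof. intros H. rewrite <- RtoC_mult, sqrt_sqrt; auto. lra. Qed.

Lemma Rneq_RtoC x : x <> 0 -> RtoC x <> 0.
Proof. intros H E. apply RtoC_inj in E. auto. Qed.

(** The finite order hypothesis speaks of elements of the space. One of them is [A z / (z - t_0)],
    with the single nonzero coefficient [/ sqrt mu_0]; multiplying by [z - t_0] recovers [A]. *)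
Lemma generating_function_growth (t : nat -> C) (A : C -> C) (mu : nat -> R) :
  (forall n, 0 < mu n) -> (forall n, A (t n) = 0) ->
  (forall F, inCdB t A mu F -> finite_order F) -> growth A.
Proof.
  intros Hmu HA Hfin.
  set (c := fun n : nat => if Nat.eq_dec n 0 then RtoC (/ sqrt (mu 0%nat)) else RtoC 0).
  assert (Hs : 0 < sqrt (mu 0%nat)) by (apply sqrt_lt_R0; auto).
  assert (G : growth (CdB_fun t A mu c)).
  { apply finite_order_growth, Hfin. exists c. split; auto.
    exists (Cmod (c 0%nat) ^ 2). apply is_series_single with (m := 0%nat).
    intros n Hn. unfold c. destruct (Nat.eq_dec n 0); [lia|]. rewrite Cmod_0. ring. }
  apply (growth_ext (fun z => (z + - t 0%nat) * CdB_fun t A mu c z)%C).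
  - intros z. rewrite CdB_funE, (CSeries_single _ 0%nat).
    2:{ intros n Hn. unfold c. destruct (Nat.eq_dec n 0); [lia|]. ring. }
    unfold c. simpl Nat.eq_dec. cbv iota. rewrite <- RtoC_mult, Rinv_l, Cmult_1_l by lra.
    destruct (Ceq_dec z (t 0%nat)) as [->|N].
    + rewrite HA. ring.
    + rewrite Kq_off by auto. field. apply Csub_neq; auto.
  - apply growth_mult; auto. apply growth_plus; [apply growth_id|apply growth_const].
Qed.

(* [1/(t_n - z) - 1/(t_n - w) = (z - w) / ((t_n - z)(t_n - w))], so that up to a
   multiple of [A] the function [Bgamma] is [z - w] times an element of the space. *)
Lemma Bgamma_decomposition (t : nat -> C) (A : C -> C) (mu : nat -> R) gamma w :
  is_lim_seq (fun n => Cmod (t n)) p_infty -> (forall n, 0 < mu n) ->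
  ex_series (fun n => mu n / (Cmod (t n) ^ 2 + 1)) ->
  ex_series (fun n => mu n / (Cmod (t n) + 1)) ->
  (forall n, A (t n) = 0) -> A w <> 0 ->
  exists k F, inCdB t A mu F /\ forall z, Bgamma t A mu gamma z = (k * A z + (w - z) * F z)%C.
Proof.
  intros Ht Hmu Hs Hc HA Hw.
  assert (Nw : forall n, w <> t n) by (intros n E; apply Hw; rewrite E; auto).
  assert (Nw' : forall n, (t n - w <> 0)%C) by (intros n; apply Csub_neq; intros E; apply (Nw n); auto).
  (* With these coefficients the element is [A z * sum mu_n / ((t_n - w) (z - t_n))]; their square
     sum is controlled by [mu_n / (|t_n| ^ 2 + 1)]. *)
  set (c := fun n => (RtoC (sqrt (mu n)) / (t n - w))%C).
  assert (Hc2 : ex_series (fun n => Cmod (c n) ^ 2)).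
  { destruct (far_points t Ht w) as [N HN].
    apply (ex_series_eventually_le _ (fun n => mu n / (Cmod (t n) ^ 2 + 1)) 4 N); auto.
    intros n Hn. specialize (HN n Hn). rewrite Cmod_sub_sym in HN. pose proof (Cmod_ge_0 (t n)) as Pt.
    split; [apply pow_le, Cmod_ge_0|]. unfold c. rewrite Cmod_div, Cmod_R, Rabs_pos_eq by (auto; apply sqrt_pos).
    assert (P : 0 < Cmod (t n - w)) by (apply Cmod_pos; auto).
    unfold Rdiv. rewrite Rpow_mult_distr, pow2_sqrt by (left; auto).
    replace (4 * (mu n * / (Cmod (t n) ^ 2 + 1))) with (mu n * (/ ((Cmod (t n) ^ 2 + 1) / 4))) by (field; nra).
    apply Rmult_le_compat_l; [left; auto|]. rewrite pow_inv. apply Rinv_le_contravar; nra. }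
  set (kap := CSeries (fun n => RtoC (mu n) / (t n - w))%C).
  exists (gamma + kap)%C, (CdB_fun t A mu c).
  split. { exists c. auto. }
  intros z. unfold Bgamma. rewrite CdB_funE.
  assert (Hmuc : ex_series (fun n => Cmod (RtoC (mu n)) / (Cmod (t n) + 1))).
  { apply (ex_series_ext (fun n => mu n / (Cmod (t n) + 1))); auto. intros n. rewrite Cmod_R, Rabs_pos_eq; auto. left; auto. }
  assert (S1 : ex_series (fun n => Cmod (RtoC (mu n) / (t n - w)))).
  { apply (ex_series_ext (fun n => Cmod (RtoC (mu n) / (w - t n)))).
    - intros n. rewrite !Cmod_div, (Cmod_sub_sym w); auto. apply Csub_neq; auto.
    - apply kernel_summable; auto. }
  assert (S2 : ex_series (fun n => Cmod (c n * RtoC (sqrt (mu n)) * Kq t A n z))).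
  { apply (Kq_summable t A (fun n => c n * RtoC (sqrt (mu n)))%C); auto. apply l2_weight_summable; auto. }
  assert (Sc : forall k u, ex_series (fun n => Cmod (u n)) -> ex_series (fun n => Cmod (k * u n))).
  { intros k u Hu. apply (ex_series_ext (fun n => Cmod k * Cmod (u n))).
    - intros n. rewrite Cmod_mult. auto.
    - apply (ex_series_scal (K := R_AbsRing) (V := R_NormedModule)); auto. }
  rewrite (CSeries_ext _ (fun n => (- A z) * (RtoC (mu n) / (t n - w)) + (z - w) * (c n * RtoC (sqrt (mu n)) * Kq t A n z))%C).
  - rewrite CSeries_plus, !CSeries_scal by auto. fold kap. ring.
  - intros n. unfold c.
    replace (RtoC (sqrt (mu n)) / (t n - w) * RtoC (sqrt (mu n)) * Kq t A n z)%C
      with (RtoC (sqrt (mu n)) * RtoC (sqrt (mu n)) * Kq t A n z / (t n - w))%C by (unfold Cdiv; ring).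
    rewrite RtoC_sqrt_sqr by auto.
    destruct (Ceq_dec z (t n)) as [->|N].
    + rewrite HA. field. auto.
    + rewrite Kq_off by auto. field. split; auto. apply Csub_neq; auto.
Qed.

(** Differentiability is inherited from the elements of the space, since [finite_order] includes
    [entire]; no locally uniform convergence of the series has to be shown. *)
Lemma Bgamma_entire_growth (t : nat -> C) (A : C -> C) (mu : nat -> R) gamma :
  is_lim_seq (fun n => Cmod (t n)) p_infty -> (forall n, 0 < mu n) ->
  ex_series (fun n => mu n / (Cmod (t n) ^ 2 + 1)) ->
  ex_series (fun n => mu n / (Cmod (t n) + 1)) ->
  (forall n, A (t n) = 0) -> (forall z, cdiff A z) -> (exists w, A w <> 0) ->
  (forall F, inCdB t A mu F -> finite_order F) ->
  (forall z, cdiff (Bgamma t A mu gamma) z) /\ growth (Bgamma t A mu gamma).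
Proof.
  intros Ht Hmu Hs Hc HA HAd [w Hw] Hfin.
  destruct (Bgamma_decomposition t A mu gamma w Ht Hmu Hs Hc HA Hw) as [k [F [HF E]]].
  apply Hfin in HF. pose proof (finite_order_growth F HF) as GF.
  destruct HF as [EF _]. rewrite entire_cdiff in EF.
  split.
  - intros z. apply (cdiff_ext (fun z => k * A z + (w - z) * F z)%C); [intros; symmetry; apply E|].
    apply cdiff_plus; apply cdiff_mult; auto; [apply cdiff_const|].
    apply cdiff_minus; [apply cdiff_const|apply cdiff_id].
  - apply (growth_ext (fun z => k * A z + (w + (-1) * z) * F z)%C). { intros z. rewrite E. ring. }
    apply growth_plus; apply growth_mult; auto; [apply growth_const| |].
    + apply (generating_function_growth t A mu); auto.
    + apply growth_plus; [apply growth_const|]. apply growth_mult; [apply growth_const|apply growth_id].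
Qed.

Lemma Bgamma_at (t : nat -> C) (A : C -> C) (mu : nat -> R) gamma m : (forall n, A (t n) = 0) -> (forall i j, t i = t j -> i = j) ->
  Bgamma t A mu gamma (t m) = (- (RtoC (mu m) * C_derive A (t m)))%C.
Proof. intros HA Hinj. unfold Bgamma. rewrite CSeries_Kq_at, HA; auto. ring. Qed.

Lemma Bgamma_off (t : nat -> C) (A : C -> C) (mu : nat -> R) gamma z : is_lim_seq (fun n => Cmod (t n)) p_infty -> (forall n, 0 < mu n) ->
  ex_series (fun n => mu n / (Cmod (t n) + 1)) -> (forall n, z <> t n) ->
  Bgamma t A mu gamma z = (A z * (gamma - CSeries (fun n => RtoC (mu n) / (z - t n))))%C.
Proof.
  intros Ht Hmu Hc Hz. unfold Bgamma. rewrite CSeries_Kq_off; auto.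
  - ring.
  - apply (ex_series_ext (fun n => mu n / (Cmod (t n) + 1))); auto.
    intros n. rewrite Cmod_R, Rabs_pos_eq; auto. left; auto.
Qed.

(** By [z / (z - t) = 1 + t / (z - t)] the transform is [CSeries a / z] up to a remainder, which is
    again a Cauchy transform, now with the weights [a n * t n]. *)
Lemma Cauchy_sum_shift t (a : nat -> C) z : is_lim_seq (fun n => Cmod (t n)) p_infty ->
  ex_series (fun n => Cmod (a n)) -> (forall n, z <> t n) ->
  Cmod (z * CSeries (fun n => a n / (z - t n)) - CSeries a)%C <=
    Series (fun n => Cmod (a n) * Cmod (t n) / Cmod (z - t n)).
Proof.
  intros Ht Ha Hz.
  assert (P : forall n, 0 < Cmod (t n) + 1) by (intros n; pose proof (Cmod_ge_0 (t n)); lra).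
  assert (H1 : ex_series (fun n => Cmod (a n) / (Cmod (t n) + 1))).
  { apply (ex_series_le_pos _ (fun n => Cmod (a n))); auto. intros n.
    pose proof (Cmod_ge_0 (a n)) as Pa. pose proof (Cmod_ge_0 (t n)) as Pt. specialize (P n).
    split; [apply Rdiv_le_0_compat; auto|].
    apply Rmult_le_reg_r with (Cmod (t n) + 1); auto. unfold Rdiv. rewrite Rmult_assoc, Rinv_l by lra. nra. }
  assert (H2 : ex_series (fun n => Cmod (a n * t n) / (Cmod (t n) + 1))).
  { apply (ex_series_le_pos _ (fun n => Cmod (a n))); auto. intros n. rewrite Cmod_mult.
    pose proof (Cmod_ge_0 (a n)) as Pa. pose proof (Cmod_ge_0 (t n)) as Pt. specialize (P n).
    split; [apply Rdiv_le_0_compat; auto; nra|].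
    apply Rmult_le_reg_r with (Cmod (t n) + 1); auto. unfold Rdiv. rewrite Rmult_assoc, Rinv_l by lra. nra. }
  rewrite <- CSeries_scal by (apply kernel_summable; auto).
  rewrite (CSeries_ext (fun n => z * (a n / (z - t n)))%C (fun n => a n + a n * t n / (z - t n))%C).
  2:{ intros n. field. apply Csub_neq; auto. }
  rewrite CSeries_plus; auto.
  2:{ apply (kernel_summable t (fun n => a n * t n)%C); auto. }
  match goal with |- Cmod ?x <= _ => replace x with (CSeries (fun n => a n * t n / (z - t n))%C) by ring end.
  eapply Rle_trans; [apply (Cauchy_sum_bound t (fun n => a n * t n)%C); auto|].
  right. apply Series_ext. intros n. rewrite Cmod_mult. auto.
Qed.

Lemma CSeries_RtoC (mu : nat -> R) : CSeries (fun n => RtoC (mu n)) = RtoC (Series mu).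
Proof.
  unfold CSeries, RtoC. simpl. f_equal.
  apply is_series_unique. apply (is_series_single (fun _ => 0) 0%nat). auto.
Qed.

(** * Uniqueness for nonzero gamma, and dimension one for gamma = 0 *)

Theorem theorem1p5
  (t : nat -> C) (mu : nat -> R) (A : C -> C)
  (* T = {t_n} distinct, |t_n| -> infinity *)
  (ht_inj : forall m n : nat, t m = t n -> m = n)
  (ht_inf : is_lim_seq (fun n => Cmod (t n)) p_infty)
  (* mu_n > 0, sum mu_n / (|t_n|^2 + 1) < infinity *)
  (hmu_pos : forall n, 0 < mu n)
  (hmu_sum : ex_series (fun n => mu n / (Cmod (t n) ^ 2 + 1)))
  (* A entire, zeros exactly at T, all simple *)
  (hA_ent : entire A)
  (hA_zero : forall z : C, A z = 0 <-> exists n, z = t n)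
  (hA_simple : forall n, C_derive A (t n) <> 0)
  (* convergence class *)
  (hconv : ex_series (fun n => mu n / (Cmod (t n) + 1)))
  (* finite order: every element of the space has finite order *)
  (hfin : forall F : C -> C, inCdB t A mu F -> finite_order F) :
  (* 1. Z(B_gamma), gamma <> 0, is a uniqueness set *)
  (forall gamma : C, gamma <> 0 ->
     forall F : C -> C, inCdB t A mu F ->
       vanishes_on_zeros (Bgamma t A mu gamma) F -> forall z, F z = 0)
  /\
  (* 2. for small spaces, the functions vanishing on Z(B_0) form a
        one-dimensional subspace *)
  (ex_series mu ->
     exists F0 : C -> C,
       inCdB t A mu F0 /\ vanishes_on_zeros (Bgamma t A mu 0) F0 /\
       (exists z, F0 z <> 0) /\
       forall F : C -> C, inCdB t A mu F ->
         vanishes_on_zeros (Bgamma t A mu 0) F ->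
         exists lam : C, forall z, F z = (lam * F0 z)%C).
Proof.
  assert (HA : forall n, A (t n) = 0) by (intros n; apply hA_zero; exists n; auto).
  assert (HAd : forall z, cdiff A z) by (apply entire_cdiff; auto).
  assert (HA1 : exists w, A w <> 0) by (apply (simple_zero_nearby A (t 0%nat)); auto).
  (* The value at [t_0] is [- mu_0 A'(t_0)]. This gives a point off the zeros, both for dividing by
     [Bgamma] and for Jensen's inequality. *)
  assert (B0 : forall gamma, Bgamma t A mu gamma (t 0%nat) <> 0).
  { intros gamma. rewrite Bgamma_at by auto. intros E.
    apply (Cmult_neq_0 (RtoC (mu 0%nat)) (C_derive A (t 0%nat))); auto.
    - apply Rneq_RtoC, Rgt_not_eq, hmu_pos.
    - rewrite <- (Copp_0), <- E. ring. }
  assert (Quot : forall gamma F, inCdB t A mu F -> vanishes_on_zeros (Bgamma t A mu gamma) F ->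
    exists S, (forall z, cdiff S z) /\ growth S /\ forall z, F z = (S z * Bgamma t A mu gamma z)%C).
  { intros gamma F HF HV.
    destruct (Bgamma_entire_growth t A mu gamma ht_inf hmu_pos hmu_sum hconv HA HAd HA1 hfin) as [Bd Bg].
    destruct (vanishing_quotient _ F Bd (ex_intro (fun z => Bgamma t A mu gamma z <> 0) _ (B0 gamma)) HV) as [S [HS E]].
    exists S. split; auto. split; auto.
    apply (growth_quotient F (Bgamma t A mu gamma) S (t 0%nat)); auto.
    apply finite_order_growth; auto. }
  assert (Az : forall z, (forall n, z <> t n) -> A z <> 0).
  { intros z Hz E. apply hA_zero in E. destruct E as [n E]. apply (Hz n); auto. }
  assert (Cmu : forall n, Cmod (RtoC (mu n)) = mu n).
  { intros n. rewrite Cmod_R, Rabs_pos_eq; auto. left; auto. }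
  assert (Pinv : forall u n, u <> t n -> 0 < / Cmod (u - t n)).
  { intros u n Hu. apply Rinv_0_lt_compat, Cmod_pos, Csub_neq; auto. }
  split.
  - intros gamma Hg F HF HV.
    destruct (Quot gamma F HF HV) as [S [HS [GS E]]].
    destruct HF as [c [Hc ->]]. set (a := fun n => (c n * RtoC (sqrt (mu n)))%C).
    assert (Ha : ex_series (fun n => Cmod (a n) / (Cmod (t n) + 1))) by (apply l2_weight_summable; auto).
    assert (Pg := Cmod_pos _ Hg).
    enough (S0 : forall z, S z = 0) by (intros z; rewrite E, S0; ring).
    intros z. apply Cmod_le_all_eps. intros M HM. revert z.
    (* Where the potential is below 1, the two Cauchy sums [P] and [Q] below satisfy
       [|P| <= / p = M |gamma| / 2] and [|Q| <= / q = |gamma| / 2]. Hence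
       [|gamma - Q| >= |gamma| / 2] and [|S| <= M], with [M] arbitrarily small. *)
    set (p := 2 / (M * Cmod gamma)). set (q := 2 / Cmod gamma).
    assert (Pp : 0 < p) by (apply Rdiv_lt_0_compat; [lra|apply Rmult_lt_0_compat; auto]).
    assert (Pq : 0 < q) by (apply Rdiv_lt_0_compat; lra).
    apply (potential_bound S t (fun n => p * Cmod (a n) + q * mu n)); auto.
    + intros n. pose proof (Cmod_ge_0 (a n)). specialize (hmu_pos n). nra.
    + apply (ex_series_ext (fun n => p * (Cmod (a n) / (Cmod (t n) + 1)) + q * (mu n / (Cmod (t n) + 1)))).
      * intros n. match goal with |- ?x = ?y => change (@eq R x y) end. unfold Rdiv. ring.
      * apply ex_series_lincomb; auto.
    + intros u Hu Hex Hlt.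
      set (nu := fun n => (p * Cmod (a n) + q * mu n) / Cmod (u - t n)) in *.
      assert (X : Cmod (CSeries (fun n => a n / (u - t n))%C) <= / p * Series nu).
      { eapply Rle_trans; [apply Cauchy_sum_bound; auto|]. apply Series_le_scal; auto.
        intros n. specialize (Pinv u n (Hu n)). pose proof (Cmod_ge_0 (a n)). specialize (hmu_pos n).
        unfold nu, Rdiv. split; [apply Rmult_le_pos; lra|].
        replace (/ p * ((p * Cmod (a n) + q * mu n) * / Cmod (u - t n)))
          with (Cmod (a n) * / Cmod (u - t n) + / p * q * mu n * / Cmod (u - t n)) by (field; split; [apply Rgt_not_eq, Cmod_pos, Csub_neq; auto|lra]).
        assert (0 <= / p * q * mu n * / Cmod (u - t n)); [|lra].
        assert (0 < / p) by (apply Rinv_0_lt_compat; auto). left. apply Rmult_lt_0_compat; [apply Rmult_lt_0_compat; [apply Rmult_lt_0_compat|]|]; auto. }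
      assert (Y : Cmod (CSeries (fun n => RtoC (mu n) / (u - t n))%C) <= / q * Series nu).
      { eapply Rle_trans; [apply Cauchy_sum_bound; auto|].
        - apply (ex_series_ext (fun n => mu n / (Cmod (t n) + 1))); auto. intros n. rewrite Cmu. auto.
        - apply Series_le_scal; auto.
          intros n. rewrite Cmu. specialize (Pinv u n (Hu n)). pose proof (Cmod_ge_0 (a n)). specialize (hmu_pos n).
          unfold nu, Rdiv. split; [apply Rmult_le_pos; lra|].
          replace (/ q * ((p * Cmod (a n) + q * mu n) * / Cmod (u - t n)))
            with (mu n * / Cmod (u - t n) + / q * p * (Cmod (a n) * / Cmod (u - t n))) by (field; split; [apply Rgt_not_eq, Cmod_pos, Csub_neq; auto|lra]).
          assert (0 <= / q * p * (Cmod (a n) * / Cmod (u - t n))); [|lra].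
          apply Rmult_le_pos; [|apply Rmult_le_pos; lra].
          left. apply Rmult_lt_0_compat; auto. apply Rinv_0_lt_compat; auto. }
      specialize (E u). rewrite CdB_funE, Bgamma_off in E; auto.
      rewrite (CSeries_Kq_off t A a) in E; auto.
      set (P := CSeries (fun n => a n / (u - t n))%C) in *.
      set (Q := CSeries (fun n => RtoC (mu n) / (u - t n))%C) in *.
      assert (PA := Cmod_pos _ (Az u Hu)).
      assert (E' : Cmod (A u) * Cmod P = Cmod (S u) * (Cmod (A u) * Cmod (gamma - Q))).
      { rewrite <- !Cmod_mult. f_equal. exact E. }
      assert (E2 : Cmod P = Cmod (S u) * Cmod (gamma - Q)).
      { apply Rmult_eq_reg_l with (Cmod (A u)); lra. }
      assert (Ip : / p = M * Cmod gamma / 2) by (unfold p; field; lra).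
      assert (Iq : / q = Cmod gamma / 2) by (unfold q; field; lra).
      rewrite Ip in X. rewrite Iq in Y.
      pose proof (Cmod_minus_ge gamma Q) as D.
      assert (0 < M * Cmod gamma) by (apply Rmult_lt_0_compat; auto).
      assert (X1 : Cmod P <= M * (Cmod gamma / 2)) by nra.
      assert (Y1 : Cmod gamma / 2 <= Cmod (gamma - Q)) by nra.
      apply Rmult_le_reg_r with (Cmod gamma / 2); [lra|].
      pose proof (Cmod_ge_0 (S u)). nra.
  (* Smallness says precisely that these coefficients are square summable; they represent
     [Bgamma t A mu 0] itself. *)
  - intros Hsm. set (c0 := fun n => RtoC (- sqrt (mu n))).
    assert (E0 : forall z, CdB_fun t A mu c0 z = Bgamma t A mu 0 z).
    { intros z. rewrite CdB_funE. unfold Bgamma.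
      rewrite (CSeries_ext _ (fun n => (-1) * (RtoC (mu n) * Kq t A n z))%C).
      - rewrite CSeries_scal; [ring|]. apply (Kq_summable t A (fun n => RtoC (mu n))); auto.
        apply (ex_series_ext (fun n => mu n / (Cmod (t n) + 1))); auto. intros n. rewrite Cmu. auto.
      - intros n. unfold c0. rewrite RtoC_opp, <- (RtoC_sqrt_sqr (mu n)) by auto. ring. }
    exists (CdB_fun t A mu c0). split; [|split; [|split]].
    + exists c0. split; auto. apply (ex_series_ext mu); auto.
      intros n. unfold c0. rewrite Cmod_R, Rabs_Ropp, Rabs_pos_eq by apply sqrt_pos.
      rewrite pow2_sqrt; auto. left; auto.
    + intros w k [g [Hg Eg]]. exists g. split; auto. intros z. rewrite E0. auto.
    + exists (t 0%nat). rewrite E0. auto.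
    + intros F HF HV. destruct (Quot 0 F HF HV) as [S [HS [GS E]]].
      destruct HF as [c [Hc ->]]. set (a := fun n => (c n * RtoC (sqrt (mu n)))%C).
      assert (Ha : ex_series (fun n => Cmod (a n) / (Cmod (t n) + 1))) by (apply l2_weight_summable; auto).
      assert (Ha1 : ex_series (fun n => Cmod (a n))).
      { apply (ex_series_le_pos _ (fun n => / 2 * Cmod (c n) ^ 2 + / 2 * mu n)).
        2:{ apply ex_series_lincomb; auto. }
        intros n. split; [apply Cmod_ge_0|]. unfold a.
        rewrite Cmod_mult, Cmod_R, Rabs_pos_eq by apply sqrt_pos.
        rewrite <- (sqrt_sqrt (mu n)) at 2 by (left; auto).
        pose proof (Rle_0_sqr (Cmod (c n) - sqrt (mu n))) as Q. unfold Rsqr in Q. simpl. lra. }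
      set (m := Series mu).
      assert (Pm : 0 < m).
      { apply Rlt_le_trans with (fsum mu 1); [simpl; specialize (hmu_pos 0%nat); lra|].
        apply fsum_le_Series; auto. intros; left; auto. }
      (* Where the potential is below 1, both remainders from [Cauchy_sum_shift] are at most
         [/ q = m / 2], so [|u * Q|] stays above [m / 2]. *)
      set (q := 2 / m). assert (Pq : 0 < q) by (apply Rdiv_lt_0_compat; lra).
      assert (Iq : / q = m / 2) by (unfold q; field; lra).
      set (al := Series (fun n => Cmod (a n))).
      assert (Pal : 0 <= al). { apply (fsum_le_Series (fun n => Cmod (a n)) 0); auto. intros; apply Cmod_ge_0. }
      (* The bound [al + m / 2] for [|u * P|] over the lower bound [m / 2] for [|u * Q|]. *)
      set (M := (al + m / 2) / (m / 2)).
      assert (PM : 0 < M) by (apply Rdiv_lt_0_compat; lra).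
      assert (SM : forall z, Cmod (S z) <= M).
      (* The factor [|t_n| + 1] dominates the [|t_n|] of the remainders, and it cancels the
         denominator in the summability condition, leaving the sums of [|a_n|] and [mu_n]. *)
      { apply (potential_bound S t (fun n => q * (Cmod (a n) + mu n) * (Cmod (t n) + 1))); auto.
        - intros n. pose proof (Cmod_ge_0 (a n)). pose proof (Cmod_ge_0 (t n)). specialize (hmu_pos n).
          apply Rmult_lt_0_compat; [apply Rmult_lt_0_compat|]; lra.
        - apply (ex_series_ext (fun n => q * Cmod (a n) + q * mu n)).
          + intros n. pose proof (Cmod_ge_0 (t n)). match goal with |- ?x = ?y => change (@eq R x y) end. field. lra.
          + apply ex_series_lincomb; auto.
        - intros u Hu Hex Hlt.
          set (nu := fun n => q * (Cmod (a n) + mu n) * (Cmod (t n) + 1) / Cmod (u - t n)) in *.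
          assert (Dom : forall x n, 0 <= x <= Cmod (a n) + mu n ->
            0 <= x * Cmod (t n) / Cmod (u - t n) <= / q * nu n).
          { intros x n Hx. specialize (Pinv u n (Hu n)). pose proof (Cmod_ge_0 (t n)).
            unfold nu, Rdiv. split; [apply Rmult_le_pos; [apply Rmult_le_pos; lra|lra]|].
            replace (/ q * (q * (Cmod (a n) + mu n) * (Cmod (t n) + 1) * / Cmod (u - t n)))
              with ((Cmod (a n) + mu n) * (Cmod (t n) + 1) * / Cmod (u - t n)) by (field; split; [apply Rgt_not_eq, Cmod_pos, Csub_neq; auto|lra]).
            apply Rmult_le_compat_r; [lra|]. apply Rmult_le_compat; lra. }
          assert (X := Cauchy_sum_shift t a u ht_inf Ha1 Hu).
          assert (Y := Cauchy_sum_shift t (fun n => RtoC (mu n)) u ht_inf).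
          assert (Y' := Y (ex_series_ext mu _ (fun n => eq_sym (Cmu n)) Hsm) Hu). clear Y.
          assert (X1 : Series (fun n => Cmod (a n) * Cmod (t n) / Cmod (u - t n)) <= / q * Series nu).
          { apply Series_le_scal; auto. intros n. apply Dom. pose proof (Cmod_ge_0 (a n)). specialize (hmu_pos n). lra. }
          assert (Y1 : Series (fun n => Cmod (RtoC (mu n)) * Cmod (t n) / Cmod (u - t n)) <= / q * Series nu).
          { apply Series_le_scal; auto. intros n. rewrite Cmu. apply Dom. pose proof (Cmod_ge_0 (a n)). specialize (hmu_pos n). lra. }
          rewrite CSeries_RtoC in Y'. fold m in Y'.
          specialize (E u). rewrite CdB_funE, Bgamma_off in E; auto.
          rewrite (CSeries_Kq_off t A a) in E; auto.
          set (P := CSeries (fun n => a n / (u - t n))%C) in *.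
          set (Q := CSeries (fun n => RtoC (mu n) / (u - t n))%C) in *.
          assert (PA := Cmod_pos _ (Az u Hu)).
          assert (E2 : Cmod (u * P) = Cmod (S u) * Cmod (u * Q)).
          { apply Rmult_eq_reg_l with (Cmod (A u)); [|lra].
            replace (Cmod (A u) * (Cmod (S u) * Cmod (u * Q))) with (Cmod (u * (S u * (A u * (0 - Q))))).
            - rewrite <- E, <- Cmod_mult. f_equal. ring.
            - rewrite <- !Cmod_mult. rewrite <- Cmod_opp. f_equal. ring. }
          rewrite Iq in X1, Y1.
          pose proof (Cmod_minus_ge (u * P) (CSeries a)) as D1.
          pose proof (CSeries_Cmod_le a Ha1) as D2. fold al in D2.
          pose proof (Cmod_minus_ge (RtoC m) (u * Q)) as D3. rewrite Cmod_sub_sym, Cmod_R, Rabs_pos_eq in D3 by lra.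
          assert (Hh : m / 2 * Series nu <= m / 2) by nra.
          assert (X2 : Cmod (u * P) <= al + m / 2) by lra.
          assert (Y2 : m / 2 <= Cmod (u * Q)) by lra.
          apply Rmult_le_reg_r with (m / 2); [lra|].
          unfold M. replace ((al + m / 2) / (m / 2) * (m / 2)) with (al + m / 2) by (field; lra).
          pose proof (Cmod_ge_0 (S u)). nra. }
      exists (S 0). intros z. rewrite E, E0, (liouville S M HS SM z). auto.
Qed.
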